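(* Let $0\le m\le n$. For every Suslin set $A\subset\Upsilon(\mathbb R^n)$, the map $(0,\infty)\ni r\mapsto\rho^m_r(A)$ is monotone non-decreasing, where $\rho_r^m$ is the localised $m$-codimensional Poisson measure on $\Upsilon(\mathbb R^n)$.
   Context: $B_r\subset\mathbb R^n$ is the closed ball of radius $r>0$ centred at $0$, $B_r^c$ its complement. $\Upsilon(\mathbb R^n)$ is the set of locally finite point measures $\gamma=\sum_i\delta_{x_i}$ on $\mathbb R^n$ with $\gamma(\{x\})\in\{0,1\}$ for all $x$, with the vague topology (convergence against $C_c(\mathbb R^n)$; it is Polish). For $A\subset\mathbb R^n$, $\Upsilon(A)$ is the set of configurations concentrated on $A$ (relative topology), $\Upsilon^k(A)=\{\gamma\in\Upsilon(A):\gamma(A)=k\}$. $\pi_A$ is the Poisson measure on $\Upsilon(A)$ whose intensity is Lebesgue measure on $A$. A Suslin set is a set of the form $\bigcup_{\phi\in\mathbb N^{\mathbb N}}\bigcap_{l\ge1}E_{\phi|_l}$ with all $E_{\phi|_l}$ closed, $\phi|_l=(\phi_1,\dots,\phi_l)$ (equivalently, an analytic set). For $A\subset\Upsilon(\mathbb R^n)$ and $\eta\in\Upsilon(B_r^c)$: $A_{\eta,r}=\{\gamma\in\Upsilon(B_r):\gamma+\eta\in A\}$. $\mathbf S^d$ is the $d$-dimensional spherical Hausdorff measure on Euclidean space: $\mathbf S^d(A)=\lim_{\varepsilon\to0}\inf\{\sum_i\omega_d2^{-d}\mathrm{diam}(B_i)^d\}$, the infimum over countable covers of $A$ by open balls of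 diameter $<\varepsilon$, with $\omega_d=\Gamma(1/2)^d/\Gamma(d/2+1)$, so that $\mathbf S^d$ is Lebesgue measure on $\mathbb R^d$. Let $\mathsf s_k:(x_1,\dots,x_k)\mapsto\sum_i\delta_{x_i}$ from $B_r^{\times k}$ minus the set of tuples with two equal entries to $\Upsilon^k(B_r)$. Put $\mathsf S^{m,k}_{B_r}(A)=\frac1{k!}\mathbf S^{nk-m}(\mathsf s_k^{-1}(A))$ for $A\subset\Upsilon^k(B_r)$; $\rho^m_{\Upsilon(B_r)}(A)=e^{-\mathbf S^n(B_r)}\sum_{k=1}^\infty\mathsf S^{m,k}_{B_r}(A\cap\Upsilon^k(B_r))$ for Suslin $A\subset\Upsilon(B_r)$; and $\rho_r^m(A)=\int_{\Upsilon(B_r^c)}\rho^m_{\Upsilon(B_r)}(A_{\eta,r})\,d\pi_{B_r^c}(\eta)$ for Suslin $A\subset\Upsilon(\mathbb R^n)$ (the integrand is $\pi_{B_r^c}$-measurable). *)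

(* Defs.v *)
From HB Require Import structures.
From mathcomp Require Import all_boot all_order all_algebra.
From mathcomp Require Import all_classical all_reals all_analysis.
Set Implicit Arguments.
Unset Strict Implicit.
Unset Printing Implicit Defensive.
Import Order.TTheory GRing.Theory Num.Theory.
Import numFieldNormedType.Exports.
Local Open Scope classical_set_scope.
Local Open Scope ring_scope.

(* Points of R^n are row vectors 'rV[R]_n.  A k-tuple of points is a matrix   *)
(* in 'M[R]_(k, n) whose rows are the points, so that (R^n)^k is R^(nk) with  *)
(* its Euclidean metric.                                                      *)

Section euclidean.
Context {R : realType} {p q : nat}.

(* The library norm on matrices is the sup norm. *)
Definition enorm (x : 'M[R]_(p, q)) : R :=
  Num.sqrt (\sum_(i < p) \sum_(j < q) x i j ^+ 2).

Definition open_eball (c : 'M[R]_(p, q)) (r : R) : set 'M[R]_(p, q) :=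
  [set x | enorm (x - c) < r].

Definition closed_eball0 (r : R) : set 'M[R]_(p, q) := [set x | enorm x <= r].

(* Only used on balls, where the supremum is taken over a nonempty bounded
   set. *)
Definition diam (A : set 'M[R]_(p, q)) : R :=
  sup [set enorm (z.1 - z.2) | z in A `*` A].

End euclidean.

Section spherical_measure.
Context {R : realType}.

Definition Gamma (s : R) : R :=
  \int[lebesgue_measure]_(x in `]0, +oo[) (x `^ (s - 1) * expR (- x)).

Definition omega (d : nat) : R :=
  Gamma (1 / 2) ^+ d / Gamma (d%:R / 2 + 1).

(* The countable covers are indexed by an arbitrary D : set nat, so that finite
   covers are allowed; this matters for d = 0, where every ball costs 1. *)
Definition spherical_premeasure {p q : nat} (d : nat) (eps : R)
    (A : set 'M[R]_(p, q)) : \bar R :=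
  ereal_inf [set s | exists (D : set nat) (c : nat -> 'M[R]_(p, q))
      (rad : nat -> R),
    [/\ forall i, D i -> 0 < rad i,
        forall i, D i -> diam (open_eball (c i) (rad i)) < eps,
        A `<=` \bigcup_(i in D) open_eball (c i) (rad i) &
        s = (\sum_(i <oo | i \in D)
          (omega d * 2 ^- d * diam (open_eball (c i) (rad i)) ^+ d)%:E)%E]].

Definition spherical_measure {p q : nat} (d : nat) (A : set 'M[R]_(p, q))
    : \bar R :=
  lim (spherical_premeasure d eps A @[eps --> 0^'+]).

End spherical_measure.

Notation borelRn R n := (g_sigma_algebraType (@open 'rV[R]_n)).

Definition lebesgueRn {R : realType} {n : nat} (A : set 'rV[R]_n) : \bar R :=
  ereal_inf [set s | exists (D : set nat) (a b : nat -> 'rV[R]_n),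
    [/\ forall j, D j -> forall i, a j ord0 i <= b j ord0 i,
        A `<=` \bigcup_(j in D)
          [set x | forall i, a j ord0 i <= x ord0 i <= b j ord0 i] &
        s = (\sum_(j <oo | j \in D)
          (\prod_(i < n) (b j ord0 i - a j ord0 i))%:E)%E]].

(* A measure in the library is a function on all sets, constrained only on the
   measurable ones.  The first clause is required of all sets, so two
   configurations that agree on Borel sets are equal. *)
Definition is_config {R : realType} {n : nat}
    (g : {measure set (borelRn R n) -> \bar R}) : Prop :=
  [/\ exists (D : set nat) (x : nat -> borelRn R n),
        forall B, g B = (\sum_(i <oo | i \in D) \d_(x i) B)%E,
      forall K : set 'rV[R]_n, compact K -> (g K < +oo)%E &
      forall x : 'rV[R]_n, g [set x] = 0%E \/ g [set x] = 1%E].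

Record config (R : realType) (n : nat) : Type := Config {
  config_measure :> {measure set (borelRn R n) -> \bar R} ;
  configP : is_config config_measure }.

Lemma is_config0 (R : realType) (n : nat) :
  is_config (mzero : {measure set (borelRn R n) -> \bar R}).
Proof.
split; [|by move=> K _; rewrite /mzero ltry|by left].
exists set0, (fun=> 0 : 'rV[R]_n) => B.
by rewrite eseries_pred0// => i; rewrite in_set0.
Qed.

HB.instance Definition _ (R : realType) (n : nat) :=
  gen_eqMixin (config R n).
HB.instance Definition _ (R : realType) (n : nat) :=
  gen_choiceMixin (config R n).
HB.instance Definition _ (R : realType) (n : nat) :=
  isPointed.Build (config R n) (Config (is_config0 R n)).

Definition Cc (R : realType) (n : nat) : Type :=
  {f : 'rV[R]_n -> R | continuous f /\
    exists2 K : set 'rV[R]_n, compact K & forall x, ~ K x -> f x = 0}.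

Definition vague_ev {R : realType} {n : nat} (f : Cc R n) (g : config R n) : R :=
  \int[g]_(x in [set: borelRn R n]) sval f x.

Definition vague_topology (R : realType) (n : nat) : Type :=
  sup_topology (fun f : Cc R n =>
    Topological.class (initial_topology (vague_ev f))).

HB.instance Definition _ (R : realType) (n : nat) :=
  Topological.copy (config R n) (vague_topology R n).

Notation borel_config R n := (g_sigma_algebraType (@open (config R n))).

Definition suslin {T : topologicalType} (A : set T) : Prop :=
  exists2 E : seq nat -> set T, (forall s, closed (E s)) &
    A = \bigcup_(phi in [set: nat -> nat])
          \bigcap_(l in [set l : nat | (1 <= l)%N]) E (mkseq phi l).

Section codimension_measures.
Context {R : realType} {n : nat}.

Definition Upsilon (A : set 'rV[R]_n) : set (config R n) :=
  [set g : config R n | g (~` A) = 0%E].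

Definition Upsilonk (k : nat) (A : set 'rV[R]_n) : set (config R n) :=
  Upsilon A `&` [set g : config R n | g A = k%:R%:E].

(* The library's poisson_pmf takes the value 1 everywhere at rate 0. *)
Definition poisson_weight (rate : R) (k : nat) : R :=
  expR (- rate) * rate ^+ k / k`!%:R.

(* A measure on Upsilon A is encoded as a measure on the space of all
   configurations that is concentrated on Upsilon A. *)
Definition is_poisson_measure (A : set 'rV[R]_n)
    (P : probability (borel_config R n) R) : Prop :=
  P (Upsilon A) = 1%E /\
  forall (k : nat) (B : 'I_k -> set (borelRn R n)) (c : 'I_k -> nat),
    (forall i, measurable (B i)) ->
    (forall i, (lebesgueRn (B i `&` A) < +oo)%E) ->
    trivIset setT B ->
    P [set g : config R n | forall i, g (B i) = (c i)%:R%:E] =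
    (\prod_(i < k) poisson_weight (fine (lebesgueRn (B i `&` A))) (c i))%:E.

Definition config_section (A : set (config R n)) (eta : config R n) (r : R)
    : set (config R n) :=
  [set g | Upsilon (closed_eball0 r) g /\
    exists2 z : config R n, A z & forall B, z B = (g B + eta B)%E].

Definition labelling_dom (k : nat) (r : R) : set 'M[R]_(k, n) :=
  [set x | (forall i, closed_eball0 r (row i x)) /\
           injective (fun i => row i x)].

Definition labelling (k : nat) (x : 'M[R]_(k, n)) (B : set (borelRn R n))
    : \bar R :=
  (\sum_(i < k) \d_(row i x : borelRn R n) B)%E.

Definition labelling_preimage (k : nat) (r : R) (A : set (config R n))
    : set 'M[R]_(k, n) :=
  [set x | labelling_dom r x /\
    exists2 g : config R n, A g & forall B, g B = labelling x B].

(* Used for m <= n and 1 <= k, where n * k - m is not truncated. *)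
Definition codim_measurek (m k : nat) (r : R) (A : set (config R n)) : \bar R :=
  ((k`!%:R^-1)%:E *
   spherical_measure (n * k - m)%N (@labelling_preimage k r A))%E.

Definition codim_measure (m : nat) (r : R) (A : set (config R n)) : \bar R :=
  (expeR (- spherical_measure n (closed_eball0 r : set 'rV[R]_n)) *
   \sum_(1 <= k <oo) codim_measurek m k r (A `&` Upsilonk k (closed_eball0 r)))%E.

(* pi r is the Poisson measure on Upsilon (~` B_r). *)
Definition localised_codim_measure (pi : R -> probability (borel_config R n) R)
    (m : nat) (r : R) (A : set (config R n)) : \bar R :=
  (\int[pi r]_(eta in Upsilon (~` closed_eball0 r))
     codim_measure m r (config_section A eta r))%E.

End codimension_measures.

(* Main.v *)
Require Import Defs.
From HB Require Import structures.
From mathcomp Require Import fingroup perm finmap.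
From mathcomp Require Import all_boot all_order all_algebra.
From mathcomp Require Import all_classical all_reals all_analysis.
From mathcomp Require Import measurable_realfun ring lra.
Set Implicit Arguments.
Unset Strict Implicit.
Unset Printing Implicit Defensive.
Import Order.TTheory GRing.Theory Num.Theory.
Import numFieldNormedType.Exports.
Local Open Scope classical_set_scope.
Local Open Scope ring_scope.

(** For [r <= s] call annulus the set of the points of the closed ball [B_s]
    outside [B_r].  A Poisson configuration outside [B_r] is a Poisson
    configuration [eta] outside [B_s] together with an independent Poisson
    configuration of the annulus, and the latter consists of a Poisson number of
    independent uniform points ([poisson_superposition]).  Hence, if [f_r] is the
    function that is integrated in the definition of [rho_r], its integral is a
    sum over [j] of

      exp (- |annulus|) / j! * E[ int f_r (eta + y_1 + ... + y_j) dy_1 ... dy_j ],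

    the [y_i] ranging over the annulus ([integral_add_poisson]).  Now
    [f_r (eta + y)] is, up to the factor [exp (- S^n (B_r))], the sum over [k] of
    [1 / k!] times the [(nk - m)]-dimensional measure of the [k]-tuples [x] of
    points of [B_r] for which [x + y + eta] is in [A]: these [x] are the slice above
    [y] of a set of [(j + k)]-tuples of points of [B_s].  Cavalieri's principle,
    in the form of the inequality

      int S^d (E_y) dy <= S^(d + n) (E)                      ([slice_inequality]),

    bounds the integral over [y] by the measure of the [N]-tuples, [N = j + k],
    whose first [j] points are in the annulus and whose last [k] points are in
    [B_r].  The [N]-tuples of points of [B_s] with exactly [j] points in the
    annulus fall into [binomial(N, j)] congruent classes, according to which
    points these are, so the weights [1 / (j! k!)] add up to [1 / N!] and the sum
    over [j + k = N] is at most the term of index [N] of [f_s (eta)]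
    ([sum_spherical_measure_pieces]).  The exponential factors match because
    [S^n] is at most Lebesgue measure ([spherical_measure_le_lebesgueRn]).

    Three points need care.

    Spherical measure is not additive on disjoint sets in general, but it is on
    sets at positive distance from each other ([spherical_measure_separated]).
    So [f_r] is cut off to the configurations that avoid the open ball of radius
    [r + delta], which keeps the points of the annulus at distance [delta] from
    those of [B_r].  A configuration outside [B_r] is locally finite and so avoids
    a slightly larger ball ([void_closed_ball]); monotone convergence then lets
    [delta] tend to [0].

    The integral of a nonnegative function is the supremum of the integrals of its
    simple minorants.  The comparison is made for these minorants, to which
    Tonelli's theorem applies.

    The Poisson law is given through the numbers of points in Borel sets.  The
    superposition property only compares the probabilities that bounded open sets
    are void, which is enough because these events generate the Borel sets of
    the vague topology ([void_generates]).

    The slice inequality holds with constant [1] since the slice of a ball of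
    radius [rho] is a ball of radius [sqrt (rho^2 - |y|^2)] and
    [int omega_d (rho^2 - |y|^2)^(d/2) dy = omega_(d + n) rho^(d + n)]
    ([integral_half_power_quad]), which is what the Gamma factors in [omega] are
    made for. *)

(** * Infima over countable covers *)

Section covering_infimum.
Local Open Scope ereal_scope.
Context {R : realType} {I : pointedType} {T : Type}.
Variables (P : set I) (B : I -> set T) (w : I -> R).
Hypothesis w_ge0 : forall i, P i -> (0 <= w i)%R.

(** Both [lebesgueRn] and [spherical_premeasure] have this form, with boxes and
    with small balls.  The unordered sum [\esum] makes the reindexing of covers
    painless. *)
Definition cover_inf (A : set T) : \bar R :=
  ereal_inf [set s | exists (D : set nat) (x : nat -> I),
    [/\ forall i, D i -> P (x i), A `<=` \bigcup_(i in D) B (x i) &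
        s = \esum_(i in D) (w (x i))%:E]].

Lemma cover_inf_ge0 A : 0 <= cover_inf A.
Proof.
apply: le_ereal_inf_tmp => _ [D [x [DP _ ->]]].
by apply: esum_ge0 => i /DP/w_ge0; rewrite lee_fin.
Qed.

Lemma le_cover_inf A A' : A `<=` A' -> cover_inf A <= cover_inf A'.
Proof.
move=> AA'; apply: ereal_inf_le_tmp => _ [D [x [DP cov ->]]].
by exists D, x; split => //; exact: subset_trans cov.
Qed.

(** Covers may be indexed by any countable type. *)
Lemma cover_inf_le (J : countType) (K : set J) (x : J -> I) A :
  (forall j, K j -> P (x j)) -> A `<=` \bigcup_(j in K) B (x j) ->
  cover_inf A <= \esum_(j in K) (w (x j))%:E.
Proof.
move=> KP cov; apply: ereal_inf_lbound.
pose y k := if unpickle k is Some j then x j else point.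
have yE j : y (pickle j) = x j by rewrite /y pickleK.
exists (pickle @` K), y; split.
- by move=> _ [j Kj <-]; rewrite yE; exact: KP.
- by move=> t /cov[j Kj Bjt]; exists (pickle j); [exists j|rewrite yE].
- rewrite esum_image; last by move=> i j _ _ /(pcan_inj pickleK).
  by apply: eq_esum => j _; rewrite yE.
Qed.

Lemma cover_inf_adherent A (e : R) : (0 < e)%R -> cover_inf A < +oo ->
  exists (D : set nat) (x : nat -> I),
    [/\ forall i, D i -> P (x i), A `<=` \bigcup_(i in D) B (x i) &
        \esum_(i in D) (w (x i))%:E <= cover_inf A + e%:E].
Proof.
move=> e0 Afin; have : cover_inf A \is a fin_num by rewrite ge0_fin_numE// cover_inf_ge0.
move=> /(lb_ereal_inf_adherent e0)[_ [D [x [DP cov ->]]] /ltW le_e].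
by exists D, x; split.
Qed.

Lemma esum_dyadic_le (J : countType) (K : set J) (e : R) : (0 <= e)%R ->
  \esum_(j in K) (e / (2 ^ (pickle j).+1)%:R)%:E <= e%:E.
Proof.
move=> e0; rewrite -(esum_image K pickle (fun k => (e / (2 ^ k.+1)%:R)%:E)); last first.
  by move=> i j _ _ /(pcan_inj pickleK).
have e20 k : 0 <= (e / (2 ^ k.+1)%:R)%:E by rewrite lee_fin divr_ge0.
apply: le_trans (epsilon_trick0 xpredT e0).
rewrite nneseries_esumT// [leLHS]esum_mkcond.
by apply: le_esum => k _; case: ifPn.
Qed.

Lemma cover_inf_bigcup (J : countType) (K : set J) (A : J -> set T) :
  cover_inf (\bigcup_(j in K) A j) <= \esum_(j in K) cover_inf (A j).
Proof.
have [[j [Kj Aj]]|fin] := pselect (exists j, K j /\ cover_inf (A j) = +oo).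
  apply: le_trans (leey _) _; rewrite -Aj.
  rewrite (esumID [set j]); last by move=> *; exact: cover_inf_ge0.
  rewrite setIidr ?esum_set1 ?cover_inf_ge0//; last by move=> _ ->.
  by rewrite leeDl// esum_ge0// => *; exact: cover_inf_ge0.
have {}fin j : K j -> cover_inf (A j) < +oo.
  by move=> Kj; rewrite ltey; apply/eqP => Aj; apply: fin; exists j.
apply/lee_addgt0Pr => e e0.
(* the covers of the pieces are optimal up to errors of total size e *)
pose ej (j : J) : R := (e / (2 ^ (pickle j).+1)%:R)%R.
have ej0 j : (0 < ej j)%R by rewrite divr_gt0// ltr0n expn_gt0.
have H j : exists Dx : set nat * (nat -> I), K j ->
    [/\ forall i, Dx.1 i -> P (Dx.2 i), A j `<=` \bigcup_(i in Dx.1) B (Dx.2 i) &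
        \esum_(i in Dx.1) (w (Dx.2 i))%:E <= cover_inf (A j) + (ej j)%:E].
  have [Kj|nKj] := pselect (K j); last by exists (set0, fun=> point).
  by have [D [x Dx]] := cover_inf_adherent (ej0 j) (fin j Kj); exists (D, x).
have {H} [F HF] := choice H.
apply: (@le_trans _ _ (\esum_(j in K) (cover_inf (A j) + (ej j)%:E))); last first.
  rewrite esumD; last 2 first.
  - by move=> *; exact: cover_inf_ge0.
  - by move=> *; rewrite lee_fin ltW.
  by rewrite leeD2l// esum_dyadic_le// ltW.
apply: (@le_trans _ _ (\esum_(j in K) \esum_(i in (F j).1) (w ((F j).2 i))%:E)); last first.
  by apply: le_esum => j Kj; case: (HF j Kj).
rewrite esum_esum; last by move=> j i Kj Di; rewrite lee_fin w_ge0//; case: (HF j Kj) => + _ _; apply.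
apply: (@cover_inf_le (J * nat)%type _ (fun k => (F k.1).2 k.2)).
- by move=> [j i]/= [Kj Di]; case: (HF j Kj) => + _ _; apply.
- move=> t [j Kj Ajt]; case: (HF j Kj) => _ /(_ _ Ajt)[i Di Bt] _.
  by exists (j, i).
Qed.

Lemma cover_inf0 : cover_inf set0 = 0.
Proof.
apply/eqP; rewrite eq_le cover_inf_ge0 andbT.
have := @cover_inf_le nat set0 (fun=> point) set0 (fun _ => False_ind _).
by rewrite esum_set0; apply.
Qed.

Lemma cover_inf_sigma_subadditive : sigma_subadditive cover_inf.
Proof.
move=> A; rewrite nneseries_esumT; last by move=> *; exact: cover_inf_ge0.
exact: cover_inf_bigcup.
Qed.

End covering_infimum.

(** * Lebesgue measure on Borel sets *)

Lemma countable_bigcup_measurable d (X : measurableType d) (J : countType)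
    (K : set J) (F : J -> set X) :
  (forall j, K j -> measurable (F j)) -> measurable (\bigcup_(j in K) F j).
Proof.
move=> mF; pose G k := if unpickle k is Some j then
  if j \in K then F j else set0 else set0.
rewrite (_ : \bigcup_(j in K) F j = \bigcup_k G k).
  apply: bigcupT_measurable => k; rewrite /G.
  by case: unpickle => // j; case: ifPn => //; rewrite inE => /mF.
apply/seteqP; split=> [x [j Kj Fjx]|x [k _]].
  by exists (pickle j) => //; rewrite /G pickleK mem_set.
rewrite /G; case: unpickle => // j; case: ifPn => //; rewrite inE => Kj Fjx.
by exists j.
Qed.

Section rational_balls.
Context {R : realType} {n : nat}.

Definition qball (q : 'rV[rat]_n * nat) : set 'rV[R]_n :=
  ball (map_mx ratr q.1 : 'rV[R]_n) (q.2.+1%:R^-1 : R).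

Lemma qballE q x : qball q x <->
  forall i, `|ratr (q.1 ord0 i) - x ord0 i| < q.2.+1%:R^-1.
Proof.
split=> [[_ qx] i|qx]; first by have := qx ord0 i; rewrite mxE.
split; first by rewrite invr_gt0.
by move=> i j; rewrite (ord1 i) mxE; exact: qx.
Qed.

Lemma open_qball q : open (qball q).
Proof. by apply: ball_open; rewrite invr_gt0. Qed.

Lemma qball_base (O : set 'rV[R]_n) x : open O -> O x ->
  exists2 q, qball q x & qball q `<=` O.
Proof.
move=> oO Ox; have : nbhs x O by apply: open_nbhs_nbhs.
move=> /nbhs_ballP[e /= e0 xeO].
have [k _ ke] : exists2 k, xpredT k & (k.+1%:R^-1 < e / 2 :> R).
  near \oo => k; exists k => //; near: k.
  by apply: (near_infty_natSinv_lt (PosNum (divr_gt0 e0 (ltr0Sn R 1)))).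
have k0 : 0 < k.+1%:R^-1 :> R by rewrite invr_gt0.
have H i : exists q : rat, `|ratr q - x ord0 i| < k.+1%:R^-1.
  have : x ord0 i - k.+1%:R^-1 < x ord0 i + k.+1%:R^-1 by rewrite ltrBlDr -addrA ltrDl addr_gt0.
  move=> /rat_in_itvoo[q]; rewrite in_itv/= => /andP[q1 q2].
  by exists q; rewrite ltr_distl q1.
have [q Hq] := choice H.
exists (\row_i q i, k); first by apply/qballE => i; rewrite mxE.
move=> y /qballE qy; apply: xeO; split=> // i j; rewrite (ord1 i).
have := qy j; rewrite mxE/= => qyj.
rewrite -ball_normE/= (splitr e) -(subrKA (ratr (q j))).
by rewrite (le_lt_trans (ler_normD _ _))// ltrD// ?(lt_trans qyj)// distrC (lt_trans (Hq j)).
Unshelve. all: by end_near. Qed.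

Lemma open_bigcup_qball (O : set 'rV[R]_n) : open O ->
  O = \bigcup_(q in [set q | qball q `<=` O]) qball q.
Proof.
move=> oO; apply/seteqP; split=> [x Ox|x [q qO qx]]; last exact: qO.
by have [q qx qO] := qball_base oO Ox; exists q.
Qed.

Lemma measurable_fun_coords d (X : measurableType d) (f : X -> borelRn R n) :
  (forall i, measurable_fun setT (fun x => (f x : 'rV[R]_n) ord0 i)) ->
  measurable_fun setT f.
Proof.
move=> mf; apply: (@measurability _ _ X (borelRn R n) setT f (@open 'rV[R]_n)) => //.
move=> _ [U oU <-]; rewrite setTI (open_bigcup_qball oU) preimage_bigcup.
apply: countable_bigcup_measurable => q _.
rewrite (_ : _ @^-1` _ = \bigcap_(i in [set: 'I_n])
    [set x | `|ratr (q.1 ord0 i) - (f x : 'rV[R]_n) ord0 i| < q.2.+1%:R^-1]).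
  apply: fin_bigcap_measurable => // i _.
  have mfi : measurable_fun setT (fun x => `|ratr (q.1 ord0 i) - (f x : 'rV[R]_n) ord0 i|).
    by apply: measurableT_comp => //; apply: measurable_funB.
  rewrite (_ : [set _ | _] = (fun x => `|ratr (q.1 ord0 i) - (f x : 'rV[R]_n) ord0 i|) @^-1`
     `]-oo, q.2.+1%:R^-1[); first by rewrite -[X in measurable X]setTI; exact: mfi.
  by apply/seteqP; split => x /=; rewrite in_itv.
by apply/seteqP; split => [x /qballE qx i _|x qx]; [exact: qx|apply/qballE => i; exact: qx].
Qed.

Lemma measurable_coord (i : 'I_n) :
  measurable_fun setT (fun x : borelRn R n => (x : 'rV[R]_n) ord0 i).
Proof.
apply: (measurability _ (RGenOInfty.measurableE R)).
move=> _ [_ [x ->] <-]; rewrite setTI; apply: sub_sigma_algebra.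
by apply: open_comp => [y _|]; [exact: coord_continuous|exact: interval_open].
Qed.

Definition half_space (i : 'I_n) (a : R) : set 'rV[R]_n := [set x | x ord0 i <= a].

(** Coordinates are measurable for the sigma-algebra generated by half-spaces, and
    countably many conditions on coordinates describe an open set. *)
Lemma half_space_sigma_algebra (M : set_system 'rV[R]_n) :
  sigma_algebra setT M -> (forall i a, M (half_space i a)) ->
  forall A : set (borelRn R n), measurable A -> M A.
Proof.
move=> sM HM A mA.
pose G := [set A | exists i a, A = half_space i a].
suff : @measurable _ (g_sigma_algebraType G) A.
  by apply: smallest_sub => // _ [i [a ->]].
have : measurable_fun setT (id : g_sigma_algebraType G -> borelRn R n).
  apply: measurable_fun_coords => i.
  apply: (measurability _ (RGenOInfty.measurableE R)).
  move=> _ [_ [x ->] <-]; rewrite setTI.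
  rewrite (_ : _ @^-1` _ = ~` half_space i x).
    by apply: measurableC; apply: sub_sigma_algebra; exists i, x.
  by apply/seteqP; split => y /=; rewrite in_itv/= andbT ltNge => /negP.
by move=> /(_ measurableT A mA); rewrite setTI.
Qed.

End rational_balls.

Section lebesgue_outer.
Local Open Scope ereal_scope.
Context {R : realType} {n : nat}.
Implicit Types X : set 'rV[R]_n.

Definition box (ab : 'rV[R]_n * 'rV[R]_n) : set 'rV[R]_n :=
  [set x | forall i, (ab.1 ord0 i <= x ord0 i <= ab.2 ord0 i)%R].

Definition box_le : set ('rV[R]_n * 'rV[R]_n) :=
  [set ab : 'rV[R]_n * 'rV[R]_n | forall i, (ab.1 ord0 i <= ab.2 ord0 i)%R].

Definition box_vol (ab : 'rV[R]_n * 'rV[R]_n) : R :=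
  (\prod_(i < n) (ab.2 ord0 i - ab.1 ord0 i))%R.

Lemma box_vol_ge0 ab : box_le ab -> (0 <= box_vol ab)%R.
Proof. by move=> ab_le; apply: prodr_ge0 => i _; rewrite subr_ge0. Qed.

Lemma lebesgueRnE : @lebesgueRn R n = cover_inf box_le box box_vol.
Proof.
apply/funext => X; congr ereal_inf; apply/seteqP; split=> [s [D [a [b [ab cov ->]]]]|s [D [x [Dx cov ->]]]].
  exists D, (fun j => (a j, b j)); split => //.
  rewrite nneseries_esum ?set_mem_set// => j; rewrite inE lee_fin => Dj.
  by apply: (@box_vol_ge0 (a j, b j)); exact: ab.
exists D, (fst \o x), (snd \o x); split => //.
rewrite nneseries_esum ?set_mem_set// => j; rewrite inE lee_fin => Dj.
by apply: (@box_vol_ge0 (x j)); exact: Dx.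
Qed.

Lemma lebesgueRn_ge0 X : 0 <= lebesgueRn X.
Proof. by rewrite lebesgueRnE; exact: cover_inf_ge0 box_vol_ge0 _. Qed.

Lemma le_lebesgueRn : {homo @lebesgueRn R n : X Y / X `<=` Y >-> X <= Y}.
Proof. by move=> X Y; rewrite lebesgueRnE; exact: le_cover_inf. Qed.

Lemma lebesgueRn_box_le ab : box_le ab -> lebesgueRn (box ab) <= (box_vol ab)%:E.
Proof.
move=> ab_le; rewrite lebesgueRnE.
have := @cover_inf_le _ _ _ box_le box box_vol nat [set 0%N] (fun=> ab) (box ab).
rewrite esum_set1 ?lee_fin ?box_vol_ge0//; apply; first by move=> _ _.
by move=> x bx; exists 0%N.
Qed.

Lemma lebesgueRn_set0 : lebesgueRn (set0 : set 'rV[R]_n) = 0.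
Proof. by rewrite lebesgueRnE; exact: cover_inf0 box_vol_ge0. Qed.

Lemma lebesgueRn_sigma_subadditive : sigma_subadditive (@lebesgueRn R n).
Proof. by rewrite lebesgueRnE; exact: cover_inf_sigma_subadditive box_vol_ge0. Qed.

HB.instance Definition _ := isOuterMeasure.Build R 'rV[R]_n (@lebesgueRn R n)
  lebesgueRn_set0 lebesgueRn_ge0 le_lebesgueRn lebesgueRn_sigma_subadditive.

Definition set_coord (x : 'rV[R]_n) (i : 'I_n) (t : R) : 'rV[R]_n :=
  (\row_j if j == i then t else x ord0 j)%R.

Lemma box_vol_split (a b : 'rV[R]_n) i t :
  (box_vol (a, set_coord b i t) + box_vol (set_coord a i t, b))%R = box_vol (a, b).
Proof.
rewrite /box_vol /= (bigD1 i)//= [X in (_ + X)%R](bigD1 i)//= [RHS](bigD1 i)//=.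
rewrite !mxE eqxx.
under eq_bigr => j ji do rewrite mxE (negbTE ji).
under [X in (_ + _ * X)%R]eq_bigr => j ji do rewrite mxE (negbTE ji).
by rewrite -mulrDl; congr (_ * _)%R; rewrite addrC addrA subrK.
Qed.

(** A coordinate hyperplane cuts every box of a cover into two boxes whose
    volumes add up. *)
Lemma caratheodory_half_space i c : (@lebesgueRn R n).-caratheodory (half_space i c).
Proof.
apply: le_caratheodory_measurable => X /=.
have [->|Xfin] := eqVneq (lebesgueRn X) +oo; first exact: leey.
have {}Xfin : cover_inf box_le box box_vol X < +oo by rewrite -lebesgueRnE ltey.
apply/lee_addgt0Pr => e e0.
have [D [x [Dx cov le_e]]] := cover_inf_adherent box_vol_ge0 e0 Xfin.
rewrite lebesgueRnE; apply: le_trans le_e.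
(* the position of the cut, moved into the box when the hyperplane misses it *)
pose t j := Num.max ((x j).1 ord0 i) (Num.min ((x j).2 ord0 i) c).
pose y j := ((x j).1, set_coord (x j).2 i (t j)).
pose z j := (set_coord (x j).1 i (t j), (x j).2).
have t1 j : ((x j).1 ord0 i <= t j)%R by rewrite le_max lexx.
have t2 j : D j -> (t j <= (x j).2 ord0 i)%R by move=> Dj; rewrite ge_max Dx// ge_min lexx.
have Dy j : D j -> box_le (y j).
  by move=> Dj k; rewrite /y/= mxE; case: eqP => [->|_]; [exact: t1|exact: Dx].
have Dz j : D j -> box_le (z j).
  by move=> Dj k; rewrite /z/= mxE; case: eqP => [->|_]; [exact: t2|exact: Dx].
rewrite (_ : \esum_(j in D) _ = \esum_(j in D) ((box_vol (y j))%:E + (box_vol (z j))%:E)); last first.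
  by apply: eq_esum => j _; rewrite -EFinD box_vol_split; case: (x j).
rewrite esumD; [|by move=> j Dj; rewrite lee_fin box_vol_ge0//; auto..].
apply: leeD; apply: cover_inf_le => //.
- move=> u [Xu iu]; have [j Dj xu] := cov _ Xu; exists j => // k.
  rewrite /y/= mxE; case: eqP => [->|_]; last exact: xu.
  have /andP[-> u2] := xu i; rewrite /= le_max; apply/orP; right.
  by rewrite le_min u2.
- move=> u [Xu /negP]; rewrite -ltNge => iu; have [j Dj xu] := cov _ Xu; exists j => // k.
  rewrite /z/= mxE; case: eqP => [->|_]; last exact: xu.
  have /andP[u1 ->] := xu i; rewrite andbT ge_max u1/=.
  by rewrite ge_min (ltW iu) orbT.
Qed.

(** [lebesgueRn] is defined on all sets; this copy, with the Borel sets as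
    measurable sets, carries the measure structure. *)
Definition lebn : set (borelRn R n) -> \bar R := @lebesgueRn R n.

Lemma le_lebn (X Y : set (borelRn R n)) : X `<=` Y -> lebn X <= lebn Y.
Proof. exact: le_lebesgueRn. Qed.

Lemma borel_caratheodory (A : set (borelRn R n)) : measurable A ->
  (@lebesgueRn R n).-caratheodory A.
Proof.
apply: half_space_sigma_algebra caratheodory_half_space A.
split.
- exact: caratheodory_measurable_set0.
- by move=> A mA; rewrite setTD; exact: caratheodory_measurable_setC.
- exact: caratheodory_measurable_bigcup.
Qed.

Let lebn0 : lebn set0 = 0. Proof. exact: lebesgueRn_set0. Qed.
Let lebn_ge0 A : 0 <= lebn A. Proof. exact: lebesgueRn_ge0. Qed.
Let lebn_sigma_additive : semi_sigma_additive lebn.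
Proof.
move=> F mF tF mUF.
by apply: (@caratheodory_measure_sigma_additive R 'rV[R]_n (@lebesgueRn R n)) => // [i|]; exact: borel_caratheodory.
Qed.

HB.instance Definition _ := isMeasure.Build _ (borelRn R n) R lebn
  lebn0 lebn_ge0 lebn_sigma_additive.

End lebesgue_outer.

Section pushforward_as_measure.
Context d d' (T1 : measurableType d) (T2 : measurableType d') (R : realType).
Variables (m : {measure set T1 -> \bar R}) (f : T1 -> T2).

(** The measurability of [f] is an argument, so that the image measure of a
    function that is not packed as a measurable one is still a measure. *)
Definition pushm (mf : measurable_fun setT f) : {measure set T2 -> \bar R}.
Proof. refine (pushforward m f : {measure set T2 -> \bar R}). exact mf. Defined.

Lemma ge0_integral_pushm (mf : measurable_fun setT f) (h : T2 -> \bar R) :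
  measurable_fun setT h -> (forall y, 0 <= h y)%E ->
  (\int[pushm mf]_y h y = \int[m]_x h (f x))%E.
Proof. by move=> mh h0; exact: (ge0_integral_pushforward mf m measurableT mh (fun y _ => h0 y)). Qed.

End pushforward_as_measure.

Section lebesgue_boxes.
Local Open Scope ereal_scope.
Context {R : realType} {n : nat}.

Lemma open_borelRn (A : set 'rV[R]_n) : open A -> measurable (A : set (borelRn R n)).
Proof. by move=> oA; exact: sub_sigma_algebra. Qed.

Lemma closed_borelRn (A : set 'rV[R]_n) : closed A -> measurable (A : set (borelRn R n)).
Proof.
move=> cA; rewrite -[X in measurable X]setCK; apply: measurableC.
by apply: open_borelRn; exact: closed_openC.
Qed.

Lemma measurable_box (ab : 'rV[R]_n * 'rV[R]_n) : measurable (box ab : set (borelRn R n)).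
Proof.
rewrite (_ : box ab = \bigcap_(i in [set: 'I_n])
    (fun x : borelRn R n => (x : 'rV[R]_n) ord0 i) @^-1` `[ab.1 ord0 i, ab.2 ord0 i]).
  apply: fin_bigcap_measurable => // i _.
  by rewrite -[X in measurable X]setTI; exact: measurable_coord.
by apply/seteqP; split => x xab i; [move=> _|have := xab i I]; rewrite /= in_itv//; exact: xab.
Qed.

Definition cube (k : nat) : set 'rV[R]_n :=
  box ((\row_i - k%:R)%R, (\row_i k%:R)%R).

Lemma cube_norm k (x : 'rV[R]_n) : (`|x| <= k%:R)%R -> cube k x.
Proof.
move=> xk i; rewrite !mxE -ler_norml; apply: le_trans xk.
rewrite /Num.norm/= mx_normrE.
by apply: (le_bigmax _ (fun ij => `|x ij.1 ij.2|%R) (ord0, i)).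
Qed.

Lemma bigcup_cube : \bigcup_k cube k = setT.
Proof.
rewrite -subTset => x _; exists (Num.bound `|x|)%R => //.
by apply: cube_norm; exact/ltW/archi_boundP.
Qed.

Lemma lebn_cube_fin k : lebn (cube k) < +oo.
Proof.
apply: le_lt_trans (ltry _); apply: lebesgueRn_box_le => i.
by rewrite !mxE ge0_cp ?ler0n.
Qed.

Lemma lebn_sigma_finite : sigma_finite setT (@lebn R n).
Proof.
exists cube; first by rewrite bigcup_cube.
by move=> k; split; [exact: measurable_box|exact: lebn_cube_fin].
Qed.

HB.instance Definition _ := Measure_isSigmaFinite.Build _ (borelRn R n) R
  (@lebn R n) lebn_sigma_finite.

Lemma box_generates (A : set (borelRn R n)) : measurable A ->
  <<s range box >> A.
Proof.
apply: half_space_sigma_algebra => [|i a]; first exact: smallest_sigma_algebra.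
rewrite (_ : half_space i a = \bigcup_k box ((\row_i - k%:R)%R,
    set_coord (\row_i k%:R)%R i a)).
  apply: (@sigma_algebra_bigcup _ _ (range box)) => k.
  by apply: sub_sigma_algebra; eexists.
apply/seteqP; split => [x xa|x [k _ /(_ i)]]; last by rewrite !mxE eqxx => /andP[].
have : (\bigcup_k cube k) x by rewrite bigcup_cube.
move=> [k _ xk]; exists k => // j; have := xk j; rewrite !mxE => /andP[->].
by case: eqP => // -> _.
Qed.

Lemma boxI_closed : setI_closed (range (@box R n)).
Proof.
move=> _ _ [[a b] _ <-] [[a' b'] _ <-].
exists ((\row_i Num.max (a ord0 i) (a' ord0 i))%R, (\row_i Num.min (b ord0 i) (b' ord0 i))%R) => //.
apply/seteqP; split => [x xab|x [xab xab'] i].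
  by split => i; have := xab i; rewrite !mxE/= ge_max le_min => /andP[/andP[h1 h2] /andP[h3 h4]]; rewrite /= ?h1 ?h2 ?h3 ?h4.
have /andP[/= h1 h2] := xab i; have /andP[/= h3 h4] := xab' i.
by rewrite !mxE ge_max le_min h1 h2 h3 h4.
Qed.

Lemma box_eq0 (ab : 'rV[R]_n * 'rV[R]_n) : ~ box_le ab -> box ab = set0 :> set 'rV[R]_n.
Proof.
move=> nab; apply/seteqP; split => // x xab; apply: nab => i.
by have /andP[] := xab i; exact: le_trans.
Qed.

Section box_measure.
Variable nu : {measure set (borelRn R n) -> \bar R}.
Hypothesis nu_box : forall ab, box_le ab -> nu (box ab) = (box_vol ab)%:E.

(** Countable subadditivity of [nu] along a cover by boxes. *)
Lemma le_lebn_of_box X : measurable X -> nu X <= lebn X.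
Proof.
move=> mX; rewrite /lebn lebesgueRnE; apply: le_ereal_inf_tmp => _ [D [x [Dx cov ->]]].
pose F j : set (borelRn R n) := if j \in D then box (x j) else set0.
have mF j : measurable (F j) by rewrite /F; case: ifP => // _; exact: measurable_box.
apply: (@le_trans _ _ (\sum_(j <oo) nu (F j))).
  apply: measure_sigma_subadditive => // t /cov[j Dj xt].
  by exists j => //; rewrite /F mem_set.
rewrite nneseries_esumT// [leRHS]esum_mkcond; apply: le_esum => j _.
rewrite /F; case: ifPn => [|_]; last by rewrite measure0.
by rewrite inE => /Dx; move=> /nu_box ->.
Qed.

(** The volume of a box is an upper bound of its measure by definition; it is a
    lower bound as soon as some measure gives each box its volume. *)
Lemma lebn_box_of (ab : 'rV[R]_n * 'rV[R]_n) : box_le ab -> lebn (box ab) = (box_vol ab)%:E.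
Proof.
move=> ab_le; apply/eqP; rewrite eq_le; apply/andP; split.
  exact: lebesgueRn_box_le.
by rewrite -nu_box//; apply: le_lebn_of_box; exact: measurable_box.
Qed.

(** The boxes are stable by intersection and generate the Borel sets. *)
Lemma lebn_unique X : measurable X -> lebn X = nu X.
Proof.
move=> mX.
have mG : (range box : set (set (borelRn R n))) `<=` measurable.
  by move=> _ [ab _ <-]; exact: measurable_box.
have Gg i : (range box : set (set (borelRn R n))) (cube i) by eexists.
apply: (@g_sigma_algebra_measure_unique _ R (borelRn R n) _ mG cube Gg bigcup_cube) => //.
- exact: boxI_closed.
- move=> _ [ab _ <-]; have [ab_le|nab] := pselect (box_le ab).
    by rewrite nu_box//; exact: lebn_box_of.
  by rewrite box_eq0// !measure0.
- exact: lebn_cube_fin.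
- exact: box_generates.
Qed.

End box_measure.
End lebesgue_boxes.

Section row_cons.
Context {R : realType} {n : nat}.

Definition rcons_row (z : R * borelRn R n) : borelRn R n.+1 :=
  \row_(i < n.+1) (if unlift ord0 i is Some j then (z.2 : 'rV[R]_n) ord0 j else z.1).

Lemma rcons_row0 z : (rcons_row z : 'rV[R]_n.+1) ord0 ord0 = z.1.
Proof. by rewrite mxE unlift_none. Qed.

Lemma rcons_rowS z j :
  (rcons_row z : 'rV[R]_n.+1) ord0 (lift ord0 j) = (z.2 : 'rV[R]_n) ord0 j.
Proof. by rewrite mxE liftK. Qed.

Lemma measurable_rcons_row : measurable_fun setT rcons_row.
Proof.
apply: measurable_fun_coords => i.
have [j ->|->] := unliftP ord0 i.
  under eq_fun do rewrite rcons_rowS.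
  exact: (measurableT_comp (@measurable_coord R n j) (@measurable_snd _ _ R (borelRn R n))).
by under eq_fun do rewrite rcons_row0; exact: measurable_fst.
Qed.

End row_cons.

Section lebesgue_product.
Local Open Scope ereal_scope.
Context {R : realType}.

Definition lebn_prod n : {measure set (borelRn R n.+1) -> \bar R} :=
  pushm (@lebesgue_measure R \x @lebn R n) measurable_rcons_row.

Lemma lebn_prod_box n : (forall ab, box_le ab -> @lebn R n (box ab) = (box_vol ab)%:E) ->
  forall ab, box_le ab -> lebn_prod n (box ab) = (box_vol ab)%:E.
Proof.
move=> IH [a b] ab_le.
pose ta (x : 'rV[R]_n.+1) : 'rV[R]_n := (\row_j x ord0 (lift ord0 j))%R.
rewrite /lebn_prod /= /pushforward.
rewrite (_ : _ @^-1` _ = `[a ord0 ord0, b ord0 ord0]%classic `*` box (ta a, ta b)).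
  rewrite product_measure1E//; last exact: measurable_box.
  rewrite [X in X * _](lebesgue_measure_itv `[a ord0 ord0, b ord0 ord0])/= lte_fin.
  rewrite IH; last by move=> i; rewrite !mxE ab_le.
  rewrite [X in X * _](_ : _ = (b ord0 ord0 - a ord0 ord0)%:E); last first.
    case: ifPn => //; rewrite -leNgt => ba; congr EFin.
    by apply/esym/eqP; rewrite subr_eq0 eq_le ba ab_le.
  rewrite -EFinM /box_vol/= big_ord_recl/=; congr ((_ * _)%:E)%R.
  by apply: eq_bigr => i _; rewrite !mxE.
apply/seteqP; split=> [[t v]/= xab|[t v]/= [tab vab] i].
  split; first by have := xab ord0; rewrite rcons_row0 in_itv.
  by move=> i; have := xab (lift ord0 i); rewrite rcons_rowS !mxE.
have [j ->|->] := unliftP ord0 i; last by rewrite rcons_row0; move: tab; rewrite in_itv.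
by rewrite rcons_rowS; have := vab j; rewrite !mxE.
Qed.

(** The measure required by [lebn_box_of] is built by induction on the dimension
    as the product with the one-dimensional Lebesgue measure. *)
Theorem lebn_box n (ab : 'rV[R]_n * 'rV[R]_n) : box_le ab ->
  lebn (box ab) = (box_vol ab)%:E.
Proof.
elim: n ab => [|n IH] ab ab_le; last exact: (lebn_box_of (lebn_prod_box IH)).
apply: (lebn_box_of (nu := dirac (0%R : borelRn R 0))) => // {ab_le}ab _.
rewrite /= diracE mem_set; last by move=> i; have := ltn_ord i; rewrite ltn0.
by rewrite /box_vol big_ord0.
Qed.

Lemma lebnS n X : measurable X -> @lebn R n.+1 X = lebn_prod n X.
Proof. by move=> mX; apply: lebn_unique => // ab; apply: lebn_prod_box; exact: lebn_box. Qed.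

Lemma integral_lebnS n (f : borelRn R n.+1 -> \bar R) :
  measurable_fun setT f -> (forall x, 0 <= f x) ->
  \int[@lebn R n.+1]_x f x =
  \int[@lebesgue_measure R]_t \int[@lebn R n]_v f (rcons_row (t, v)).
Proof.
move=> mf f0.
rewrite (@eq_measure_integral _ _ _ _ (lebn_prod n)); last by move=> A mA _; exact: lebnS.
rewrite ge0_integral_pushm// fubini_tonelli1//.
exact: measurableT_comp mf measurable_rcons_row.
Qed.

Lemma integral_lebn0 (f : borelRn R 0 -> \bar R) : 
  (forall x, 0 <= f x) ->
  \int[@lebn R 0]_x f x = f 0%R.
Proof.
move=> f0.
have E A : measurable A -> @lebn R 0 A = dirac (0%R : borelRn R 0) A.
  move=> mA; apply: lebn_unique => // ab _.
  rewrite /= diracE mem_set; last by move=> i; have := ltn_ord i; rewrite ltn0.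
  by rewrite /box_vol big_ord0.
rewrite (@eq_measure_integral _ _ _ _ (dirac (0%R : borelRn R 0))); last by move=> A mA _; exact: E.
have -> : f = cst (f 0%R) by apply/funext => x; rewrite [x](_ : _ = 0%R)//; apply/rowP; case.
by rewrite integral_cst//= diracE in_setT mule1.
Qed.

End lebesgue_product.

(** * The constants omega *)

Section affine_change_of_variables.
Local Open Scope ereal_scope.
Context {R : realType}.
Notation mu := (@lebesgue_measure R).

Let aff (a c : R) : R -> R := (fun t => a * t + c)%R.

Let measurable_aff a c : measurable_fun setT (aff a c).
Proof. by apply: measurable_funD => //; exact: measurable_funM. Qed.

Lemma ge0_integral_affine (a c : R) (f : R -> \bar R) : (0 < a)%R ->
  measurable_fun setT f -> (forall x, 0 <= f x) ->
  \int[mu]_x f x = a%:E * \int[mu]_t f (a * t + c)%R.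
Proof.
move=> a0 mf f0.
pose nu : {measure set (measurableTypeR R) -> \bar R} := mscale (NngNum (ltW a0))
  (@pushm _ _ (measurableTypeR R) (measurableTypeR R) R mu (aff a c) (measurable_aff a c)).
have E A : measurable A -> mu A = nu A.
  move=> mA; refine (@lebesgue_measure_unique R nu _ A mA) => _ [[x y] _ <-].
  rewrite /nu/= /mscale/= /pushforward.
  rewrite (_ : aff a c @^-1` _ = `](((x - c) / a)%R), (((y - c) / a)%R)]%classic).
    rewrite !lebesgue_measure_itv/= !lte_fin ltr_pM2r ?invr_gt0// ltrD2r.
    case: ifPn => _; last by rewrite mule0.
    rewrite -!EFinB -EFinM; congr EFin.
    by rewrite -mulrBl opprB addrA subrK mulrC divfK// gt_eqF.
  apply/seteqP; split=> t /=; rewrite !in_itv/= /aff.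
    by rewrite ltr_pdivrMr// ler_pdivlMr// ltrBlDr lerBrDr mulrC.
  by rewrite ltr_pdivrMr// ler_pdivlMr// ltrBlDr lerBrDr mulrC.
rewrite (@eq_measure_integral _ _ _ _ nu); last by move=> A mA _; exact: E.
rewrite ge0_integral_mscale//; congr (_ * _).
exact: (@ge0_integral_pushm _ _ (measurableTypeR R) (measurableTypeR R) R mu
  (aff a c) (measurable_aff a c)).
Qed.

Lemma ge0_integral_shift (c : R) (f : R -> \bar R) :
  measurable_fun setT f -> (forall x, 0 <= f x) ->
  \int[mu]_x f x = \int[mu]_t f (t + c)%R.
Proof.
move=> mf f0; rewrite (@ge0_integral_affine 1 c)// mul1e.
by apply: eq_integral => t _; rewrite mul1r.
Qed.

End affine_change_of_variables.

Section half_power.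
Context {R : realType}.

(** [v ^ (d/2)] for positive [v] and [0] otherwise: for [d = 0] this is the
    indicator of the positive numbers, so that empty slices cost nothing. *)
Definition half_power (d : nat) (v : R) : R := if 0 < v then Num.sqrt v ^+ d else 0.

Lemma half_power_ge0 d v : 0 <= half_power d v.
Proof. by rewrite /half_power; case: ifP => // _; rewrite exprn_ge0// sqrtr_ge0. Qed.

Lemma measurable_half_power d : measurable_fun setT (half_power d).
Proof.
apply: measurable_fun_ifT => //; first exact: measurable_fun_ltr.
by apply: measurable_funX; apply: continuous_measurable_fun; exact: sqrt_continuous.
Qed.

Lemma half_powerM d u v : 0 < u ->
  half_power d (u * v) = Num.sqrt u ^+ d * half_power d v.
Proof.
move=> u0; rewrite /half_power pmulr_rgt0//; case: ifP => v0; last by rewrite mulr0.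
by rewrite sqrtrM ?ltW// exprMn.
Qed.

End half_power.

Section gamma_one_half.
Local Open Scope ereal_scope.
Context {R : realType}.
Notation mu := (@lebesgue_measure R).

Let g (x : R) : R := (x `^ (1 / 2 - 1) * expR (- x))%R.

Let g_ge0 x : (0 <= g x)%R. Proof. by rewrite mulr_ge0// ?powR_ge0 ?expR_ge0. Qed.

Let mg : measurable_fun setT g.
Proof. by apply: measurable_funM; [exact: measurable_powR|exact: measurableT_comp]. Qed.

Let gE (x : R) : (0 < x)%R -> g x = (2 * (expR (- x) * (2 * Num.sqrt x)^-1))%R.
Proof.
move=> x0; rewrite /g (_ : 1 / 2 - 1 = - 2^-1)%R; last first.
  by rewrite mul1r {2}(splitr 1) mul1r opprD addrA subrr sub0r.
rewrite powRN powR12_sqrt ?ltW//.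
by field; rewrite gt_eqF// sqrtr_gt0.
Qed.

Let derive_sqrt1 (x : R) : (0 < x)%R -> (@Num.sqrt R)^`()%classic x = ((2 * Num.sqrt x)^-1)%R.
Proof. by move=> x0; rewrite derive1E derive_sqrt. Qed.

(** The substitution [t = sqrt x] in the Gaussian integral. *)
Let gauss_substitution (a : R) : (0 < a)%R ->
  \int[mu]_(t in `[Num.sqrt a, +oo[) (gauss_fun t)%:E =
  \int[mu]_(x in `[a, +oo[) (2^-1 * g x)%:E.
Proof.
move=> a0.
have cinv (x : R) : (0 < x)%R -> {for x, continuous (fun x : R => ((2 * Num.sqrt x)^-1)%R)}.
  move=> x0; apply: cvgV; first by rewrite mulf_neq0// gt_eqF// sqrtr_gt0.
  by apply: cvgM; [exact: cvg_cst|exact: sqrt_continuous].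
have near_eq (x : R) : (0 < x)%R ->
    \forall y \near x, ((2 * Num.sqrt y)^-1)%R = (@Num.sqrt R)^`()%classic y.
  move=> x0; near=> y; rewrite derive_sqrt1//; near: y; exact: lt_nbhsr.
have cd (x : R) : (0 < x)%R -> {for x, continuous (@Num.sqrt R)^`()%classic}.
  move=> x0; rewrite /prop_for /continuous_at derive_sqrt1//.
  by apply: cvg_trans (cinv x x0); apply: near_eq_cvg; exact: near_eq.
rewrite (@increasing_ge0_integration_by_substitutiony R (@Num.sqrt R)).
- apply: eq_integral => x; rewrite inE/= in_itv/= andbT => ax.
  have x0 := lt_le_trans a0 ax.
  rewrite fctE derive_sqrt1// /gauss_fun/= sqr_sqrtr ?ltW// gE//.
  by rewrite mulKf.
- move=> x y; rewrite !in_itv/= !andbT => ax ay xy.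
  by rewrite ltr_sqrt// (lt_le_trans a0).
- by move=> x; rewrite in_itv/= andbT => ax; apply: cd; exact: lt_trans ax.
- apply/cvg_ex; exists ((@Num.sqrt R)^`()%classic a).
  by apply: cvg_at_right_filter; exact: cd.
- apply/cvg_ex; exists 0%R; apply/cvgrPdist_le => e e0; near=> x.
  have xe : (e^-1 ^+ 2 <= x)%R by near: x; apply: nbhs_pinfty_ge; exact: num_real.
  have x0 : (0 < x)%R by apply: lt_le_trans xe; rewrite exprn_gt0// invr_gt0.
  have sx0 : (0 < Num.sqrt x)%R by rewrite sqrtr_gt0.
  rewrite derive_sqrt1// sub0r normrN gtr0_norm ?invr_gt0 ?mulr_gt0//.
  rewrite -[leRHS]invrK lef_pV2 ?posrE ?invr_gt0 ?mulr_gt0//.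
  rewrite (@le_trans _ _ (Num.sqrt x))//; last by rewrite ler_peMl ?ltW// ltr1n.
  by rewrite (le_trans (ler_norm _))// -sqrtr_sqr ler_wsqrtr.
- split; last by apply: cvg_at_right_filter; exact: sqrt_continuous.
  move=> x; rewrite in_itv/= andbT => ax.
  by have [] := is_derive1_sqrt (lt_trans a0 ax).
- apply/cvgryPge => A; near=> x.
  have xA : (A ^+ 2 <= x)%R by near: x; apply: nbhs_pinfty_ge; exact: num_real.
  by rewrite (le_trans (ler_norm A))// -sqrtr_sqr ler_wsqrtr.
- by apply: continuous_subspaceT; exact: continuous_gauss_fun.
- by move=> x _; exact: gauss_fun_ge0.
Unshelve. all: by end_near. Qed.

(** The substitution is singular at [0]: it is made on the half-lines away from
    [0], which then exhaust the positive numbers. *)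
Lemma Gamma_one_half : Gamma (1 / 2) = Num.sqrt pi :> R.
Proof.
pose b k : R := (k.+1%:R^-1)%R.
have b0 k : (0 < b k)%R by rewrite invr_gt0.
have decb i j : (i <= j)%N -> (b j <= b i)%R.
  by move=> ij; rewrite lef_pV2 ?posrE// ler_nat.
have U (c : R -> R) : (forall x, 0 < x -> 0 < c x)%R ->
    (forall x, 0 < x -> exists k, c (b k) <= x)%R ->
    \bigcup_k [set` `[c (b k), +oo[%R] = [set` `]0%R, +oo[%R].
  move=> c0 ck; apply/seteqP; split=> [x [k _]|x]; rewrite /= !in_itv/= !andbT.
    by apply: lt_le_trans; exact: c0.
  by move=> /ck[k kx]; exists k => //=; rewrite in_itv/= kx.
have b_lt (x : R) : (0 < x)%R -> exists k, (b k <= x)%R.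
  move=> x0; near \oo => k; exists k; apply: ltW; near: k.
  exact: (near_infty_natSinv_lt (PosNum x0)).
have c1 : \int[mu]_(x in [set` `[b k, +oo[%R]) (gauss_fun x)%:E @[k --> \oo] -->
    \int[mu]_(x in [set` `]0%R, +oo[%R]) (gauss_fun x)%:E.
  rewrite -(U id)//; apply: ge0_nondecreasing_set_cvg_integral => //.
  - move=> i j ij; apply/subsetPset => x /=; rewrite !in_itv/= !andbT.
    exact/le_trans/decb.
  - move=> i; apply/measurable_EFinP; apply: measurable_funTS; exact: measurable_gauss_fun.
  - by move=> i x _; rewrite lee_fin gauss_fun_ge0.
have c2 : \int[mu]_(x in [set` `[(b k ^+ 2)%R, +oo[%R]) (2^-1 * g x)%:E @[k --> \oo] -->
    \int[mu]_(x in [set` `]0%R, +oo[%R]) (2^-1 * g x)%:E.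
  rewrite -(U (fun x => x ^+ 2)%R); last 2 first.
  - by move=> x x0; rewrite exprn_gt0.
  - move=> x x0; have [k kx] := b_lt (Num.sqrt x) ltac:(by rewrite sqrtr_gt0).
    by exists k; rewrite -(sqr_sqrtr (ltW x0)) ler_sqr// nnegrE ?sqrtr_ge0// ltW.
  apply: ge0_nondecreasing_set_cvg_integral => //.
  - move=> i j ij; apply/subsetPset => x /=; rewrite !in_itv/= !andbT.
    apply: le_trans; rewrite ler_sqr ?nnegrE; [exact: decb|exact: ltW|exact: ltW].
  - by move=> i; apply/measurable_EFinP; apply: measurable_funTS; exact: measurable_funM.
  - by move=> i x _; rewrite lee_fin mulr_ge0.
have E : \int[mu]_(x in [set` `]0%R, +oo[%R]) (2^-1 * g x)%:E = (Num.sqrt pi / 2)%:E.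
  rewrite -integral0y_gauss -integral_itv_obnd_cbnd; last first.
    by apply/measurable_EFinP; apply: measurable_funTS; exact: measurable_gauss_fun.
  have E k : \int[mu]_(x in [set` `[(b k ^+ 2)%R, +oo[%R]) (2^-1 * g x)%:E =
      \int[mu]_(x in [set` `[b k, +oo[%R]) (gauss_fun x)%:E.
    by rewrite -gauss_substitution ?exprn_gt0// sqrtr_sqr gtr0_norm.
  move: c2; under eq_fun do rewrite E.
  by move=> c2; exact: (cvg_unique _ c2 c1).
rewrite /Gamma /Rintegral.
under eq_integral do rewrite -/(g _).
have : \int[mu]_(x in [set` `]0%R, +oo[%R]) (g x)%:E = (Num.sqrt pi)%:E.
  have -> : Num.sqrt pi = (2 * (Num.sqrt pi / 2))%R :> R by rewrite mulrCA divff ?mulr1.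
  rewrite EFinM -E -ge0_integralZl_EFin//.
  - by apply: eq_integral => x _; rewrite -EFinM mulrA divff// mul1r.
  - by move=> x _; rewrite lee_fin mulr_ge0.
  - by apply/measurable_EFinP; apply: measurable_funTS; exact: measurable_funM.
by move=> ->.
Unshelve. all: by end_near. Qed.

End gamma_one_half.

Section gamma_constants.
Local Open Scope ereal_scope.
Context {R : realType}.
Notation mu := (@lebesgue_measure R).

Definition beta_half (d : nat) : \bar R :=
  \int[mu]_t (half_power d (1 - t ^+ 2))%:E.

Definition gamma_half (d : nat) : \bar R :=
  \int[mu]_v (half_power d v * expR (- v))%:E.

Let measurable_f d : measurable_fun [set: R * R]
  (fun z => (half_power d (z.2 - z.1 ^+ 2) * expR (- z.2))%:E).
Proof.
apply/measurable_EFinP; apply: measurable_funM.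
  apply: measurableT_comp; first exact: measurable_half_power.
  by apply: measurable_funB => //; exact: measurable_funX.
by apply: measurableT_comp => //; exact: measurableT_comp.
Qed.

Let measurable_quad d u : measurable_fun [set: R]
  (fun t => (half_power d (u - t ^+ 2))%:E).
Proof.
apply/measurable_EFinP; apply: measurableT_comp; first exact: measurable_half_power.
by apply: measurable_funB.
Qed.

Let measurable_ge d : measurable_fun [set: R] (fun v => (half_power d v * expR (- v))%:E).
Proof.
apply/measurable_EFinP; apply: measurable_funM; first exact: measurable_half_power.
exact: measurableT_comp.
Qed.

(** Homogeneity: substitute [sqrt u * t] for [t]. *)
Lemma integral_half_power_slice0 d u :
  \int[mu]_t (half_power d (u - t ^+ 2))%:E = (half_power d.+1 u)%:E * beta_half d.
Proof.
have [u0|u0] := ltP 0%R u; last first.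
  rewrite {2}/half_power ltNge u0/= mul0e integral0_eq// => t _.
  by rewrite /half_power ltNge subr_le0 (le_trans u0) ?sqr_ge0.
have su : (0 < Num.sqrt u)%R by rewrite sqrtr_gt0.
rewrite (@ge0_integral_affine _ (Num.sqrt u) 0)//; last first.
  by move=> t; rewrite lee_fin half_power_ge0.
under eq_integral => t _.
  rewrite addr0 exprMn sqr_sqrtr ?ltW// -{1}(mulr1 u) -mulrBr half_powerM// EFinM.
  over.
rewrite /= (ge0_integralZl mu measurableT (measurable_quad d 1)).
- by rewrite muleA -EFinM -exprS /half_power u0.
- by move=> t _; rewrite lee_fin half_power_ge0.
- by rewrite lee_fin exprn_ge0// ltW.
Qed.

Lemma gamma_half0 : gamma_half 0 = 1.
Proof.
rewrite -(integral_exponential_pdf (@ltr01 R)).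
transitivity (\int[mu]_(v in `]0%R, +oo[) (expR (- v))%:E).
  rewrite [RHS]integral_mkcond; apply: eq_integral => v _.
  rewrite patchE /half_power expr0 mem_setE in_itv/= andbT.
  by case: ifP => _; rewrite ?mul1r ?mul0r.
rewrite integral_itv_obnd_cbnd; last first.
  by apply/measurable_EFinP; apply: measurableT_comp => //; exact: measurableT_comp.
rewrite [LHS]integral_mkcond; apply: eq_integral => v _.
rewrite /exponential_pdf !patchE; case: ifP => // _.
by rewrite mul1r mulN1r.
Qed.

(** The integral of [(u - t^2)^(d/2) exp (- u)] over the plane, computed in both
    orders; shifting [u] by [t^2] splits off a Gaussian integral. *)
Lemma gamma_half_rec d :
  gamma_half d * (Num.sqrt pi)%:E = gamma_half d.+1 * beta_half d.
Proof.
transitivity (\int[mu]_t \int[mu]_u (half_power d (u - t ^+ 2) * expR (- u))%:E).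
  have mg : measurable_fun [set: R] (fun t => (gauss_fun t)%:E).
    by apply/measurable_EFinP; exact: measurable_gauss_fun.
  rewrite -integralT_gauss muleC -(ge0_integralZr mu measurableT mg); last 2 first.
  - by move=> t _; rewrite lee_fin gauss_fun_ge0.
  - by apply: integral_ge0 => v _; rewrite lee_fin mulr_ge0// ?half_power_ge0 ?expR_ge0.
  apply: eq_integral => t _.
  rewrite (@ge0_integral_shift _ (t ^+ 2) (fun u => (half_power d (u - t ^+ 2) * expR (- u))%:E)).
  - rewrite -(ge0_integralZl mu measurableT (measurable_ge d)); last 2 first.
    + by move=> v _; rewrite lee_fin mulr_ge0// ?half_power_ge0 ?expR_ge0.
    + by rewrite lee_fin gauss_fun_ge0.
    apply: eq_integral => u _; rewrite addrK opprD expRD -EFinM.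
    by rewrite /gauss_fun mulrCA [(expR (- u) * _)%R]mulrC.
  - exact: (measurableT_comp (measurable_f d) (pair1_measurable t)).
  - by move=> u; rewrite lee_fin mulr_ge0// ?half_power_ge0 ?expR_ge0.
have f0 (z : R * R) : 0 <= (half_power d (z.2 - z.1 ^+ 2) * expR (- z.2))%:E.
  by rewrite lee_fin mulr_ge0// ?half_power_ge0 ?expR_ge0.
rewrite (fubini_tonelli (m1 := mu) (m2 := mu) _ (measurable_f d) f0)//=.
rewrite /gamma_half -(ge0_integralZr mu measurableT (measurable_ge d.+1)); last 2 first.
- by move=> t _; rewrite lee_fin mulr_ge0// ?half_power_ge0 ?expR_ge0.
- by apply: integral_ge0 => v _; rewrite lee_fin half_power_ge0.
apply: eq_integral => u _.
under eq_integral do rewrite EFinM.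
rewrite /= (ge0_integralZr mu measurableT (measurable_quad d u)).
- by rewrite integral_half_power_slice0 EFinM muleAC.
- by move=> t _; rewrite lee_fin half_power_ge0.
- by rewrite lee_fin expR_ge0.
Qed.

Lemma GammaE d : Gamma (d%:R / 2 + 1) = fine (gamma_half d) :> R.
Proof.
rewrite /Gamma /Rintegral; congr fine; rewrite integral_mkcond.
apply: eq_integral => x _; rewrite patchE mem_setE in_itv/= andbT /half_power.
case: ifPn => x0; last by rewrite mul0r.
by rewrite addrK [(d%:R / 2)%R]mulrC powRrM powR12_sqrt ?ltW// powR_mulrn ?sqrtr_ge0.
Qed.

Let gamma_half_ge0 d : 0 <= gamma_half d.
Proof. by apply: integral_ge0 => v _; rewrite lee_fin mulr_ge0// ?half_power_ge0 ?expR_ge0. Qed.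

Lemma gamma_half_fin d : 0 < gamma_half d < +oo.
Proof.
have beta_ge0 e : 0 <= beta_half e :> \bar R.
  by apply: integral_ge0 => v _; rewrite lee_fin half_power_ge0.
have pi0 : (0 < Num.sqrt pi :> R)%R by rewrite sqrtr_gt0 pi_gt0.
elim: d => [|d /andP[d0 doo]]; first by rewrite gamma_half0 lte01 ltry.
have P0 : 0 < gamma_half d.+1 * beta_half d by rewrite -gamma_half_rec mule_gt0.
have Poo : gamma_half d.+1 * beta_half d < +oo.
  by rewrite -gamma_half_rec lte_mul_pinfty ?ltry// ?ge0_fin_numE// ltW.
have g0 : gamma_half d.+1 != 0 by apply: contraTneq P0 => ->; rewrite mul0e ltxx.
have b0 : beta_half d != 0 :> \bar R by apply: contraTneq P0 => ->; rewrite mule0 ltxx.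
rewrite lt0e g0 gamma_half_ge0/= ltey; apply: contraTneq Poo => ->.
by rewrite gt0_mulye ?ltxx// lt0e b0 beta_ge0.
Qed.

Lemma omega_ge0 d : (0 <= omega d :> R)%R.
Proof. by rewrite /omega GammaE Gamma_one_half divr_ge0 ?exprn_ge0 ?sqrtr_ge0 ?fine_ge0. Qed.

Lemma omega_gt0 d : (0 < omega d :> R)%R.
Proof.
rewrite /omega GammaE Gamma_one_half divr_gt0 ?exprn_gt0 ?sqrtr_gt0 ?pi_gt0//.
by rewrite fine_gt0// gamma_half_fin.
Qed.

Lemma omega0 : omega 0 = 1%R :> R.
Proof. by rewrite /omega GammaE gamma_half0/= expr0 divr1. Qed.

(** With [Gamma (1/2) = sqrt pi] this is the recursion [gamma_half_rec]. *)
Lemma omegaS d : (omega d)%:E * beta_half d = (omega d.+1)%:E :> \bar R.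
Proof.
have /andP[g0 goo] := gamma_half_fin d; have /andP[g1 goo1] := gamma_half_fin d.+1.
have gfin : gamma_half d \is a fin_num by rewrite ge0_fin_numE ?ltW.
have gfin1 : gamma_half d.+1 \is a fin_num by rewrite ge0_fin_numE ?ltW.
have b_fin : beta_half d \is a fin_num :> bool.
  have := gamma_half_rec d; rewrite -(fineK gfin) -(fineK gfin1) -EFinM.
  have f0 : (0 < fine (gamma_half d.+1))%R by rewrite fine_gt0 ?g1.
  by case: (beta_half d) => // /esym; rewrite ?gt0_muley ?gt0_muleNy ?lte_fin.
have := gamma_half_rec d; rewrite /omega !GammaE Gamma_one_half.
rewrite -(fineK gfin) -(fineK gfin1) -(fineK b_fin) -!EFinM => -[E]; congr EFin.
rewrite /= exprS; set x := fine (gamma_half d); set y := fine (gamma_half d.+1).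
have x0 : x != 0%R by rewrite gt_eqF// fine_gt0 ?g0.
have y0 : y != 0%R by rewrite gt_eqF// fine_gt0 ?g1.
apply: (mulIf y0); rewrite divfK// -mulrA [(fine _ * y)%R]mulrC -E.
by rewrite mulrA divfK// mulrC.
Qed.

Lemma integral_half_power_slice d u :
  \int[mu]_t (omega d * half_power d (u - t ^+ 2))%:E =
  (omega d.+1 * half_power d.+1 u)%:E.
Proof.
under eq_integral do rewrite EFinM.
rewrite (ge0_integralZl mu measurableT (measurable_quad d u)).
- by rewrite integral_half_power_slice0 muleCA omegaS -EFinM mulrC.
- by move=> t _; rewrite lee_fin half_power_ge0.
- by rewrite lee_fin omega_ge0.
Qed.

End gamma_constants.

(** * Euclidean norm and balls *)

Section ball_integral.
Local Open Scope ereal_scope.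
Context {R : realType}.

Lemma measurable_half_power_quad n d (u : R) (c : 'rV[R]_n) :
  measurable_fun [set: borelRn R n] (fun y =>
    (omega d * half_power d (u - \sum_(i < n) ((y : 'rV[R]_n) ord0 i - c ord0 i) ^+ 2))%:E)%R.
Proof.
apply/measurable_EFinP; apply: measurable_funM => //.
apply: measurableT_comp; first exact: measurable_half_power.
apply: measurable_funB => //; apply: measurable_sum => i.
apply: measurable_funX; apply: measurable_funB => //; exact: measurable_coord.
Qed.

(** Cavalieri's principle for a ball: the slice over [y] of a ball of squared
    radius [u] has squared radius [u - |y - c|^2], and the constants [omega]
    are exactly those for which the volumes of the slices add up. *)
Lemma integral_half_power_quad n d (u : R) (c : 'rV[R]_n) :
  \int[lebn]_y (omega d *
    half_power d (u - \sum_(i < n) ((y : 'rV[R]_n) ord0 i - c ord0 i) ^+ 2))%:E%R =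
  (omega (d + n) * half_power (d + n) u)%:E.
Proof.
have ge0 m v : (0 <= omega m * half_power m v :> R)%R.
  by rewrite mulr_ge0 ?omega_ge0 ?half_power_ge0.
elim: n u c => [|n IH] u c.
  rewrite integral_lebn0; last by move=> y; rewrite lee_fin.
  by rewrite big_ord0 subr0 addn0.
rewrite integral_lebnS; last 2 first.
- exact: measurable_half_power_quad.
- by move=> y; rewrite lee_fin.
transitivity (\int[lebesgue_measure]_t
    (omega (d + n) * half_power (d + n) (u - (t - c ord0 ord0) ^+ 2))%:E%R).
  apply: eq_integral => t _.
  rewrite -(IH _ (\row_j c ord0 (lift ord0 j))%R); apply: eq_integral => v _.
  rewrite big_ord_recl rcons_row0 opprD addrA.
  congr (omega d * half_power d (_ - _))%:E%R.
  by apply: eq_bigr => i _; rewrite rcons_rowS mxE.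
rewrite addnS -(integral_half_power_slice (d + n) u).
rewrite (@ge0_integral_shift _ (c ord0 ord0)).
- by apply: eq_integral => t _; rewrite addrK.
- apply/measurable_EFinP; apply: measurable_funM => //.
  apply: measurableT_comp; first exact: measurable_half_power.
  by apply: measurable_funB => //; apply: measurable_funX; exact: measurable_funB.
- by move=> t; rewrite lee_fin.
Qed.

End ball_integral.

Section euclidean_norm.
Context {R : realType}.

(** Minkowski's inequality, by Cauchy-Schwarz. *)
Lemma sqrt_sum_triangle (I : finType) (a b : I -> R) :
  Num.sqrt (\sum_i (a i + b i) ^+ 2) <=
  Num.sqrt (\sum_i a i ^+ 2) + Num.sqrt (\sum_i b i ^+ 2).
Proof.
set A := \sum_i a i ^+ 2; set B := \sum_i b i ^+ 2.
have A0 : 0 <= A by apply: sumr_ge0 => i _; rewrite sqr_ge0.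
have B0 : 0 <= B by apply: sumr_ge0 => i _; rewrite sqr_ge0.
set s := Num.sqrt A; set t := Num.sqrt B.
have s2 : s ^+ 2 = A by rewrite sqr_sqrtr.
have t2 : t ^+ 2 = B by rewrite sqr_sqrtr.
have s0 : 0 <= s := sqrtr_ge0 _; have t0 : 0 <= t := sqrtr_ge0 _.
have CS : \sum_i a i * b i <= s * t.
  have [st|st] := eqVneq (s * t) 0.
    rewrite st big1// => i _; apply/eqP; move/eqP: st.
    rewrite !mulf_eq0 !sqrtr_eq0 => /orP[] X0; apply/orP; [left|right].
      have /eqP : A = 0 by apply/le_anti; rewrite X0.
      by rewrite psumr_eq0; [move=> /allP/(_ i (mem_index_enum _)); rewrite sqrf_eq0|move=> *; rewrite sqr_ge0].
    have /eqP : B = 0 by apply/le_anti; rewrite X0.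
    by rewrite psumr_eq0; [move=> /allP/(_ i (mem_index_enum _)); rewrite sqrf_eq0|move=> *; rewrite sqr_ge0].
  have st0 : 0 < s * t by rewrite lt0r st mulr_ge0.
  (* expanding this square gives Cauchy-Schwarz after division by 2 s t *)
  have : 0 <= \sum_i (t * a i - s * b i) ^+ 2 by apply: sumr_ge0 => i _; rewrite sqr_ge0.
  under eq_bigr => i _.
    rewrite (_ : _ ^+ 2 = t ^+ 2 * a i ^+ 2 + (s ^+ 2 * b i ^+ 2 - (2 * (s * t)) * (a i * b i))); last by ring.
    over.
  rewrite big_split/= sumrB -!mulr_sumr -/A -/B s2 t2 => h.
  rewrite -subr_ge0 -(pmulr_rge0 _ st0) -(pmulr_rge0 _ (ltr0Sn R 1)).
  move: h; set X := \sum_i _; rewrite -s2 -t2 => h.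
  by apply: le_trans h _; rewrite le_eqVlt; apply/orP; left; apply/eqP; ring.
rewrite -(ler_sqr _ _) ?nnegrE ?addr_ge0 ?sqrtr_ge0// sqr_sqrtr; last first.
  by apply: sumr_ge0 => i _; rewrite sqr_ge0.
rewrite sqrrD s2 t2.
under eq_bigr do rewrite sqrrD.
rewrite !big_split/= -/A -/B lerD2r lerD2l.
by rewrite mulr2n lerD.
Qed.

Section dim.
Context {p q : nat}.
Implicit Types x y c : 'M[R]_(p, q).

Lemma enormE x : enorm x = Num.sqrt (\sum_(ij : 'I_p * 'I_q) x ij.1 ij.2 ^+ 2).
Proof. by rewrite /enorm pair_big. Qed.

Lemma enorm_ge0 x : 0 <= enorm x. Proof. exact: sqrtr_ge0. Qed.

Lemma enorm_sqr x : enorm x ^+ 2 = \sum_i \sum_j x i j ^+ 2.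
Proof. by rewrite sqr_sqrtr//; do 2![apply: sumr_ge0 => ? _]; rewrite sqr_ge0. Qed.

Lemma enormD x y : enorm (x + y) <= enorm x + enorm y.
Proof.
rewrite !enormE; apply: le_trans (sqrt_sum_triangle _ _).
by under eq_bigr do rewrite mxE.
Qed.

Lemma enormZ a x : enorm (a *: x) = `|a| * enorm x.
Proof.
rewrite /enorm -sqrtr_sqr -sqrtrM ?sqr_ge0// mulr_sumr; congr Num.sqrt.
by apply: eq_bigr => i _; rewrite mulr_sumr; apply: eq_bigr => j _; rewrite mxE exprMn.
Qed.

Lemma enormN x : enorm (- x) = enorm x.
Proof. by rewrite -scaleN1r enormZ normrN1 mul1r. Qed.

Lemma enorm0 : enorm (0 : 'M[R]_(p, q)) = 0.
Proof. by rewrite -(scale0r 0) enormZ normr0 mul0r. Qed.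

Lemma enormB x y : enorm (x - y) = enorm (y - x).
Proof. by rewrite -enormN opprB. Qed.

Lemma enorm_dist_triangle x y c : enorm (x - y) <= enorm (x - c) + enorm (y - c).
Proof. by rewrite (enormB y c) -{1}(subrKA c); exact: enormD. Qed.

Lemma open_eball_dist c r x y :
  open_eball c r x -> open_eball c r y -> enorm (x - y) <= 2 * r.
Proof.
move=> /ltW xr /ltW yr; rewrite (le_trans (enorm_dist_triangle x y c))//.
by rewrite mulr_natl mulr2n lerD.
Qed.

Let diam_set c r := [set enorm (z.1 - z.2) | z in open_eball c r `*` open_eball c r].

Let diam_has_sup c r : 0 < r -> has_sup (diam_set c r).
Proof.
move=> r0; split.
  by exists (enorm (c - c)), (c, c) => //; split; rewrite /open_eball/= subrr enorm0.
by exists (2 * r) => _ [[x y]/= [xr yr] <-]; exact: open_eball_dist xr yr.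
Qed.

Lemma open_eball_le_diam c r x y :
  open_eball c r x -> open_eball c r y -> enorm (x - y) <= diam (open_eball c r).
Proof.
move=> xr yr; have r0 : 0 < r by apply: le_lt_trans xr; exact: enorm_ge0.
by apply: sup_upper_bound; [exact: diam_has_sup|exists (x, y)].
Qed.

Lemma diam_open_eball_ge0 c r : 0 < r -> 0 <= diam (open_eball c r).
Proof.
by move=> r0; rewrite -(enorm0) -(subrr c) open_eball_le_diam// /open_eball/= subrr enorm0.
Qed.

Lemma diam_open_eball_le c r : 0 < r -> diam (open_eball c r) <= 2 * r.
Proof.
move=> r0; apply: sup_le_ub; first exact: (diam_has_sup c r0).1.
by move=> _ [[x y]/= [xr yr] <-]; exact: open_eball_dist xr yr.
Qed.

Lemma enorm_delta i j : enorm (delta_mx i j : 'M[R]_(p, q)) = 1.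
Proof.
rewrite enormE (bigD1 (i, j))//= mxE !eqxx expr1n big1 ?addr0 ?sqrtr1//.
move=> [i' j'] /=; rewrite xpair_eqE mxE => /negbTE ->.
by rewrite expr0n.
Qed.

(** Two nearly antipodal points on a coordinate axis; there is none in dimension
    zero, where balls have diameter [0]. *)
Lemma diam_open_eball c r : (0 < p)%N -> (0 < q)%N -> 0 < r ->
  diam (open_eball c r) = 2 * r.
Proof.
move=> p0 q0 r0; apply/eqP; rewrite eq_le diam_open_eball_le//=.
pose e : 'M[R]_(p, q) := delta_mx (Ordinal p0) (Ordinal q0).
apply/ler_addgt0Pl => t t0.
pose a := Num.max 0 (r - t / 2).
have a0 : 0 <= a by rewrite le_max lexx.
have ar : a < r by rewrite gt_max r0/= ltrBlDr ltrDl divr_gt0.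
have ba b : `|b| = a -> open_eball c r (c + b *: e).
  by move=> ba; rewrite /open_eball/= addrC addKr enormZ enorm_delta mulr1 ba.
have := open_eball_le_diam (ba a (ger0_norm a0)) (ba (- a) _).
rewrite normrN ger0_norm// => /(_ erefl).
rewrite opprD addrACA subrr add0r -scaleNr -scalerDl opprK enormZ enorm_delta mulr1.
rewrite ger0_norm ?addr_ge0// => h.
rewrite -lerBlDl; apply: le_trans h.
have : r - t / 2 <= a by rewrite le_max lexx orbT.
lra.
Qed.

Lemma diam_open_eball_translate c c' r : diam (open_eball c r) = diam (open_eball c' r).
Proof.
congr sup; apply/seteqP; split=> _ [[x y]/= [xr yr] <-].
  exists (x - c + c', y - c + c'); last by rewrite /= opprD addrACA subrr addr0 opprB addrA subrK.
  by split; rewrite /open_eball/= addrK.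
exists (x - c' + c, y - c' + c); last by rewrite /= opprD addrACA subrr addr0 opprB addrA subrK.
by split; rewrite /open_eball/= addrK.
Qed.

End dim.

Lemma enorm_rV_sqr n (x : 'rV[R]_n) : enorm x ^+ 2 = \sum_i x ord0 i ^+ 2.
Proof. by rewrite enorm_sqr big_ord1. Qed.

Lemma enorm_row_le p q (x : 'M[R]_(p, q)) i : enorm (row i x) <= enorm x.
Proof.
rewrite -ler_sqr ?nnegrE ?enorm_ge0// enorm_rV_sqr enorm_sqr (bigD1 i)//=.
under eq_bigr do rewrite mxE.
by rewrite lerDl; do 2![apply: sumr_ge0 => ? _]; rewrite sqr_ge0.
Qed.

Lemma enorm_col_mx_sqr N n (y : 'rV[R]_n) (x : 'M[R]_(N, n)) :
  enorm (col_mx y x) ^+ 2 = enorm y ^+ 2 + enorm x ^+ 2.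
Proof.
rewrite !enorm_sqr big_split_ord/=; congr +%R; apply: eq_bigr => i _; apply: eq_bigr => j _.
  by rewrite col_mxEu.
by rewrite col_mxEd.
Qed.

End euclidean_norm.

(** * Spherical measure *)

Section spherical_measure_theory.
Local Open Scope ereal_scope.
Context {R : realType} {p q : nat}.
Variable d : nat.
Implicit Types A E : set 'M[R]_(p, q).

Definition eball (b : 'M[R]_(p, q) * R) : set 'M[R]_(p, q) := open_eball b.1 b.2.

Definition small_eball (eps : R) : set ('M[R]_(p, q) * R) :=
  [set b | (0 < b.2)%R /\ (diam (eball b) < eps)%R].

Definition eball_cost (b : 'M[R]_(p, q) * R) : R :=
  (omega d * 2 ^- d * diam (eball b) ^+ d)%R.

Lemma eball_cost_ge0 b : (0 < b.2)%R -> (0 <= eball_cost b)%R.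
Proof.
move=> b0; apply: mulr_ge0; first by rewrite mulr_ge0 ?omega_ge0// invr_ge0 exprn_ge0.
by apply: exprn_ge0; exact: diam_open_eball_ge0.
Qed.

Lemma small_eball_cost_ge0 eps b : small_eball eps b -> (0 <= eball_cost b)%R.
Proof. by case=> b0 _; exact: eball_cost_ge0. Qed.

Lemma spherical_premeasureE eps :
  spherical_premeasure d eps = cover_inf (small_eball eps) eball eball_cost.
Proof.
apply/funext => A; congr ereal_inf.
apply/seteqP; split=> [s [D [c [rad [rad0 dia cov ->]]]]|s [D [x [Dx cov ->]]]].
  exists D, (fun j => (c j, rad j)); split => //; first by move=> i Di; split; [exact: rad0|exact: dia].
  rewrite nneseries_esum ?set_mem_set// => j; rewrite inE lee_fin => Dj.
  by apply: (@eball_cost_ge0 (c j, rad j)); exact: rad0.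
exists D, (fst \o x), (snd \o x); split => //; try by move=> i /Dx[].
rewrite nneseries_esum ?set_mem_set// => j; rewrite inE lee_fin => Dj.
by apply: (@eball_cost_ge0 (x j)); case: (Dx _ Dj).
Qed.

Lemma spherical_premeasure_ge0 eps A : 0 <= spherical_premeasure d eps A.
Proof. by rewrite spherical_premeasureE; apply: cover_inf_ge0; exact: small_eball_cost_ge0. Qed.

Lemma le_spherical_premeasure eps A E : A `<=` E ->
  spherical_premeasure d eps A <= spherical_premeasure d eps E.
Proof. by rewrite spherical_premeasureE; exact: le_cover_inf. Qed.

Lemma spherical_premeasure_anti eps eps' A : (eps' <= eps)%R ->
  spherical_premeasure d eps A <= spherical_premeasure d eps' A.
Proof.
move=> ee; rewrite !spherical_premeasureE; apply: ereal_inf_le_tmp => _ [D [x [Dx cov ->]]].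
by exists D, x; split => // i /Dx[? ?]; split => //; exact: lt_le_trans ee.
Qed.

Lemma spherical_premeasure_bigcup eps (J : countType) (K : set J) (F : J -> set 'M[R]_(p, q)) :
  spherical_premeasure d eps (\bigcup_(j in K) F j) <=
  \esum_(j in K) spherical_premeasure d eps (F j).
Proof.
by rewrite spherical_premeasureE; apply: cover_inf_bigcup; exact: small_eball_cost_ge0.
Qed.

Lemma spherical_measure_sup A :
  spherical_measure d A = ereal_sup [set spherical_premeasure d eps A | eps in [set` `]0%R, +oo[%R]].
Proof.
apply/cvg_lim => //; apply: nonincreasing_at_right_cvge => //.
by move=> x y _ _; exact: spherical_premeasure_anti.
Qed.

Lemma spherical_premeasure_le eps A : (0 < eps)%R ->
  spherical_premeasure d eps A <= spherical_measure d A.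
Proof.
move=> e0; rewrite spherical_measure_sup; apply: ereal_sup_ubound.
by exists eps => //=; rewrite in_itv/= e0.
Qed.

Lemma spherical_measure_le A M :
  (forall eps, (0 < eps)%R -> spherical_premeasure d eps A <= M) -> spherical_measure d A <= M.
Proof.
move=> H; rewrite spherical_measure_sup; apply: ge_ereal_sup => _ [e/= +] <-.
by rewrite in_itv/= andbT => /H.
Qed.

Lemma spherical_measure_ge0 A : 0 <= spherical_measure d A.
Proof. by apply: le_trans (spherical_premeasure_le A ltr01); exact: spherical_premeasure_ge0. Qed.

Lemma le_spherical_measure A E : A `<=` E -> spherical_measure d A <= spherical_measure d E.
Proof.
move=> AE; apply: spherical_measure_le => e e0.
by apply: le_trans (spherical_premeasure_le _ e0); exact: le_spherical_premeasure.
Qed.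

Lemma spherical_measureU A E :
  spherical_measure d (A `|` E) <= spherical_measure d A + spherical_measure d E.
Proof.
apply: spherical_measure_le => e e0.
have -> : A `|` E = \bigcup_(b in [set: bool]) (if b then A else E).
  apply/seteqP; split=> [x [Ax|Ex]|x [[] _ ?]]; [by exists true|by exists false|by left|by right].
apply: le_trans (spherical_premeasure_bigcup _ _ _) _.
rewrite (esumID [set true]); last by move=> *; exact: spherical_premeasure_ge0.
rewrite !setTI (_ : ~` [set true] = [set false]); last first.
  by apply/seteqP; split=> [[] //= h|_ -> //]; case: h.
by rewrite !esum_set1 ?spherical_premeasure_ge0// leeD// spherical_premeasure_le.
Qed.

Let inv_nat_gt0 k : (0 < k.+1%:R^-1 :> R)%R. Proof. by rewrite invr_gt0. Qed.

Lemma spherical_premeasure_near eps A : (0 < eps)%R ->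
  \forall k \near \oo, spherical_premeasure d eps A <= spherical_premeasure d k.+1%:R^-1 A.
Proof.
move=> e0; near=> k; apply: spherical_premeasure_anti; apply/ltW; near: k.
exact: (near_infty_natSinv_lt (PosNum e0)).
Unshelve. all: by end_near. Qed.

Lemma cvg_spherical_premeasure A :
  spherical_premeasure d k.+1%:R^-1 A @[k --> \oo] --> spherical_measure d A.
Proof.
have -> : spherical_measure d A = ereal_sup (range (fun k => spherical_premeasure d k.+1%:R^-1 A)).
  apply/eqP; rewrite eq_le; apply/andP; split.
    apply: spherical_measure_le => e e0.
    have [k _ /(_ k (leqnn _))] := spherical_premeasure_near A e0.
    by move/le_trans; apply; apply: ereal_sup_ubound; exists k.
  by apply: ge_ereal_sup => _ [k _ <-]; exact: spherical_premeasure_le.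
apply: ereal_nondecreasing_cvgn => i j ij; apply: spherical_premeasure_anti.
by rewrite lef_pV2 ?posrE// ler_nat.
Qed.

(** A ball of diameter less than [delta] meets at most one of the pieces, so a
    fine enough cover of [E] splits into covers of the pieces. *)
Lemma spherical_measure_separated (J : finType) (F : J -> set 'M[R]_(p, q)) E (delta : R) :
  (0 < delta)%R -> (forall j, F j `<=` E) ->
  (forall i j x y, i != j -> F i x -> F j y -> (delta <= enorm (x - y))%R) ->
  \sum_(j : J) spherical_measure d (F j) <= spherical_measure d E.
Proof.
move=> delta0 FE sep.
have pre e : (0 < e)%R -> (e <= delta)%R ->
    \sum_(j : J) spherical_premeasure d e (F j) <= spherical_premeasure d e E.
  move=> e0 ed; rewrite spherical_premeasureE.
  apply: le_ereal_inf_tmp => _ [D [x [Dx cov ->]]].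
  pose DJ j := [set i | exists2 z, F j z & eball (x i) z].
  have DJtriv i j k : D k -> DJ i k -> DJ j k -> i = j.
    move=> Dk [z Fiz xz] [z' Fjz xz']; apply/eqP/negP => /negP ij.
    have := sep _ _ _ _ ij Fiz Fjz; rewrite leNgt => /negP; apply.
    apply: le_lt_trans (open_eball_le_diam xz xz') _.
    by have [_ /lt_le_trans] := Dx _ Dk; apply.
  have c0 i : D i -> 0 <= (eball_cost (x i))%:E.
    by move=> /Dx/small_eball_cost_ge0; rewrite lee_fin.
  apply: (@le_trans _ _ (\sum_(j : J) \esum_(i in D `&` DJ j) (eball_cost (x i))%:E)).
    apply: lee_sum => j _.
    apply: (@cover_inf_le _ _ _ _ _ _ nat) => [i [/Dx//]|z Fz].
    by have [i Di xz] := cov _ (FE _ _ Fz); exists i => //; split => //; exists z.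
  under eq_bigr do rewrite esum_mkcondr.
  rewrite -esum_sum; last by move=> i j Di _; case: ifP => // _; exact: c0.
  apply: le_esum => i Di.
  have [[j0 ij0]|no] := pselect (exists j, DJ j i).
    rewrite (bigD1 j0)//= mem_set// big1 ?adde0// => j /eqP jj0.
    by case: ifP => //; rewrite inE => ij; case: jj0; exact: (DJtriv _ _ i).
  rewrite big1 ?c0// => j _; case: ifP => //; rewrite inE => ij.
  by case: no; exists j.
have cvgs : \sum_(j : J) spherical_premeasure d k.+1%:R^-1 (F j) @[k --> \oo] -->
    \sum_(j : J) spherical_measure d (F j).
  apply: cvg_nnesum => [j _|j _]; first by apply: nearW => k; exact: spherical_premeasure_ge0.
  exact: cvg_spherical_premeasure.
rewrite -(cvg_lim _ cvgs)//; apply: lime_le; first by apply/cvg_ex; eexists; exact: cvgs.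
near=> k.
apply: le_trans (spherical_premeasure_le E (inv_nat_gt0 k)); apply: pre => //.
by apply/ltW; near: k; exact: (near_infty_natSinv_lt (PosNum delta0)).
Unshelve. all: by end_near. Qed.

(** An isometry maps a ball into the ball of the same radius around the image of its
    centre, so covers by balls are carried along at the same cost. *)
Lemma spherical_measure_isometry_le (f : 'M[R]_(p, q) -> 'M[R]_(p, q)) E :
  (forall x y, enorm (f x - f y) = enorm (x - y)) ->
  spherical_measure d (f @` E) <= spherical_measure d E.
Proof.
move=> fiso; apply: spherical_measure_le => e e0.
apply: le_trans (spherical_premeasure_le E e0).
rewrite !spherical_premeasureE; apply: le_ereal_inf_tmp => _ [D [x [Dx cov ->]]].
have dE i : diam (eball (f (x i).1, (x i).2)) = diam (eball (x i)).
  by rewrite /eball/=; exact: diam_open_eball_translate.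
rewrite (_ : \esum_(i in D) _ = \esum_(i in D) (eball_cost (f (x i).1, (x i).2))%:E); last first.
  by apply: eq_esum => i _; rewrite /eball_cost dE.
apply: cover_inf_le => [i /Dx[x0 xe]|_ [z Ez <-]].
  by split => //; rewrite dE.
by have [i Di xz] := cov _ Ez; exists i => //; rewrite /eball/open_eball/= fiso.
Qed.

End spherical_measure_theory.

(** * Slices *)

Section slices.
Local Open Scope ereal_scope.
Context {R : realType}.

Definition slice {N n} (E : set 'M[R]_(N.+1, n)) (y : 'rV[R]_n) : set 'M[R]_(N, n) :=
  [set x | E (col_mx y x : 'M[R]_(1 + N, n))].

(** Only an inequality, because a slice may be a point of a space of dimension
    zero, whose balls have diameter [0]. *)
Lemma diam_pow_le (p q d : nat) (c : 'M[R]_(p, q)) r : (0 < r)%R ->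
  (eball_cost d (c, r) <= omega d * r ^+ d)%R.
Proof.
move=> r0; rewrite /eball_cost -mulrA ler_wpM2l ?omega_ge0//.
have -> : (r ^+ d = 2 ^- d * (2 * r) ^+ d)%R by rewrite exprMn mulKf.
rewrite ler_wpM2l ?invr_ge0 ?exprn_ge0//; apply: lerXn2r; rewrite ?nnegrE.
- exact: diam_open_eball_ge0.
- by rewrite mulr_ge0// ltW.
- exact: diam_open_eball_le.
Qed.

Lemma eball_costE (p q d : nat) (c : 'M[R]_(p, q)) r : (0 < p)%N -> (0 < q)%N -> (0 < r)%R ->
  eball_cost d (c, r) = (omega d * r ^+ d)%R.
Proof.
by move=> p0 q0 r0; rewrite /eball_cost diam_open_eball// -mulrA exprMn mulKf.
Qed.

Lemma open_eball_slice N n (C : 'M[R]_(1 + N, n)) r (y : 'rV[R]_n) (x : 'M[R]_(N, n)) :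
  (0 < r)%R -> open_eball C r (col_mx y x) ->
  (0 < r ^+ 2 - enorm (y - usubmx C) ^+ 2)%R /\
  open_eball (dsubmx C) (Num.sqrt (r ^+ 2 - enorm (y - usubmx C) ^+ 2)) x.
Proof.
move=> r0; rewrite /open_eball/= -{1}(vsubmxK C) opp_col_mx add_col_mx.
rewrite -ltr_sqr ?nnegrE ?enorm_ge0 ?ltW// enorm_col_mx_sqr => h.
have h' : (enorm (x - dsubmx C) ^+ 2 < r ^+ 2 - enorm (y - usubmx C) ^+ 2)%R.
  by rewrite ltrBrDl.
have u0 := le_lt_trans (sqr_ge0 _) h'; split => //.
by rewrite -ltr_sqr ?nnegrE ?enorm_ge0 ?sqrtr_ge0// (sqr_sqrtr (ltW u0)).
Qed.

Section cover_of_slices.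
Variables (N n d : nat) (eps : R) (D : set nat) (x : nat -> 'M[R]_(N.+1, n) * R).
Hypothesis n0 : (0 < n)%N.
Hypothesis Dx : forall i, D i -> small_eball eps (x i).

Let top i : 'rV[R]_n := usubmx ((x i).1 : 'M[R]_(1 + N, n)).

Let F i (y : borelRn R n) : \bar R :=
  (omega d * half_power d ((x i).2 ^+ 2 - \sum_j ((y : 'rV[R]_n) ord0 j - top i ord0 j) ^+ 2))%:E.

Let F_ge0 i y : 0 <= F i y.
Proof. by rewrite lee_fin mulr_ge0 ?omega_ge0 ?half_power_ge0. Qed.

(** A ball of a cover of [E] slices to a ball that is not larger, and the cost of
    the slice integrates to the cost of the ball.  The function [G] is the total
    cost of the slices, whence its measurability. *)
Lemma slice_cover_cost : exists G : borelRn R n -> \bar R,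
  [/\ measurable_fun setT G, forall y, 0 <= G y,
      forall E, E `<=` \bigcup_(i in D) eball (x i) ->
        forall y, spherical_premeasure d eps (slice E y) <= G y &
      \int[lebn]_y G y = \esum_(i in D) (eball_cost (d + n) (x i))%:E].
Proof.
have Fser y : \esum_(i in D) F i y = \sum_(i <oo | i \in D) F i y.
  by rewrite nneseries_esum ?set_mem_set.
exists (fun y => \esum_(i in D) F i y); split.
- under eq_fun do rewrite Fser.
  apply: (ge0_emeasurable_sum (h := F)) => [i y _ _|i _]; first exact: F_ge0.
  exact: measurable_half_power_quad.
- by move=> y; apply: esum_ge0 => i _; exact: F_ge0.
- move=> E cov y; rewrite spherical_premeasureE.
  pose u i := ((x i).2 ^+ 2 - enorm ((y : 'rV_n) - top i) ^+ 2)%R.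
  pose z i : 'M[R]_(N, n) * R := (dsubmx ((x i).1 : 'M[R]_(1 + N, n)), Num.sqrt (u i)).
  have uE i : u i = ((x i).2 ^+ 2 - \sum_j ((y : 'rV[R]_n) ord0 j - top i ord0 j) ^+ 2)%R.
    rewrite /u enorm_rV_sqr; congr (_ - _)%R.
    by apply: eq_bigr => j _; rewrite !mxE.
  pose Dy := D `&` [set i | (0 < u i)%R].
  have Dyz i : Dy i -> small_eball eps (z i).
    move=> [Di ui]; have [x0 xe] := Dx Di.
    have s0 : (0 < (z i).2)%R by rewrite sqrtr_gt0.
    split => //; apply: le_lt_trans (diam_open_eball_le _ s0) _.
    apply: le_lt_trans xe; rewrite diam_open_eball// ler_wpM2l//.
    rewrite -ler_sqr ?nnegrE ?sqrtr_ge0 ?(ltW x0)// (sqr_sqrtr (ltW ui)).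
    by rewrite /u lerBlDr lerDl sqr_ge0.
  apply: (@le_trans _ _ (\esum_(i in Dy) (eball_cost d (z i))%:E)).
    apply: cover_inf_le => // t Et.
    have [i Di xt] := cov _ Et; have [x0 _] := Dx Di.
    have [ui zt] := open_eball_slice x0 xt.
    by exists i.
  rewrite esum_mkcondr; apply: le_esum => i Di.
  case: ifPn => [|_]; last exact: F_ge0.
  rewrite inE/= => ui; rewrite /F -uE lee_fin /half_power ui.
  by apply: diam_pow_le; rewrite sqrtr_gt0.
- under eq_integral do rewrite Fser eseries_mkcond.
  rewrite integral_nneseries//; first last.
  - by move=> i y _; case: ifP.
  - by move=> i; case: (i \in D) => //; exact: measurable_half_power_quad.
  rewrite nneseries_esumT; last by move=> i; apply: integral_ge0 => y _; case: ifP.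
  rewrite [RHS]esum_mkcond; apply: eq_esum => i _.
  have [|_] := boolP (i \in D); last by rewrite integral0.
  rewrite inE => Di; have [x0 _] := Dx Di.
  rewrite integral_half_power_quad /half_power exprn_gt0//.
  rewrite sqrtr_sqr gtr0_norm//.
  by case: (x i) x0 => c r /= r0; rewrite eball_costE.
Qed.

End cover_of_slices.

(** Cavalieri's inequality (Federer). Covers of [E] induce covers of all its
    slices at once, and Fatou's lemma lets the mesh tend to zero. *)
Theorem slice_inequality N n d (E : set 'M[R]_(N.+1, n)) : (0 < n)%N ->
  exists G : borelRn R n -> \bar R,
  [/\ measurable_fun setT G, forall y, 0 <= G y,
      forall y, spherical_measure d (slice E y) <= G y &
      \int[lebn]_y G y <= spherical_measure (d + n) E].
Proof.
move=> n0; have [Eoo|Efin] := eqVneq (spherical_measure (d + n) E) +oo.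
  by exists (cst +oo); split => //= [y|]; rewrite ?Eoo leey.
have e0 k : (0 < k.+1%:R^-1 :> R)%R by rewrite invr_gt0.
have H k : exists G : borelRn R n -> \bar R,
  [/\ measurable_fun setT G, forall y, 0 <= G y,
      forall y, spherical_premeasure d k.+1%:R^-1 (slice E y) <= G y &
      \int[lebn]_y G y <= spherical_measure (d + n) E + k.+1%:R^-1%:E].
  have : cover_inf (small_eball k.+1%:R^-1) eball (eball_cost (d + n)) E < +oo.
    rewrite -spherical_premeasureE; apply: le_lt_trans (spherical_premeasure_le _ _ (e0 k)) _.
    by rewrite ltey.
  move=> /(cover_inf_adherent (@small_eball_cost_ge0 _ _ _ _ _) (e0 k))[D [x [Dx cov le_e]]].
  have [G [mG G0 GE intG]] := slice_cover_cost d n0 Dx.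
  exists G; split => //; first exact: GE.
  rewrite intG; apply: le_trans le_e _; rewrite leeD2r// -spherical_premeasureE.
  exact: spherical_premeasure_le.
have {H} [F HF] := choice H.
have mF k : measurable_fun setT (F k) by case: (HF k).
have F0 k y : 0 <= F k y by case: (HF k).
exists (fun y => limn_einf (F ^~ y)); split.
- apply: (emeasurable_fun_cvg (fun k y => einfs (F ^~ y) k)).
    exact: measurable_fun_einfs.
  by move=> y _; rewrite limn_einf_lim; exact: is_cvg_einfs.
- move=> y; rewrite limn_einf_lim; apply: lime_ge; first exact: is_cvg_einfs.
  by apply: nearW => k; apply: le_ereal_inf_tmp => _ [j _ <-].
- move=> y; apply: spherical_measure_le => e e_gt0.
  rewrite limn_einf_lim; apply: lime_ge; first exact: is_cvg_einfs.
  have [k0 _ k0P] := spherical_premeasure_near d (slice E y) e_gt0.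
  exists k0 => // k /= k0k; apply: le_ereal_inf_tmp => _ [j /= kj <-].
  by apply: le_trans (k0P j (leq_trans k0k kj)) _; case: (HF j).
- apply: le_trans (fatou _ _ _ _) _ => //.
  have c : spherical_measure (d + n) E + k.+1%:R^-1%:E @[k --> \oo] -->
      spherical_measure (d + n) E.
    rewrite -[X in _ --> X]adde0; apply: cvgeD; [by rewrite ge0_adde_def// inE ?spherical_measure_ge0| exact: cvg_cst|].
    by apply: cvg_EFin; [exact: nearW|exact: cvg_harmonic].
  have := cvg_limn_einf_sup c => -[<- _].
  rewrite !limn_einf_lim; apply: lee_lim; [exact: is_cvg_einfs..|].
  apply: nearW => k; apply: le_ereal_inf_tmp => _ [j /= kj <-].
  apply: ge_ereal_inf; exists (\int[lebn]_y F j y); first by exists j.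
  by case: (HF j).
Qed.

End slices.

(** * Spherical measure is at most Lebesgue measure *)

Section enorm_topology.
Context {R : realType}.

Lemma continuous_enormB p q (c : 'M[R]_(p, q)) : continuous (fun x : 'M[R]_(p, q) => enorm (x - c)).
Proof.
move=> x; apply: (@continuous_comp _ _ _
  (fun x : 'M[R]_(p, q) => \sum_i \sum_j (x - c) i j ^+ 2) (@Num.sqrt R)); last first.
  exact: sqrt_continuous.
have FF : Filter (nbhs x) := nbhs_filter x.
apply: (cvg_big add_continuous FF) => i _.
apply: (cvg_big add_continuous FF) => j _.
under eq_fun do rewrite !mxE; rewrite !mxE.
apply: (@cvg_comp _ _ _ (fun y : 'M[R]_(p, q) => y i j) (fun t => (t - c i j) ^+ 2)
  _ (nbhs (x i j))).
  exact: coord_continuous.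
apply: (@cvg_comp _ _ _ (fun t => t - c i j) (fun t => t ^+ 2) _ (nbhs (x i j - c i j))).
  by apply: cvgB; [exact: cvg_id|exact: cvg_cst].
exact: exprn_continuous.
Qed.

Lemma continuous_enorm p q : continuous (@enorm R p q).
Proof.
rewrite (_ : enorm = fun x => enorm (x - (0 : 'M[R]_(p, q)))).
  exact: continuous_enormB.
by apply/funext => x; rewrite subr0.
Qed.

Lemma open_open_eball p q (c : 'M[R]_(p, q)) r : open (open_eball c r).
Proof.
rewrite (_ : open_eball c r = (fun x => enorm (x - c)) @^-1` [set t | t < r])//.
by apply: open_comp => [x _|]; [exact: continuous_enormB|exact: open_lt].
Qed.

Lemma closed_closed_eball0 p q r : closed (closed_eball0 r : set 'M[R]_(p, q)).
Proof.
rewrite (_ : closed_eball0 r = @enorm R p q @^-1` [set t | t <= r])//.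
by apply: closed_comp => [x _|]; [exact: continuous_enorm|exact: closed_le].
Qed.

End enorm_topology.

Section disjoint_pieces.
Local Open Scope ereal_scope.
Context d (T : measurableType d) (R : realType) (mu : {measure set T -> \bar R}).

Lemma esum_measure_le (J : choiceType) (K : set J) (F : J -> set T) (A : set T) :
  trivIset K F -> (forall j, K j -> measurable (F j)) -> measurable A ->
  (forall j, K j -> F j `<=` A) -> \esum_(j in K) mu (F j) <= mu A.
Proof.
move=> tF mF mA FA; apply: ge_ereal_sup => _ [X [finX XK] <-].
rewrite -measure_fin_bigcup//; last 2 first.
- exact: sub_trivIset XK tF.
- by move=> j /XK/mF.
apply: le_measure; rewrite ?inE//.
  by apply: fin_bigcup_measurable => // j /XK/mF.
by move=> x [j /XK/FA]; exact.
Qed.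

End disjoint_pieces.

Section spherical_le_lebesgue.
Local Open Scope ereal_scope.
Context {R : realType} {n : nat}.

(** The case [d = 0] of [integral_half_power_quad]. *)
Lemma lebn_eball (c : 'rV[R]_n) (r : R) : (0 < r)%R ->
  lebn (open_eball c r) = (omega n * r ^+ n)%:E.
Proof.
move=> r0.
have mb : measurable (open_eball c r : set (borelRn R n)).
  by apply: open_borelRn; exact: open_open_eball.
transitivity (lebn (open_eball c r `&` setT)); first by rewrite setIT.
rewrite -integral_indic//.
have := integral_half_power_quad 0 (r ^+ 2) c.
rewrite add0n {2}/half_power exprn_gt0// sqrtr_sqr gtr0_norm// => <-.
apply: eq_integral => y _; rewrite omega0 mul1r indicE /half_power expr0.
have -> : (\sum_i ((y : 'rV[R]_n) ord0 i - c ord0 i) ^+ 2 = enorm ((y : 'rV[R]_n) - c) ^+ 2)%R.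
  by rewrite enorm_rV_sqr; apply: eq_bigr => i _; rewrite !mxE.
rewrite subr_gt0 ltr_sqr ?nnegrE ?enorm_ge0 ?(ltW r0)//.
by congr EFin; case: ifPn => yr; [rewrite mem_set|rewrite memNset// => /=; exact/negP].
Qed.

(** Half-open, so that the cubes of a grid are disjoint. *)
Definition qcube (al : 'rV[R]_n * R) : set 'rV[R]_n :=
  [set x | forall i, (al.1 ord0 i <= x ord0 i < al.1 ord0 i + al.2)%R].

Lemma measurable_qcube al : measurable (qcube al : set (borelRn R n)).
Proof.
rewrite (_ : qcube al = \bigcap_(i in [set: 'I_n])
    (fun x : borelRn R n => (x : 'rV[R]_n) ord0 i) @^-1` `[al.1 ord0 i, (al.1 ord0 i + al.2)%R[%classic).
  apply: fin_bigcap_measurable => // i _.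
  by rewrite -[X in measurable X]setTI; exact: measurable_coord.
by apply/seteqP; split => x xab i; [move=> _|have := xab i I]; rewrite /= in_itv//; exact: xab.
Qed.

Let shift_box (a : 'rV[R]_n) (t : R) : 'rV[R]_n * 'rV[R]_n := (a, \row_i (a ord0 i + t))%R.

Let shift_box_le a t : (0 <= t)%R -> box_le (shift_box a t).
Proof. by move=> t0 i; rewrite mxE lerDl. Qed.

Let shift_box_vol a t : box_vol (shift_box a t) = (t ^+ n)%R.
Proof.
rewrite /box_vol; under eq_bigr do rewrite mxE addrAC subrr add0r.
by rewrite prodr_const card_ord.
Qed.

Lemma lebn_qcube a (l : R) : (0 < l)%R -> lebn (qcube (a, l)) = (l ^+ n)%:E.
Proof.
move=> l0.
have le : lebn (qcube (a, l)) <= (l ^+ n)%:E.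
  rewrite -(shift_box_vol a) -lebn_box; last exact: shift_box_le (ltW l0).
  by apply: le_lebn => x xa i; rewrite mxE; have /andP[-> /ltW] := xa i.
apply/eqP; rewrite eq_le le/=.
have fin : lebn (qcube (a, l)) \is a fin_num.
  by rewrite ge0_fin_numE ?measure_ge0// (le_lt_trans le) ?ltry.
have ge t : (0 <= t)%R -> (t < l)%R -> (t ^+ n <= fine (lebn (qcube (a, l))))%R.
  move=> t0 tl; rewrite -lee_fin fineK// -(shift_box_vol a) -lebn_box; last exact: shift_box_le.
  apply: le_lebn => x xa i; have := xa i; rewrite mxE => /andP[-> h] /=.
  by rewrite (le_lt_trans h)// ltrD2l.
rewrite -(fineK fin) lee_fin.
apply: (@cvgr_to_le _ (l^'-) _ _ (fun t => t ^+ n)%R).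
  apply: cvg_at_left_filter; exact: exprn_continuous.
near=> t; apply: ge.
  by near: t; apply: nbhs_left_ge.
by near: t; exact: nbhs_left_lt.
Unshelve. all: by end_near. Qed.

Section mesh.
Variable eps : R.
Hypothesis eps0 : (0 < eps)%R.
Notation S := (@spherical_premeasure R 1 n n eps).

(** Cubes of side at most [l0] lie in balls of diameter less than [eps]. *)
Let l0 : R := (eps / (4 * n.+1%:R))%R.

Let l0_gt0 : (0 < l0)%R. Proof. by rewrite divr_gt0// mulr_gt0. Qed.

Let small_diam (c : 'rV[R]_n) r : (0 < r)%R -> (r <= n.+1%:R * l0)%R ->
  small_eball eps (c, r).
Proof.
move=> r0 rl; split => //; apply: le_lt_trans (diam_open_eball_le _ r0) _.
apply: (@le_lt_trans _ _ (2 * (n.+1%:R * l0)))%R; first by rewrite ler_wpM2l.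
have -> : (2 * (n.+1%:R * l0) = eps / 2 :> R)%R.
  have : n.+1%:R != 0%R :> R by rewrite pnatr_eq0.
  by rewrite /l0; move: n.+1%:R => N N0; field.
by rewrite ltr_pdivrMr// ltr_pMr// ltr1n.
Qed.

Let S_ball (c : 'rV[R]_n) r : (0 < r)%R -> (r <= n.+1%:R * l0)%R ->
  S (open_eball c r) <= (omega n * r ^+ n)%:E.
Proof.
move=> r0 rl; rewrite spherical_premeasureE.
apply: (@le_trans _ _ (\esum_(j in [set 0%N]) (eball_cost n (c, r))%:E)).
  by apply: cover_inf_le => [j _|x xr]; [exact: small_diam|exists 0%N].
by rewrite esum_set1 ?lee_fin ?diam_pow_le// eball_cost_ge0.
Qed.

(** The bound to be improved from a crude constant to [k = 1]. *)
Let ratio (k : R) := forall a l, (0 < l)%R -> (l <= l0)%R ->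
  S (qcube (a, l)) <= (k * l ^+ n)%:E.

(** A cube lies in the ball around one of its vertices of radius [n + 1] times its
    side. *)
Let ratio_init : ratio (omega n * n.+1%:R ^+ n)%R.
Proof.
move=> a l lpos ll0; rewrite -mulrA -exprMn.
apply: le_trans (S_ball a _ _); last 2 first.
- by rewrite mulr_gt0.
- by rewrite ler_wpM2l.
apply: le_spherical_premeasure => x xa; rewrite /open_eball/=.
rewrite -ltr_sqr ?nnegrE ?enorm_ge0 ?mulr_ge0 ?(ltW lpos)// enorm_rV_sqr.
apply: (@le_lt_trans _ _ (\sum_(i < n) l ^+ 2))%R.
  apply: ler_sum => i _; rewrite !mxE.
  have /andP[x1 x2] := xa i; rewrite /= in x1 x2.
  by rewrite ler_sqr ?nnegrE ?subr_ge0 ?(ltW lpos)// lerBlDl ltW.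
rewrite sumr_const card_ord -[ltLHS]mulr_natl exprMn ltr_pM2r ?exprn_gt0//.
by rewrite -natrX ltr_nat -{1}(expn1 n.+1) leq_pexp2l.
Qed.

Let esum_EFin_mulr (J : choiceType) (K : set J) (k : R) (f : J -> \bar R) : (0 <= k)%R ->
  (forall j, 0 <= f j) -> \esum_(j in K) (k%:E * f j) <= k%:E * \esum_(j in K) f j.
Proof.
move=> k0 f0; apply: ge_ereal_sup => _ [X XK <-].
rewrite -ge0_mule_fsumr// lee_wpmul2l ?lee_fin//.
by apply: ereal_sup_ubound; exists X.
Qed.

(** The cubes of a fine grid that meet a box are disjoint and fill little more
    than the box. *)
Let ratio_box k ab : (0 <= k)%R -> ratio k -> box_le ab -> S (box ab) <= (k * box_vol ab)%:E.
Proof.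
case: ab => a b k0 Hk ab_le.
pose v l := (\prod_(i < n) (b ord0 i - a ord0 i + 2 * l))%R.
have le_v l : (0 < l)%R -> (l <= l0)%R -> S (box (a, b)) <= (k * v l)%:E.
  move=> lpos ll0.
  pose Q (z : 'rV[int]_n) : set 'rV[R]_n := qcube (map_mx (fun m => m%:~R * l)%R z, l).
  pose K := [set z | (Q z `&` box (a, b) !=set0)%classic].
  have Qfloor (x : 'rV[R]_n) z : Q z x <-> z = map_mx (fun t => Num.floor (t / l)%R) x.
    split=> [xz|->].
      apply/rowP => i; rewrite mxE; apply/esym/floor_def.
      have := xz i; rewrite !mxE/= => /andP[z1 z2].
      by rewrite ler_pdivlMr// ltr_pdivrMr// z1 intrD mulrDl mul1r.
    move=> i; rewrite !mxE/=; have /andP[f1 f2] := floor_itv (x ord0 i / l)%R.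
    by move: f1 f2; rewrite ler_pdivlMr// ltr_pdivrMr// intrD mulrDl mul1r => -> ->.
  have cov : box (a, b) `<=` \bigcup_(z in K) Q z.
    move=> x xab; exists (map_mx (fun t => Num.floor (t / l)%R) x); last exact/Qfloor.
    by exists x; split => //; exact/Qfloor.
  apply: le_trans (le_spherical_premeasure _ _ cov) _.
  apply: le_trans (spherical_premeasure_bigcup _ _ _ _) _.
  apply: (@le_trans _ _ (\esum_(z in K) (k%:E * lebn (Q z)))).
    by apply: le_esum => z _; rewrite lebn_qcube// -EFinM; exact: Hk.
  apply: le_trans (esum_EFin_mulr _ k0 (fun z => measure_ge0 _ _)) _.
  rewrite EFinM lee_wpmul2l ?lee_fin//.
  pose ab' := ((\row_i (a ord0 i - l))%R, (\row_i (b ord0 i + l))%R) : 'rV[R]_n * 'rV[R]_n.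
  apply: (@le_trans _ _ (lebn (box ab'))).
    apply: esum_measure_le => [z z' _ _ [x [/Qfloor -> /Qfloor ->]]//|z _||z [y [yz yab]] x xz i].
    - exact: measurable_qcube.
    - exact: measurable_box.
    - have := yab i; have := yz i; have := xz i; rewrite !mxE/=.
      by move=> /andP[h1 h2] /andP[h3 h4] /andP[h5 h6]; apply/andP; split; lra.
  rewrite lebn_box; last by move=> i; rewrite !mxE; have := ab_le i => /=; lra.
  rewrite lee_fin /box_vol le_eqVlt; apply/orP; left; apply/eqP; apply: eq_bigr => i _.
  by rewrite !mxE; ring.
have vc : (k * v l)%R @[l --> 0^'+] --> (k * box_vol (a, b))%R.
  apply: cvg_at_right_filter; apply: cvgM; first exact: cvg_cst.
  have -> : box_vol (a, b) = v 0%R by apply: eq_bigr => i _; rewrite mulr0 addr0.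
  apply: (cvg_big mul_continuous (nbhs_filter _)) => i _.
  by apply: cvgD; [exact: cvg_cst|apply: cvgM; [exact: cvg_cst|exact: cvg_id]].
have Sfin : S (box (a, b)) \is a fin_num.
  rewrite ge0_fin_numE ?spherical_premeasure_ge0//.
  by apply: le_lt_trans (le_v l0 l0_gt0 (lexx _)) _; exact: ltry.
rewrite -(fineK Sfin) lee_fin; apply: (cvgr_to_ge vc); near=> l.
rewrite -lee_fin fineK//; apply: le_v; first by near: l; exact: nbhs_right_gt.
by near: l; apply: nbhs_right_le.
Unshelve. all: by end_near. Qed.

Let ratio_set k X : (0 < k)%R -> ratio k -> S X <= k%:E * lebesgueRn X.
Proof.
move=> k0 Hk; rewrite lebesgueRnE -lee_pdivrMl//.
apply: le_ereal_inf_tmp => _ [D [x [Dx cov ->]]]; rewrite lee_pdivrMl//.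
apply: le_trans (le_spherical_premeasure _ _ cov) _.
apply: le_trans (spherical_premeasure_bigcup _ _ _ _) _.
pose f j : \bar R := if j \in D then (box_vol (x j))%:E else 0.
have f0 j : 0 <= f j.
  by rewrite /f; case: ifPn => //; rewrite inE => /Dx/box_vol_ge0; rewrite lee_fin.
have -> : \esum_(i in D) (box_vol (x i))%:E = \esum_(i in D) f i.
  by apply: eq_esum => i Di; rewrite /f mem_set.
apply: le_trans (esum_EFin_mulr _ (ltW k0) f0).
apply: le_esum => i Di; rewrite /f mem_set// -EFinM.
by apply: ratio_box => //; [exact: ltW|exact: Dx].
Qed.

Let theta : R := (omega n / 2 ^+ n)%R.

Let theta_gt0 : (0 < theta)%R. Proof. by rewrite divr_gt0 ?omega_gt0 ?exprn_gt0. Qed.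

Let center (a : 'rV[R]_n) l : 'rV[R]_n := (\row_i (a ord0 i + l / 2))%R.

Let inscribed a l : open_eball (center a l) (l / 2) `<=` qcube (a, l).
Proof.
move=> x; rewrite /open_eball/= => xl i /=.
have : (`|(x - center a l) ord0 i| < l / 2)%R.
  apply: le_lt_trans xl; rewrite -ler_sqr ?nnegrE ?enorm_ge0// enorm_rV_sqr.
  by rewrite real_normK ?num_real// (bigD1 i)//= lerDl; apply: sumr_ge0 => j _; rewrite sqr_ge0.
by rewrite !mxE ltr_norml => /andP[h1 h2]; apply/andP; split; lra.
Qed.

Let theta_le1 : (theta <= 1)%R.
Proof.
have := le_lebn (@inscribed 0%R 1%R).
rewrite lebn_eball ?divr_gt0// lebn_qcube//.
by rewrite lee_fin expr1n div1r exprVn.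
Qed.

(** The ball inscribed in a cube is its own cheapest cover and fills the
    proportion [theta] of the cube; only the rest has to be covered by cubes. *)
Let ratio_improve k : (0 < k)%R -> ratio k -> ratio (theta + k * (1 - theta))%R.
Proof.
move=> k0 Hk a l lpos ll0.
set b := open_eball (center a l) (l / 2).
have l2 : (0 < l / 2)%R by rewrite divr_gt0.
have mb : measurable (b : set (borelRn R n)) by apply: open_borelRn; exact: open_open_eball.
have vb : lebn b = (theta * l ^+ n)%:E.
  by rewrite lebn_eball// exprMn exprVn /theta mulrA mulrAC.
have sub : qcube (a, l) `<=` \bigcup_(j in [set: bool]) (if j then b else qcube (a, l) `\` b).
  by move=> x xa; have [xb|xb] := pselect (b x); [exists true|exists false].
apply: le_trans (le_spherical_premeasure _ _ sub) _.
apply: le_trans (spherical_premeasure_bigcup _ _ _ _) _.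
rewrite (esumID [set true]); last by move=> *; exact: spherical_premeasure_ge0.
rewrite !setTI (_ : ~` [set true] = [set false]); last first.
  by apply/seteqP; split=> [[] //= h|_ -> //]; case: h.
rewrite !esum_set1 ?spherical_premeasure_ge0// mulrDl EFinD leeD//.
  apply: le_trans (S_ball _ _ _) _ => //.
    rewrite (le_trans _ (_ : l0 <= _))%R//; last first.
      by rewrite ler_peMl ?(ltW l0_gt0)// ler1n.
    by apply: le_trans ll0; lra.
  by rewrite lee_fin exprMn exprVn /theta mulrA mulrAC.
apply: le_trans (ratio_set _ k0 Hk) _.
rewrite -mulrA EFinM lee_wpmul2l ?lee_fin ?(ltW k0)// -/(lebn _) measureD//=.
- rewrite (setIidr (@inscribed a l)) -/b vb lebn_qcube// -EFinB lee_fin.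
  by rewrite mulrBl mul1r.
- exact: measurable_qcube.
- by rewrite lebn_qcube// ltry.
Qed.

Let C : R := (omega n * n.+1%:R ^+ n)%R.

Let C_gt0 : (0 < C)%R. Proof. by rewrite mulr_gt0 ?omega_gt0 ?exprn_gt0. Qed.

Let kappa j : R := (1 + (1 - theta) ^+ j * C)%R.

Let kappa_gt0 j : (0 < kappa j)%R.
Proof. by rewrite ltr_pwDl// mulr_ge0 ?exprn_ge0 ?subr_ge0// (ltW C_gt0). Qed.

Let ratio_kappa j : ratio (kappa j).
Proof.
elim: j => [|j IH].
  move=> a l lpos ll0; apply: le_trans (ratio_init a lpos ll0) _.
  by rewrite lee_fin /kappa expr0 mul1r ler_wpM2r ?exprn_ge0 ?(ltW lpos)// lerDr.
have -> : kappa j.+1 = (theta + kappa j * (1 - theta))%R by rewrite /kappa exprSr; ring.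
exact: ratio_improve.
Qed.

(** Iterating [ratio_improve] leads to the fixed point [1] of the affine map
    [k |-> theta + k (1 - theta)]. *)
Lemma spherical_premeasure_le_lebesgueRn X : S X <= lebesgueRn X.
Proof.
have [->|Xfin] := eqVneq (lebesgueRn X) +oo; first exact: leey.
have {}Xfin : lebesgueRn X \is a fin_num by rewrite ge0_fin_numE ?ltey ?lebesgueRn_ge0.
have kappaX j : S X <= (kappa j * fine (lebesgueRn X))%:E.
  by rewrite EFinM fineK//; exact: ratio_set.
have kc : (kappa j * fine (lebesgueRn X))%R @[j --> \oo] --> (1 * fine (lebesgueRn X))%R.
  apply: cvgM; last exact: cvg_cst.
  rewrite -[X in _ --> X]addr0; apply: cvgD; first exact: cvg_cst.
  rewrite -(mul0r C); apply: cvgM; last exact: cvg_cst.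
  apply: cvg_expr; rewrite ger0_norm ?subr_ge0// ltrBlDr ltrDl.
  exact: theta_gt0.
have Sfin : S X \is a fin_num.
  rewrite ge0_fin_numE ?spherical_premeasure_ge0//.
  by apply: le_lt_trans (kappaX 0%N) _; exact: ltry.
rewrite -(fineK Xfin) -(fineK Sfin) lee_fin -[leRHS]mul1r.
by apply: (cvgr_to_ge kc); apply: nearW => j; rewrite -lee_fin fineK.
Qed.

End mesh.

Theorem spherical_measure_le_lebesgueRn (X : set 'rV[R]_n) :
  spherical_measure n X <= lebesgueRn X.
Proof. by apply: spherical_measure_le => e e0; exact: spherical_premeasure_le_lebesgueRn. Qed.

End spherical_le_lebesgue.

(** * Configurations *)

Section configurations.
Local Open Scope ereal_scope.
Context {R : realType} {n : nat}.
Implicit Types (g : config R n) (B : set 'rV[R]_n).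

Definition supp g : set 'rV[R]_n := [set x | g [set x] != 0].

Let dirac_esum (D : set nat) (x : nat -> borelRn R n) B :
  \sum_(i <oo | i \in D) \d_(x i) B = \esum_(i in D `&` (x @^-1` B)) (1 : \bar R).
Proof.
rewrite nneseries_esum ?set_mem_set; last by move=> i _; exact: measure_ge0.
rewrite esum_mkcondr; apply: eq_esum => i _; rewrite diracE.
rewrite (_ : (i \in x @^-1` B) = (x i \in B)); first by case: (_ \in B).
by apply/idP/idP; rewrite !inE.
Qed.

Lemma le_esum1 (T : choiceType) (A A' : set T) : A `<=` A' ->
  \esum_(i in A) (1 : \bar R) <= \esum_(i in A') 1.
Proof. by move=> AA'; rewrite [leRHS](esumID A)//= setIidr// leeDl// esum_ge0. Qed.

Lemma esum1_fset (T : choiceType) (X : {fset T}) :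
  \esum_(i in [set` X]) (1 : \bar R) = (size (enum_fset X))%:R%:E.
Proof.
rewrite esum_fset//= fsbig_finite//= set_fsetK sumEFin.
by rewrite big_const_seq count_predT iter_addr_0.
Qed.

Lemma esum1_eq0 (T : choiceType) (A : set T) : \esum_(i in A) (1 : \bar R) = 0 <-> A = set0.
Proof.
split=> [A0|->]; last by rewrite esum_set0.
apply/seteqP; split=> // x Ax.
have : \esum_(i in [set x]) (1 : \bar R) <= \esum_(i in A) 1 by apply: le_esum1 => _ ->.
by rewrite A0 esum_set1// leNgt lte01.
Qed.

Let config_repr g : exists (D : set nat) (x : nat -> 'rV[R]_n),
  set_inj D x /\ forall B, g B = \esum_(i in D `&` (x @^-1` B)) (1 : \bar R).
Proof.
have [[D [x gE]] _ g01] := configP g.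
have gE' B : g B = \esum_(i in D `&` (x @^-1` B)) (1 : \bar R) by rewrite gE dirac_esum.
exists D, x; split => // i j; rewrite !inE => Di Dj xij; apply/eqP/negP => /negP ij.
have := g01 (x i); rewrite gE'.
have : \esum_(i in [set` [fset i; j]%fset]) (1 : \bar R) <= \esum_(k in D `&` (x @^-1` [set x i])) (1 : \bar R).
  by apply: le_esum1 => k /=; rewrite !inE => /orP[] /eqP ->.
rewrite esum1_fset cardfs2 ij/= => le2 [] E; move: le2; rewrite E lee_fin leNgt.
  by rewrite ltr0n.
by rewrite ltr1n.
Qed.

(** No point is repeated when a configuration is written as a sum of Dirac measures,
    because the mass of a singleton is at most [1]. *)
Lemma configE g B : g B = \esum_(y in supp g `&` B) (1 : \bar R).
Proof.
have [D [x [xinj gE]]] := config_repr g.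
have -> : supp g `&` B = x @` (D `&` (x @^-1` B)).
  apply/seteqP; split=> [y []|_ [i [Di Bxi] <-]].
    rewrite /supp/= gE => /eqP y0 By.
    have [i [Di xiy]] : exists i, (D `&` (x @^-1` [set y])) i.
      by apply/set0P/eqP => E; apply: y0; rewrite E esum_set0.
    by exists i => //; split => //=; rewrite xiy.
  split => //; rewrite /supp/= gE; apply/eqP => /esum1_eq0/seteqP[+ _].
  by move=> /(_ i); apply; split.
rewrite esum_image ?gE//.
by move=> i j; rewrite !inE => -[Di _] [Dj _]; apply: xinj; rewrite inE.
Qed.

(** Valid for every set [B], measurable or not, as configurations are sums of
    Dirac measures on all sets. *)
Lemma config_eq0 g B : g B = 0 <-> forall y, supp g y -> ~ B y.
Proof.
rewrite configE; split=> [/esum1_eq0/seteqP[h _] y gy By|h]; first by apply: (h y).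
by apply/esum1_eq0/seteqP; split=> // y [gy /(h _ gy)].
Qed.

Lemma config_repr_supp g : exists (D : set nat) (x : nat -> 'rV[R]_n),
  supp g = x @` D.
Proof.
have [D [x [xinj gE]]] := config_repr g; exists D, x.
apply/seteqP; split=> [y|_ [i Di <-]].
  rewrite /supp/= gE => /eqP y0.
  have [i [Di xiy]] : exists i, (D `&` (x @^-1` [set y])) i.
    by apply/set0P/eqP => E; apply: y0; rewrite E esum_set0.
  by exists i.
rewrite /supp/= gE; apply/eqP => /esum1_eq0/seteqP[+ _].
by move=> /(_ i); apply; split.
Qed.

Lemma finite_of_esum1 (T : choiceType) (A : set T) :
  \esum_(i in A) (1 : \bar R) < +oo -> finite_set A.
Proof.
move=> fin; apply: contrapT => infA.
have fin' : \esum_(i in A) (1 : \bar R) \is a fin_num by rewrite ge0_fin_numE// esum_ge0.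
set M := fine (\esum_(i in A) (1 : \bar R)).
have [X XA kX] := infinite_set_fset (Num.bound M) infA.
have := le_esum1 XA; rewrite esum1_fset -(fineK fin') lee_fin -/M leNgt => /negP; apply.
have M0 : (0 <= M)%R by rewrite fine_ge0// esum_ge0.
by apply: lt_le_trans (archi_boundP M0) _; rewrite ler_nat.
Qed.

Definition sup_ball (M : R) : set 'rV[R]_n := [set x | (`|x| < M)%R].

Lemma open_sup_ball M : open (sup_ball M).
Proof.
rewrite (_ : sup_ball M = (fun x : 'rV[R]_n => `|x|%R) @^-1` [set t | (t < M)%R])//.
by apply: open_comp => [x _|]; [exact: norm_continuous|exact: open_lt].
Qed.

Lemma compact_sup_ball M : compact [set x : 'rV[R]_n | (`|x| <= M)%R].
Proof.
apply: bounded_closed_compact.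
  exists M; split; first exact: num_real.
  by move=> t Mt x /= /le_trans; apply; exact: ltW.
rewrite (_ : [set x | _] = (fun x : 'rV[R]_n => `|x|%R) @^-1` [set t | (t <= M)%R])//.
by apply: closed_comp => [x _|]; [exact: norm_continuous|exact: closed_le].
Qed.

Lemma finite_supp g M : finite_set (supp g `&` sup_ball M).
Proof.
apply: finite_of_esum1; rewrite -configE.
apply: (@le_lt_trans _ _ (g [set x : 'rV[R]_n | (`|x| <= M)%R])).
  by rewrite !configE; apply: le_esum1 => x [gx xM]; split => //; exact: ltW.
by have [_ + _] := configP g; apply; exact: compact_sup_ball.
Qed.

(** The atoms in the open sup-norm ball of radius [M], finitely many because its
    closure is compact. *)
Definition atoms g M : seq 'rV[R]_n := enum_fset (fset_set (supp g `&` sup_ball M)).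

Lemma mem_atoms g M y : (y \in atoms g M) <-> supp g y /\ (`|y| < M)%R.
Proof. by rewrite /atoms in_fset_set ?inE//; exact: finite_supp. Qed.

Lemma uniq_atoms g M : uniq (atoms g M). Proof. exact: fset_uniq. Qed.

(** Inside a ball a configuration is the finite sum of the Dirac measures at its
    atoms. *)
Lemma integral_config_ge0 g M (f : 'rV[R]_n -> R) :
  measurable_fun [set: borelRn R n] f -> (forall x, (0 <= f x)%R) ->
  (forall x, (M <= `|x|)%R -> f x = 0%R) ->
  \int[g]_(x in [set: borelRn R n]) (f x)%:E = \sum_(y <- atoms g M) (f y)%:E.
Proof.
move=> mf f0 fM.
pose m_ i : {measure set (borelRn R n) -> \bar R} := dirac (nth 0%R (atoms g M) i : borelRn R n).
have mQ : measurable (sup_ball M : set (borelRn R n)).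
  by apply: open_borelRn; exact: open_sup_ball.
transitivity (\int[g]_(x in (sup_ball M : set (borelRn R n))) (f x)%:E).
  rewrite [RHS]integral_mkcond; apply: eq_integral => x _; rewrite patchE.
  case: ifPn => // /negP xM; rewrite fM// leNgt; apply/negP => xM'; apply: xM.
  by rewrite inE.
rewrite (@eq_measure_integral _ _ _ _ (msum m_ (size (atoms g M)))); last first.
  move=> A mA AQ; rewrite /= /msum/= configE.
  rewrite (_ : supp g `&` A = [set` [fset y in [seq y <- atoms g M | y \in A]]%fset]).
    rewrite esum1_fset -sum1_size natr_sum -sumEFin.
    rewrite (perm_big [seq y <- atoms g M | y \in A])/=; last first.
      by apply: uniq_perm; rewrite ?fset_uniq ?filter_uniq ?uniq_atoms// => y; rewrite !inE.
    rewrite big_filter big_mkcond/= (big_nth 0%R) big_mkord.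
    by apply: eq_bigr => i _; rewrite diracE; case: (_ \in A).
  apply/seteqP; split=> y /=; rewrite !inE mem_filter.
    move=> [gy Ay]; rewrite mem_set//=; apply/mem_atoms; split => //; exact: AQ.
  by move=> /andP[Ay /mem_atoms[gy _]]; split => //; move: Ay; rewrite ?inE.
rewrite ge0_integral_measure_sum//; last 2 first.
- by move=> x _; rewrite lee_fin.
- by apply/measurable_EFinP; exact: measurable_funTS.
rewrite [RHS](big_nth 0%R) big_mkord; apply: eq_bigr => i _.
rewrite integral_dirac//; last by apply/measurable_EFinP; exact: measurable_funTS.
rewrite diracE mem_set ?mul1e//.
by have /mem_atoms[] : nth 0%R (atoms g M) i \in atoms g M by exact: mem_nth.
Qed.

Lemma integral_config g M (f : 'rV[R]_n -> R) :
  measurable_fun [set: borelRn R n] f -> (forall x, (M <= `|x|)%R -> f x = 0%R) ->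
  (\int[g]_(x in [set: borelRn R n]) f x)%R = (\sum_(y <- atoms g M) f y)%R.
Proof.
move=> mf fM; rewrite /Rintegral integralE.
have pos : \int[g]_(x in [set: borelRn R n]) (EFin \o f)^\+ x =
    \sum_(y <- atoms g M) ((f^\+)%R y)%:E.
  under eq_integral do rewrite funeposE/= -EFin_max -/(funrpos f _).
  apply: integral_config_ge0 => [|x|x /fM fx]; first exact: measurable_funrpos.
  - exact: funrpos_ge0.
  - by rewrite /funrpos fx maxxx.
have neg : \int[g]_(x in [set: borelRn R n]) (EFin \o f)^\- x =
    \sum_(y <- atoms g M) ((f^\-)%R y)%:E.
  under eq_integral do rewrite funenegE/= -EFin_max -/(funrneg f _).
  apply: integral_config_ge0 => [|x|x /fM fx]; first exact: measurable_funrneg.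
  - exact: funrneg_ge0.
  - by rewrite /funrneg fx oppr0 maxxx.
rewrite pos neg !sumEFin/= -sumrB; apply: eq_bigr => y _.
exact: (congr1 (fun h => h y) (funrposBneg f)).
Qed.

Let add_dirac g (y : 'rV[R]_n) : {measure set (borelRn R n) -> \bar R} :=
  measure_add g (dirac (y : borelRn R n)).

Let add_diracE g y B : add_dirac g y B = g B + \d_(y : borelRn R n) B.
Proof. exact: (measure_addE g). Qed.

Lemma is_config_addpt g y : g [set y] = 0 ->
  is_config (add_dirac g y).
Proof.
move=> gy; split.
- have [[D [x gE]] _ _] := configP g.
  pose x' i := if i is j.+1 then x j else y.
  exists [set i | if i is j.+1 then D j else True], x' => B.
  have d0 i : 0 <= \d_(x' i) B :> \bar R by exact: measure_ge0.
  rewrite add_diracE gE !nneseries_esum ?set_mem_set; last 2 first.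
  + by move=> i _; exact: measure_ge0.
  + by move=> i _; exact: measure_ge0.
  rewrite [RHS](esumID [set 0%N])// addrC.
  rewrite setIidr; last by move=> _ ->.
  rewrite esum_set1//; congr (_ + _).
  rewrite (_ : _ `&` _ = S @` D); first by rewrite esum_image// => i j _ _ [].
  apply/seteqP; split=> [[|i]/= [Di h]|_ [i Di <-]].
  - by case: h.
  - by exists i.
  - by split.
- move=> K cK; rewrite add_diracE; have [_ /(_ _ cK) gK _] := configP g.
  by rewrite lte_add_pinfty// diracE ltry.
- move=> z; rewrite add_diracE diracE; have [_ _ /(_ z) gz] := configP g.
  have [yz|yz] := eqVneq y z; last by rewrite memNset ?adde0// => /eqP; rewrite (negbTE yz).
  by right; rewrite -yz gy mem_set// add0e.
Qed.

(** The union of a configuration with a point; a point that is already an atom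
    is not counted twice, which keeps the result a simple configuration. *)
Definition addpt (y : 'rV[R]_n) g : config R n :=
  if pselect (g [set y] = 0) is left gy then Config (is_config_addpt gy) else g.

Lemma addptE y g : ~ supp g y -> forall B, addpt y g B = g B + \d_(y : borelRn R n) B.
Proof.
move=> gy B; rewrite /addpt; case: pselect => [gy0|ngy]; first by rewrite -add_diracE.
by exfalso; apply: gy; apply/eqP.
Qed.

Lemma supp_addpt y g : supp (addpt y g) = y |` supp g.
Proof.
rewrite /addpt; case: pselect => [gy0|ngy].
  apply/seteqP; split=> z; rewrite /supp/=.
    rewrite add_diracE diracE; have [zy|zy] := eqVneq z y; first by left.
    rewrite [z == y]eq_sym in zy.
    by rewrite memNset ?adde0; [right|move=> /eqP; rewrite (negbTE zy)].
  rewrite add_diracE => -[->|gz].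
    by rewrite gy0 add0e diracE mem_set// eqe oner_eq0.
  by rewrite padde_eq0 ?measure_ge0// (negbTE gz).
apply/seteqP; split=> z; first by right.
by move=> [->|//]; apply/eqP.
Qed.

Lemma addpt_eq0 y g B : addpt y g B = 0 <-> ~ B y /\ g B = 0.
Proof.
rewrite !config_eq0 supp_addpt; split=> [h|[By h] z [->|/h]//].
by split=> [|z gz]; [apply: h; left|apply: h; right].
Qed.

End configurations.

(** * Void events generate the vague Borel sets *)

Section vague_topology.
Context {R : realType} {n : nat}.
Implicit Types (g : config R n) (O : set 'rV[R]_n).

Definition void O : set (config R n) := [set g | g O = 0%E].

Lemma voidP O g : void O g <-> forall y, supp g y -> ~ O y.
Proof. exact: config_eq0. Qed.

Lemma nvoidP O g : (~` void O) g <-> exists2 y, supp g y & O y.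
Proof.
split=> [|[y gy Oy] /voidP/(_ y gy)//].
by apply: contra_notP => nex; apply/voidP => y gy Oy; apply: nex; exists y.
Qed.

Lemma voidU O O' : void (O `|` O') = void O `&` void O'.
Proof.
apply/seteqP; split=> [g /voidP h|g [/voidP h /voidP h']].
  by split; apply/voidP => y gy Oy; apply: (h y gy); [left|right].
by apply/voidP => y gy [/(h y gy)|/(h' y gy)].
Qed.

Lemma continuous_measurable_borelRn (f : 'rV[R]_n -> R) : continuous f ->
  measurable_fun [set: borelRn R n] f.
Proof.
move=> cf; apply: (measurability _ (RGenOInfty.measurableE R)).
move=> _ [_ [x ->] <-]; rewrite setTI; apply: sub_sigma_algebra.
by apply: (open_comp (f := f)) => //; exact: interval_open.
Qed.

Lemma Cc_bounded (f : Cc R n) : exists M, forall x, M <= `|x| -> sval f x = 0.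
Proof.
case: f => f /= [cf [K /compact_bounded[M [_ MK]] fK]].
exists (M + 2) => x Mx; apply: fK => Kx.
have := MK (M + 1); rewrite ltrDl ltr01 => /(_ isT x Kx) /= h.
by have := le_trans Mx h; lra.
Qed.

Lemma vague_evE (f : Cc R n) g M : (forall x, M <= `|x| -> sval f x = 0) ->
  vague_ev f g = \sum_(y <- atoms g M) sval f y.
Proof.
move=> fM; apply: integral_config => //.
by apply: continuous_measurable_borelRn; case: (f) => ? [].
Qed.

Lemma vague_ev_continuous (f : Cc R n) : continuous (vague_ev f).
Proof.
move=> g; have /cvg_sup/(_ f) H : nbhs g --> g by exact: cvg_id.
apply: cvg_trans (cvg_app (vague_ev f) H) _.
exact: (@initial_continuous _ _ (vague_ev f) g).
Qed.

Lemma continuous_normB (x : 'rV[R]_n) : continuous (fun y : 'rV[R]_n => `|y - x|).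
Proof.
move=> y; have FF : Filter (nbhs (y : 'rV[R]_n)) := nbhs_filter y.
apply: (@cvg_norm _ 'rV[R]_n _ _ FF (fun y => y - x) (y - x)).
apply: (@cvgB R 'rV[R]_n _ _ FF (fun y => y) (fun=> x) y x).
  exact: cvg_id.
exact: cvg_cst.
Qed.

Lemma bump (x : 'rV[R]_n) O : open O -> O x ->
  exists f : Cc R n, [/\ 0 < sval f x, forall y, 0 <= sval f y &
    forall y, ~ O y -> sval f y = 0].
Proof.
move=> oO Ox; have : nbhs x O by exact: open_nbhs_nbhs.
move=> /nbhs_ballP[e /= e0 xeO].
(* twice the positive part of e - |y - x| *)
pose f (y : 'rV[R]_n) : R := (e - `|y - x|) + `|e - `|y - x| |.
have f0 y : e <= `|y - x| -> f y = 0.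
  by move=> ey; rewrite /f ler0_norm ?subr_le0// subrr.
have cf : continuous f.
  move=> y; have FF : Filter (nbhs (y : 'rV[R]_n)) := nbhs_filter y.
  have ct : (e - `|z - x|) @[z --> y] --> (e - `|y - x|).
    by apply: (@cvgB R R _ _ FF); [exact: cvg_cst|exact: continuous_normB].
  by apply: (@cvgD R R _ _ FF); [exact: ct|apply: (@cvg_norm _ _ _ _ FF); exact: ct].
have cK : exists2 K : set 'rV[R]_n, compact K & forall y, ~ K y -> f y = 0.
  exists [set y | `|y| <= `|x| + e]; first exact: compact_sup_ball.
  move=> y /negP; rewrite -ltNge => xy; apply: f0.
  by have := ler_normD (y - x) x; rewrite subrK; lra.
exists (exist _ f (conj cf cK)); split => /=.
- by rewrite /f subrr normr0 subr0 gtr0_norm// addr_gt0.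
- by move=> y; rewrite /f; set t := e - _; have := ler_norm (- t); rewrite normrN; lra.
- move=> y nOy; apply: f0; rewrite leNgt; apply/negP => ye; apply: nOy.
  by apply: xeO; rewrite -ball_normE/= distrC.
Qed.

(** Avoiding an open set is a vaguely closed condition: it says that all
    nonnegative test functions supported in the set have integral zero. *)
Lemma closed_void O : open O -> closed (void O).
Proof.
move=> oO.
pose F : set (Cc R n) := [set f | (forall y, 0 <= sval f y) /\ forall y, ~ O y -> sval f y = 0].
rewrite (_ : void O = \bigcap_(f in F) (vague_ev f @^-1` [set 0])).
  apply: closed_bigI => f _; apply: closed_comp => [g _|]; first exact: vague_ev_continuous.
  exact: closed_eq.
apply/seteqP; split=> [g /voidP gO f [f0 fO]|g gF]; rewrite /preimage/=.
  have [M fM] := Cc_bounded f; rewrite (vague_evE _ fM) big_seq big1// => y.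
  by move=> /mem_atoms[gy _]; apply: fO; exact: gO.
apply/voidP => y gy Oy.
have [f [fy f0 fO]] := bump oO Oy.
have [M fM] := Cc_bounded f.
have : vague_ev f g = 0 by apply: gF; split.
rewrite (vague_evE _ fM) => /eqP; rewrite psumr_eq0 => [/allP/(_ y)|z _]; last exact: f0.
have ya : y \in atoms g M.
  apply/mem_atoms; split => //; rewrite ltNge; apply/negP => /fM fy0.
  by rewrite fy0 ltxx in fy.
by move=> /(_ ya) /eqP fy0; rewrite fy0 ltxx in fy.
Qed.

Let idx := ('rV[rat]_n * nat)%type.

Let ball_of (q : idx) : set 'rV[R]_n := qball q.

(** Distinct points have disjoint rational balls around them, inside prescribed
    neighbourhoods. *)
Lemma disjoint_rational_balls k (y : 'I_k -> 'rV[R]_n) (O : 'I_k -> set 'rV[R]_n) :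
  injective y -> (forall i, open (O i)) -> (forall i, O i (y i)) ->
  exists q : {ffun 'I_k -> idx}, [/\ forall i, ball_of (q i) (y i),
    forall i, ball_of (q i) `<=` O i &
    forall i j x, i != j -> ball_of (q i) x -> ~ ball_of (q j) x].
Proof.
move=> yinj oO Oy.
pose delta := \big[Num.min/1]_(ij : 'I_k * 'I_k | ij.1 != ij.2) `|y ij.1 - y ij.2|.
have delta0 : 0 < delta.
  apply/bigmin_gtP; split => // -[i j]/= ij; rewrite normr_gt0 subr_eq0.
  by apply: contra_neq ij => /yinj.
have deltaP i j : i != j -> delta <= `|y i - y j|.
  by move=> ij; apply: (bigmin_le_cond _ (j := (i, j))).
have H i : exists q : idx, ball_of q (y i) /\ ball_of q `<=` O i `&` ball (y i) (delta / 2).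
  have oOb : open (O i `&` ball (y i) (delta / 2)).
    by apply: openI => //; apply: ball_open; rewrite divr_gt0.
  have Oby : (O i `&` ball (y i) (delta / 2)) (y i).
    by split; [exact: Oy|apply: ballxx; rewrite divr_gt0].
  by have [q qy qO] := qball_base oOb Oby; exists q.
have [q Hq] := choice H.
exists [ffun i => q i]; split=> [i|i|i j x ij]; rewrite !ffunE.
- by case: (Hq i).
- by move=> x xq; have [_ /(_ x xq)[]] := Hq i.
- move=> xi xj; have [_ /(_ x xi)[_]] := Hq i; have [_ /(_ x xj)[_]] := Hq j.
  rewrite -!ball_normE/= => yj yi; have := deltaP i j ij.
  by have := ler_distD x (y i) (y j); rewrite (distrC x); lra.
Qed.

(** A condition on the number of atoms ([at_leastP]), expressed through the voidness
    of rational balls so that it belongs to the sigma-algebra of void events. *)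
Definition at_least (N k : nat) : set (config R n) :=
  [set g | exists q : {ffun 'I_k -> idx},
    [/\ forall i, ball_of (q i) `<=` sup_ball N%:R,
        forall i j x, i != j -> ball_of (q i) x -> ~ ball_of (q j) x &
        forall i, (~` void (ball_of (q i))) g]].

Lemma disjoint_witnesses g k (q : {ffun 'I_k -> idx}) :
  (forall i j x, i != j -> ball_of (q i) x -> ~ ball_of (q j) x) ->
  (forall i, (~` void (ball_of (q i))) g) ->
  exists y : 'I_k -> 'rV[R]_n,
    [/\ injective y, forall i, supp g (y i) & forall i, ball_of (q i) (y i)].
Proof.
move=> qdis qg.
have H i : exists y, supp g y /\ ball_of (q i) y.
  by have /nvoidP[y gy qy] := qg i; exists y.
have [y Hy] := choice H.
exists y; split=> [i j yij|i|i]; try by case: (Hy i).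
apply/eqP/negP => /negP ij.
by apply: (qdis i j (y i) ij); [case: (Hy i)|rewrite yij; case: (Hy j)].
Qed.

Lemma at_leastP N k g : at_least N k g <-> (k <= size (atoms g N%:R))%N.
Proof.
split=> [[q [qN qdis qg]]|ks].
  have [y [yinj gy qy]] := disjoint_witnesses qdis qg.
  rewrite -[leqLHS](size_enum_ord k) -(size_map y).
  apply: uniq_leq_size; first by rewrite map_inj_uniq ?enum_uniq.
  by move=> _ /mapP[i _ ->]; apply/mem_atoms; split => //; exact: (qN i).
pose y (i : 'I_k) := nth 0 (atoms g N%:R) i.
have ya i : y i \in atoms g N%:R by apply: mem_nth; exact: leq_trans ks.
have yinj : injective y.
  move=> i j /eqP; rewrite nth_uniq ?uniq_atoms//; last 2 first.
  - exact: leq_trans ks.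
  - exact: leq_trans ks.
  by move=> /eqP /ord_inj.
have [|i|q [qy qO qdis]] := disjoint_rational_balls (O := fun=> sup_ball N%:R) yinj.
- by move=> _; exact: open_sup_ball.
- by have /mem_atoms[] := ya i.
by exists q; split => // i; apply/nvoidP; exists (y i) => //; have /mem_atoms[] := ya i.
Qed.

Let basic := (nat * {k : nat & {ffun 'I_k -> idx}})%type.

(** When the listed rational balls are disjoint and lie in the ball of radius
    [w.1], the latter has one atom in each of them and no other. *)
Definition basic_set (w : basic) : set (config R n) :=
  [set g | (forall i, (~` void (ball_of (projT2 w.2 i))) g)] `&`
  ~` at_least w.1 (projT1 w.2).+1.

(** A configuration in a narrow basic set has its atoms close to those of [g], one
    by one, so a test function takes nearby values on the two. *)
Lemma basic_set_nbhs (f : Cc R n) g (V : set R) : open V -> V (vague_ev f g) ->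
  exists2 w, basic_set w g & basic_set w `<=` vague_ev f @^-1` V.
Proof.
move=> oV Vg; have : nbhs (vague_ev f g) V by exact: open_nbhs_nbhs.
move=> /nbhs_ballP[e /= e0 geV].
have [M fM] := Cc_bounded f.
pose N := Num.bound `|M|.
have fN x : N%:R <= `|x| -> sval f x = 0.
  move=> Nx; apply: fM; apply: le_trans Nx; apply: le_trans (ler_norm M) _.
  by rewrite ltW// archi_boundP.
have cf : continuous (sval f) by case: (f) => ? [].
pose k := size (atoms g N%:R).
pose y (i : 'I_k) := nth 0 (atoms g N%:R) i.
have ya i : y i \in atoms g N%:R by exact: mem_nth.
have yinj : injective y.
  by move=> i j /eqP; rewrite nth_uniq ?uniq_atoms// => /eqP /ord_inj.
pose delta := e / k.+1%:R.
have delta0 : 0 < delta by rewrite divr_gt0.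
pose O i := sup_ball N%:R `&` sval f @^-1` (ball (sval f (y i)) delta).
have oO i : open (O i).
  apply: openI; first exact: open_sup_ball.
  by apply: open_comp => [z _|]; [exact: cf|exact: ball_open].
have Oy i : O i (y i).
  by split; [have /mem_atoms[] := ya i|exact: ballxx].
have [q [qy qO qdis]] := disjoint_rational_balls yinj oO Oy.
exists (N, existT _ k q); first split => /=.
- by move=> i; apply/nvoidP; exists (y i) => //; have /mem_atoms[] := ya i.
- by move=> /at_leastP; rewrite ltnn.
move=> g' [/= qg' nk].
have [y' [y'inj gy' qy']] := disjoint_witnesses qdis qg'.
have sz : (size (atoms g' N%:R) <= k)%N.
  by rewrite leqNgt; apply/negP => h; apply: nk; exact/at_leastP.
(* g' has an atom in each of the k balls and at most k atoms, hence no other *)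
have perm' : perm_eq (atoms g' N%:R) [seq y' i | i <- enum 'I_k].
  have u' : uniq [seq y' i | i <- enum 'I_k] by rewrite map_inj_uniq ?enum_uniq.
  apply: uniq_perm => //; first exact: uniq_atoms.
  have [||_ mem_eq] := uniq_min_size u' (s2 := atoms g' N%:R).
  - by move=> _ /mapP[i _ ->]; apply/mem_atoms; split => //; have [] := qO i _ (qy' i).
  - by rewrite size_map size_enum_ord.
  by move=> z; rewrite mem_eq.
have Eg : vague_ev f g = \sum_(i < k) sval f (y i).
  by rewrite (vague_evE _ fN) (big_nth 0) big_mkord.
have Eg' : vague_ev f g' = \sum_(i < k) sval f (y' i).
  by rewrite (vague_evE _ fN) (perm_big _ perm') big_map big_enum.
apply: geV; rewrite -ball_normE/= Eg Eg' -sumrB.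
apply: le_lt_trans (ler_norm_sum _ _ _) _.
apply: (@le_lt_trans _ _ (\sum_(i < k) delta)).
  apply: ler_sum => i _; have [_] := qO i _ (qy' i).
  by rewrite /preimage/= -ball_normE/= => /ltW.
rewrite sumr_const card_ord -mulr_natl /delta mulrA ltr_pdivrMr//.
by rewrite mulrC ltr_pM2l// ltr_nat.
Qed.

Let basics := seq basic.

Let basics_set (w : basics) : set (config R n) := \bigcap_(v in [set` w]) basic_set v.

Let basics_filter g : set_system (config R n) :=
  [set A | exists2 w, basics_set w g & basics_set w `<=` A].

Let basics_filterP g : Filter (basics_filter g).
Proof.
split.
- by exists [::].
- move=> A B [w wg wA] [w' wg' wB]; exists (w ++ w').
    by move=> v /=; rewrite mem_cat => /orP[] vw; [exact: wg|exact: wg'].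
  by move=> h hw; split; [apply: wA|apply: wB] => v /= vw; apply: hw => /=; rewrite mem_cat vw ?orbT.
- by move=> A B AB [w wg wA]; exists w => //; exact: subset_trans AB.
Qed.

(** The basic sets are countably many and, though not vaguely open, generate
    neighbourhoods: every vaguely open set is a countable union of finite
    intersections of basic sets. *)
Lemma vague_open_basics (U : set (config R n)) : open U ->
  U = \bigcup_(w in [set w | basics_set w `<=` U]) basics_set w.
Proof.
move=> oU; apply/seteqP; split=> [g Ug|g [w wU]]; last exact: wU.
suff : basics_filter g U by case=> w wg wU; exists w.
have FF := basics_filterP g.
suff H : basics_filter g --> g by apply: H; exact: open_nbhs_nbhs.
apply/cvg_sup => f A /= [_ [[V oV <-] Vg] VA].
have [w wg wV] := basic_set_nbhs oV Vg.
exists [:: w]; first by move=> v; rewrite /= inE => /eqP ->.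
by move=> h /(_ w); rewrite /= inE eqxx => /(_ isT)/wV/VA.
Qed.

(** A basic set is described by the voidness of countably many rational balls,
    and vaguely open sets are countable unions built from basic sets. *)
Lemma void_generates (C : set (config R n)) :
  measurable (C : set (borel_config R n)) ->
  <<s [set void O | O in [set O | open O /\ exists M, O `<=` sup_ball M]] >> C.
Proof.
set G := (X in <<s X >>).
apply: smallest_sub; first exact: smallest_sigma_algebra.
pose GT := g_sigma_algebraType G.
have mvoid q : measurable (void (ball_of q) : set GT).
  apply: sub_sigma_algebra; exists (ball_of q) => //; split; first exact: open_qball.
  pose c : 'rV[R]_n := map_mx ratr q.1.
  exists (`|c| + q.2.+1%:R^-1) => x; rewrite /ball_of /qball -ball_normE/= -/c => xc.
  rewrite /sup_ball/= -[x](subKr c) (le_lt_trans (ler_normB _ _))// ltrD2l; exact: xc.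
have mat_least N k : measurable (at_least N k : set GT).
  rewrite (_ : at_least N k = \bigcup_(q in [set q : {ffun 'I_k -> idx} |
      (forall i, ball_of (q i) `<=` sup_ball N%:R) /\
      forall i j x, i != j -> ball_of (q i) x -> ~ ball_of (q j) x])
      \bigcap_(i in [set: 'I_k]) ~` void (ball_of (q i))).
    apply: countable_bigcup_measurable => q _; apply: fin_bigcap_measurable => [|i _]; first exact: finite_finset.
    by apply: measurableC; exact: mvoid.
  apply/seteqP; split=> [g [q [qN qdis qg]]|g [q [qN qdis] qg]]; exists q => //.
  by split => // i; exact: qg.
have mbasic w : measurable (basic_set w : set GT).
  apply: measurableI; last by apply: measurableC; exact: mat_least.
  rewrite (_ : [set g | _] = \bigcap_(i in [set: 'I_(projT1 w.2)]) ~` void (ball_of (projT2 w.2 i))).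
    apply: fin_bigcap_measurable => [|i _]; first exact: finite_finset.
    by apply: measurableC; exact: mvoid.
  by apply/seteqP; split=> [g gw i _|g gw i]; exact: gw.
move=> U oU; rewrite (vague_open_basics oU).
apply: (@countable_bigcup_measurable _ GT) => w _.
apply: fin_bigcap_measurable => [|v _]; last exact: mbasic.
exact: finite_seq.
Qed.

Lemma measurable_void O : open O -> measurable (void O : set (borel_config R n)).
Proof.
move=> oO; rewrite -[X in measurable X]setCK; apply: measurableC.
by apply: sub_sigma_algebra; apply: closed_openC; exact: closed_void.
Qed.

End vague_topology.

(** * Superposition of Poisson configurations *)

Section measurable_addpt.
Context {R : realType} {n : nat}.

Lemma measurable_borel_configE : @measurable _ (borel_config R n) =
  <<s [set void O | O in [set O | open O /\ exists M, O `<=` sup_ball M]] >>.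
Proof.
apply/seteqP; split => C; first exact: void_generates.
move: C; apply: smallest_sub; first exact: sigma_algebra_measurable.
by move=> _ [U [oU _] <-]; exact: measurable_void.
Qed.

(** [addpt y g] avoids [U] if and only if both [y] and [g] do, so the preimages of
    void events are rectangles. *)
Lemma measurable_addpt : measurable_fun setT
  (fun z : borelRn R n * borel_config R n => addpt z.1 z.2 : borel_config R n).
Proof.
apply: (measurability _ measurable_borel_configE) => _ [_ [U [oU _] <-] <-].
rewrite setTI (_ : _ @^-1` _ = (~` U) `*` void U); last first.
  by apply/seteqP; split => -[y g] /=; rewrite /void/= addpt_eq0.
by apply: measurableX; [by apply: measurableC; exact: open_borelRn|exact: measurable_void].
Qed.

End measurable_addpt.

Section superposition.
Local Open Scope ereal_scope.
Context {R : realType} {n : nat}.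
Variable L : {finite_measure set (borelRn R n) -> \bar R}.
Implicit Types nu : {finite_measure set (borel_config R n) -> \bar R}.

(** The law (up to normalisation) of a configuration of law [nu] to which an
    independent point of law [L] has been added. *)
Definition throw_point nu : set (borel_config R n) -> \bar R :=
  pushm (L \x nu) measurable_addpt.

HB.instance Definition _ nu := Measure.on (throw_point nu).

Lemma throw_point_fin nu : fin_num_fun (throw_point nu).
Proof.
move=> C mC; rewrite ge0_fin_numE//; apply: (@le_lt_trans _ _ (throw_point nu setT)).
  by apply: le_measure => //; rewrite inE.
rewrite /throw_point /= /pushforward preimage_setT -setXTT product_measure1E//.
by rewrite ltey_eq fin_numM// fin_num_measure.
Qed.

HB.instance Definition _ nu :=
  Measure_isFinite.Build _ _ _ (throw_point nu) (throw_point_fin nu).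

Lemma throw_point_void nu O : open O ->
  throw_point nu (void O) = L (~` O) * nu (void O).
Proof.
move=> oO; rewrite /throw_point /= /pushforward.
rewrite (_ : _ @^-1` _ = (~` O) `*` void O); last first.
  by apply/seteqP; split => -[y g] /=; rewrite /void/= addpt_eq0.
by rewrite product_measure1E//; [by apply: measurableC; exact: open_borelRn|exact: measurable_void].
Qed.

(** The operator dual to [throw_point]. *)
Definition add_mean (u : config R n -> \bar R) (g : config R n) : \bar R :=
  \int[L]_y u (addpt y g).

Lemma measurable_add_mean (u : borel_config R n -> \bar R) : measurable_fun setT u -> (forall g, 0 <= u g) ->
  measurable_fun setT (add_mean u : borel_config R n -> \bar R).
Proof.
move=> mu u0.
apply: (@measurable_fun_fubini_tonelli_G _ _ (borelRn R n) (borel_config R n) R L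
  (fun z => u (addpt z.1 z.2))) => //.
exact: (measurableT_comp mu measurable_addpt).
Qed.

Lemma add_mean_ge0 (u : config R n -> \bar R) : (forall g, 0 <= u g) ->
  forall g, 0 <= add_mean u g.
Proof. by move=> u0 g; exact: integral_ge0. Qed.

Lemma integral_throw_point nu (u : borel_config R n -> \bar R) : measurable_fun setT u -> (forall g, 0 <= u g) ->
  \int[throw_point nu]_g u g = \int[nu]_g add_mean u g.
Proof.
move=> mu u0; rewrite /throw_point ge0_integral_pushm//.
rewrite (@fubini_tonelli2 _ _ (borelRn R n) (borel_config R n) R L nu
  (fun z => u (addpt z.1 z.2)))//.
exact: (measurableT_comp mu measurable_addpt).
Qed.

Definition throw_points nu (j : nat) : {finite_measure set (borel_config R n) -> \bar R} :=
  iter j (fun m : {finite_measure set (borel_config R n) -> \bar R} =>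
    throw_point m : {finite_measure set (borel_config R n) -> \bar R}) nu.

Lemma throw_points_void nu j O : open O ->
  throw_points nu j (void O) = L (~` O) ^+ j * nu (void O).
Proof.
move=> oO; elim: j => [|j IH]; first by rewrite expe0 mul1e.
by rewrite [LHS]throw_point_void// IH muleA expeS.
Qed.

Lemma iter_add_mean (j : nat) (u : borel_config R n -> \bar R) : measurable_fun setT u -> (forall g, 0 <= u g) ->
  measurable_fun setT (iter j add_mean u : borel_config R n -> \bar R) /\
  forall g, 0 <= iter j add_mean u g.
Proof.
move=> mu u0; elim: j => [//|j [mK K0]].
by split; [exact: measurable_add_mean|exact: add_mean_ge0].
Qed.

Lemma integral_throw_points nu j (u : borel_config R n -> \bar R) : measurable_fun setT u -> (forall g, 0 <= u g) ->
  \int[throw_points nu j]_g u g = \int[nu]_g iter j add_mean u g.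
Proof.
elim: j u => [|j IH] u mu u0 /=; first by [].
rewrite integral_throw_point// IH -?iterSr//.
  exact: measurable_add_mean.
exact: add_mean_ge0.
Qed.

Lemma poisson_factor_ge0 (j : nat) : (0 <= expR (- fine (L setT)) / j`!%:R)%R.
Proof. by rewrite divr_ge0 ?expR_ge0. Qed.

(** The law of a configuration of law [nu] together with an independent Poisson
    process of intensity [L], written as a Poisson number, of mean the total mass
    of [L], of independent points of law proportional to [L].  The normalising
    factors cancel. *)
Definition add_poisson nu : {measure set (borel_config R n) -> \bar R} :=
  mseries (fun j => mscale (NngNum (poisson_factor_ge0 j)) (throw_points nu j)) 0.

Lemma integral_add_poisson nu (u : borel_config R n -> \bar R) :
  measurable_fun setT u -> (forall g, 0 <= u g) ->
  \int[add_poisson nu]_g u g =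
  \sum_(j <oo) (expR (- fine (L setT)) / j`!%:R)%:E * \int[nu]_g iter j add_mean u g.
Proof.
move=> mu u0; rewrite ge0_integral_measure_series//; apply: eq_eseriesr => j _.
by rewrite ge0_integral_mscale// integral_throw_points.
Qed.

Lemma expR_eseries (a x : R) : (0 <= x)%R ->
  \sum_(j <oo) (a / j`!%:R * x ^+ j)%R%:E = (a * expR x)%R%:E.
Proof.
move=> x0; under eq_eseriesr do rewrite -mulrA EFinM.
rewrite nneseriesZl/=; last by move=> i _; rewrite lee_fin mulr_ge0// exprn_ge0.
rewrite EFinM; congr (_ * _).
rewrite expRE -EFin_lim.
  by apply/congr_lim/funext => k /=; rewrite /pseries/= /series/= -sumEFin.
by rewrite /pseries/= -exp_coeffE; exact: is_cvg_series_exp_coeff.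
Qed.

(** An open set is avoided when each of the [j] points falls in its complement;
    the probabilities sum up to an exponential series. *)
Lemma add_poisson_void nu O : open O ->
  add_poisson nu (void O) = (expR (- fine (L O)))%:E * nu (void O).
Proof.
move=> oO; have mO := open_borelRn oO.
have Lfin (C : set (borelRn R n)) : measurable C -> L C \is a fin_num by exact: fin_num_measure.
have nufin : nu (void O) \is a fin_num by apply: fin_num_measure; exact: measurable_void.
rewrite /add_poisson /= /mseries.
transitivity (\sum_(j <oo) (expR (- fine (L setT)) * fine (nu (void O)) / j`!%:R *
    fine (L (~` O)) ^+ j)%R%:E).
  apply: eq_eseriesr => j _.
  transitivity ((expR (- fine (L setT)) / j`!%:R)%:E * throw_points nu j (void O)); first by [].
  rewrite throw_points_void//.
  rewrite -[in LHS](fineK (Lfin _ (measurableC mO))) -[in LHS](fineK nufin).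
  rewrite -EFin_expe -!EFinM; congr (_%:E); ring.
rewrite expR_eseries; last exact: fine_ge0.
rewrite -[nu _ in RHS](fineK nufin) -EFinM; congr (_%:E).
rewrite mulrAC -expRD; congr (expR _ * _)%R.
rewrite -(setvU O) measureU//; [|exact: measurableC|by rewrite setICl].
by rewrite fineD ?Lfin//; [lra|exact: measurableC].
Qed.

End superposition.

Section poisson_law.
Local Open Scope ereal_scope.
Context {R : realType} {n : nat}.

Lemma lebn_sup_ball (M : R) : lebn (sup_ball M : set (borelRn R n)) < +oo.
Proof.
apply: le_lt_trans (lebn_cube_fin (Num.bound `|M|)%R).
apply: le_lebn => x xM; apply: cube_norm; apply: le_trans (ltW (archi_boundP _)) => //.
exact: le_trans (ltW xM) (ler_norm M).
Qed.

Lemma lebn_closed_ball (r : R) : lebn (closed_eball0 r : set (borelRn R n)) < +oo.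
Proof.
have r1 : (0 < `|r| + 1)%R by rewrite ltr_pwDr.
apply: (@le_lt_trans _ _ (lebn (open_eball (0%R : 'rV[R]_n) (`|r| + 1)))).
  apply: le_lebn => x; rewrite /closed_eball0 /open_eball /= subr0 => /le_lt_trans; apply.
  by rewrite (le_lt_trans (ler_norm r))// ltrDl.
by rewrite lebn_eball// ltry.
Qed.

Lemma poisson_void (A : set 'rV[R]_n) P (B : set (borelRn R n)) :
  is_poisson_measure A P -> measurable B -> lebn (B `&` A) < +oo ->
  P (void B) = (expR (- fine (lebn (B `&` A))))%:E.
Proof.
move=> [_ PP] mB Bfin.
have := PP 1%N (fun=> B) (fun=> 0%N) (fun=> mB) (fun=> Bfin).
rewrite big_ord1 /poisson_weight expr0 mulr1 fact0 divr1 => <-.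
  by congr (P _); apply/seteqP; split => [g gB i|g /(_ ord0)].
by move=> i j _ _ _; rewrite !ord1.
Qed.

Section superposition.
Variables (r s : R) (le_rs : (r <= s)%R).

Definition annulus : set (borelRn R n) := closed_eball0 s `\` closed_eball0 r.

Lemma measurable_annulus : measurable annulus.
Proof.
by apply: measurableD; apply: closed_borelRn; exact: closed_closed_eball0.
Qed.

Lemma lebn_annulus : lebn annulus < +oo.
Proof. by apply: le_lt_trans (lebn_closed_ball s); apply: le_lebn => x []. Qed.

Definition annulus_measure : {finite_measure set (borelRn R n) -> \bar R} :=
  mfrestr measurable_annulus lebn_annulus.

Lemma annulus_measureE C : annulus_measure C = lebn (C `&` annulus).
Proof. by []. Qed.

(** Void events form a class stable by intersection that generates the Borel sets,
    and both sides give to the void event of [U] the probability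
    [exp (- |U \ B_r|)]. *)
Lemma poisson_superposition (P Q : probability (borel_config R n) R) :
  is_poisson_measure (~` closed_eball0 r) P ->
  is_poisson_measure (~` closed_eball0 s) Q ->
  forall C, measurable C -> P C = add_poisson annulus_measure Q C.
Proof.
move=> Ppoisson Qpoisson C; rewrite measurable_borel_configE.
apply: (@g_sigma_algebra_measure_unique _ R (borel_config R n) _ _ (fun=> setT)) => //.
- by move=> _ [U [oU _] <-]; exact: measurable_void.
- move=> _; exists set0; last by apply/seteqP; split => // g _; exact: measure0.
  by split; [exact: open0|exists 0%R].
- by rewrite bigcup_const//; exists 0%N.
- move=> _ _ [U [oU [M UM]] <-] [V [oV [M' VM']] <-].
  exists (U `|` V); last exact: voidU.
  split; first exact: openU.
  exists (Num.max M M') => x; rewrite /sup_ball/= lt_max.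
  by move=> [/UM|/VM'] h; apply/orP; [left|right].
- move=> _ [U [oU [M UM]] <-].
  have mU := open_borelRn oU.
  have Ufin (X : set (borelRn R n)) : lebn (U `&` X) < +oo.
    by apply: le_lt_trans (lebn_sup_ball M); apply: le_lebn => x [/UM].
  rewrite [LHS](poisson_void Ppoisson mU (Ufin _)) add_poisson_void//.
  rewrite [X in _ * X](poisson_void Qpoisson mU (Ufin _)).
  rewrite -EFinM -expRD annulus_measureE; congr ((expR _)%:E).
  rewrite (_ : U `&` ~` closed_eball0 r = (U `&` annulus) `|` (U `&` ~` closed_eball0 s)).
    rewrite measureU//; [|apply: measurableI => //; exact: measurable_annulus|..].
    - rewrite fineD ?opprD//; rewrite ge0_fin_numE ?measure_ge0 ?Ufin//.
    - apply: measurableI => //; apply: measurableC; apply: closed_borelRn.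
      exact: closed_closed_eball0.
    - by apply/seteqP; split => // x [[_ [xs _]] [_]].
  apply/seteqP; split => [x [Ux xr]|x [[Ux [_ xr]]|[Ux xs]]].
  - by have [xs|xs] := pselect (closed_eball0 s x); [left|right].
  - by [].
  - by split => // xr; apply: xs; apply: le_trans le_rs.
- by move=> _; exact: fin_num_fun_lty (fin_num_measure P).
Qed.

End superposition.
End poisson_law.

(** * Tuples sorted by the positions of their outer points *)

Section pieces.
Context {R : realType} {n : nat}.
Variables (A : set (config R n)) (r s delta : R).
Hypotheses (le_rs : r <= s) (delta_gt0 : 0 < delta).

Definition outer_shell : set 'rV[R]_n := [set y | r + delta <= enorm y <= s].

(** The tuples whose union with [eta] is in [A], with the points of index in [I] in
    the shell and the others in [B_r].  The gap [delta] between the shell and [B_r]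
    separates the pieces of different [I]. *)
Definition piece N (I : pred 'I_N) (eta : config R n) : set 'M[R]_(N, n) :=
  [set x | (forall i, if I i then outer_shell (row i x) else closed_eball0 r (row i x)) /\
           exists2 z, A z & forall B, z B = (labelling x B + eta B)%E].

Lemma labelling_seq N (x : 'M[R]_(N, n)) B :
  labelling x B = (\sum_(y <- [seq row i x | i <- enum 'I_N]) \d_(y : borelRn R n) B)%E.
Proof. by rewrite big_map big_enum. Qed.

(** Adding the points one by one. *)
Lemma config_of_seq (L : seq 'rV[R]_n) : uniq L ->
  exists2 g : config R n, supp g = [set` L] &
    forall B, g B = (\sum_(y <- L) \d_(y : borelRn R n) B)%E.
Proof.
elim: L => [_|y L IH /= /andP[yL /IH [g gL gE]]].
  exists (Config (is_config0 R n)) => [|B]; last by rewrite big_nil.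
  by apply/seteqP; split => y //; rewrite /supp /= /mzero eqxx.
have gy : ~ supp g y by rewrite gL/= => yL'; move: yL; rewrite yL'.
exists (addpt y g) => [|B]; last by rewrite addptE// big_cons gE addeC.
rewrite supp_addpt gL; apply/seteqP; split => z /=; rewrite inE.
  by case=> [->|->]; rewrite ?eqxx ?orbT.
by case/orP => [/eqP ->|]; [left|right].
Qed.

(** Configurations are simple, so a tuple completing [eta] to a configuration has
    no repeated point. *)
Lemma labelling_injective N (x : 'M[R]_(N, n)) (z eta : config R n) :
  (forall B, z B = (labelling x B + eta B)%E) -> injective (fun i => row i x).
Proof.
move=> zE i j xij; apply/eqP/negP => /negP ij.
have [_ _ /(_ (row i x)) z01] := configP z.
have : (2%:E <= z [set row i x])%E.
  rewrite zE /labelling (bigD1 i)//= (bigD1 j) 1?eq_sym//=.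
  rewrite -xij diracE mem_set//= -[X in (_ <= X)%E]addeA -[X in (_ + X)%E]addeA addeA.
  have -> : 2%:E = (1 + 1)%E :> \bar R by [].
  rewrite leeDl// adde_ge0//.
  by apply: sume_ge0 => k _; rewrite diracE lee_fin.
by case: z01 => ->; rewrite lee_fin; lra.
Qed.

Lemma piece_sub_preimage N (I : pred 'I_N) eta : piece I eta `<=`
  labelling_preimage s (config_section A eta s `&` Upsilonk N (closed_eball0 s)).
Proof.
move=> x [xI [z Az zE]].
have xs i : closed_eball0 s (row i x).
  have := xI i; case: ifP => _; first by case/andP.
  by move=> /le_trans; apply.
have xinj := labelling_injective zE.
split; first by split.
have [|g _ gE] := @config_of_seq [seq row i x | i <- enum 'I_N].
  by rewrite map_inj_uniq ?enum_uniq.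
have {}gE B : g B = labelling x B by rewrite gE labelling_seq.
have gs : Upsilon (closed_eball0 s) g.
  rewrite /Upsilon /= gE /labelling big1// => i _.
  by rewrite diracE memNset// => /(_ (xs i)).
exists g => //; split; first by split => //; exists z => // B; rewrite zE gE.
split => //=; rewrite gE /labelling (eq_bigr (fun=> 1%E)).
  by rewrite sumEFin big_const_ord iter_addr_0.
by move=> i _; rewrite diracE mem_set.
Qed.

Lemma enorm_row_perm N (p : {perm 'I_N}) (x : 'M[R]_(N, n)) :
  enorm (row_perm p x) = enorm x.
Proof.
rewrite /enorm [in RHS](reindex_inj (@perm_inj _ p)); congr Num.sqrt.
by apply: eq_bigr => i _; apply: eq_bigr => j _; rewrite mxE.
Qed.

Lemma labelling_row_perm N (p : {perm 'I_N}) (x : 'M[R]_(N, n)) B :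
  labelling (row_perm p x) B = labelling x B.
Proof.
rewrite /labelling [in RHS](reindex_inj (@perm_inj _ p)); apply: eq_bigr => i _.
by rewrite (_ : row i _ = row (p i) x)//; apply/rowP => j; rewrite !mxE.
Qed.

(** List [I] first and its complement next. *)
Lemma perm_initial N (I : {set 'I_N}) :
  exists p : {perm 'I_N}, forall i, (p i < #|I|)%N = (i \in I).
Proof.
pose L := enum I ++ enum (~: I).
have memL i : i \in L by rewrite mem_cat !mem_enum inE orbN.
have sizeL : size L = N by rewrite size_cat -!cardE cardsC card_ord.
have idx i : (index i L < N)%N by rewrite -[X in (_ < X)%N]sizeL index_mem.
have inj : injective (fun i => Ordinal (idx i)).
  by move=> i j /(congr1 val) /= /(congr1 (nth i L)); rewrite !nth_index.
exists (perm inj) => i; rewrite permE /= /L index_cat mem_enum.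
case: ifPn => iI; first by rewrite cardE index_mem mem_enum.
by apply/negbTE; rewrite -leqNgt cardE leq_addr.
Qed.

(** Permuting the points of a tuple is an isometry. *)
Lemma spherical_measure_piece_le N d (I : {set 'I_N}) eta :
  (spherical_measure d (piece (fun i : 'I_N => (i < #|I|)%N) eta) <=
   spherical_measure d (piece (mem I) eta))%E.
Proof.
have [p pI] := perm_initial I.
apply: (@le_trans _ _ (spherical_measure d ((@row_perm _ _ _ p^-1%g) @` piece (mem I) eta))).
  apply: le_spherical_measure => x [xI [z Az zE]]; exists (row_perm p x).
    split; last by exists z => // B; rewrite zE labelling_row_perm.
    move=> i; have -> : row i (row_perm p x) = row (p i) x by apply/rowP => j; rewrite !mxE.
    by have := xI (p i); rewrite pI.
  by rewrite -row_permM mulVg row_perm1.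
apply: spherical_measure_isometry_le => x y.
rewrite -[RHS](enorm_row_perm p^-1%g); congr enorm.
by apply/matrixP => i j; rewrite !mxE.
Qed.

Lemma piece_separated N (I J : {set 'I_N}) eta x y : I != J ->
  piece (mem I) eta x -> piece (mem J) eta y -> delta <= enorm (x - y).
Proof.
move=> IJ [xI _] [yJ _].
have dist i u v : outer_shell (row i u) -> closed_eball0 r (row i v) ->
    delta <= enorm (u - v :> 'M[R]_(N, n)).
  rewrite /outer_shell /closed_eball0 /= => /andP[u1 _] v1.
  apply: le_trans (enorm_row_le _ i).
  have -> : row i (u - v) = row i u - row i v by apply/rowP => j; rewrite !mxE.
  have := enormD (row i u - row i v) (row i v); rewrite subrK; lra.
have [i iIJ] : exists i, (i \in I) != (i \in J).
  apply/existsP; apply: contraR IJ => /existsPn h; apply/eqP/setP => i.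
  by apply/eqP; rewrite -[_ == _]negbK h.
have := xI i; have := yJ i; rewrite /=; move: iIJ.
case: (i \in I); case: (i \in J) => // _ yi xi; first exact: dist xi yi.
by rewrite -enormN opprB; exact: dist yi xi.
Qed.

Local Open Scope ereal_scope.

(** The pieces of the [binomial(N, j)] sets [I] of cardinal [j] have the same
    measure, and all pieces are separated subsets of the tuples counted on the
    right. *)
Lemma sum_spherical_measure_pieces N d eta :
  \sum_(j < N) ('C(N, j)%:R%:E *
    spherical_measure d (piece (fun i : 'I_N => (i < j)%N) eta)) <=
  spherical_measure d (@labelling_preimage R n N s
    (config_section A eta s `&` Upsilonk N (closed_eball0 s))).
Proof.
apply: (@le_trans _ _ (\sum_(I : {set 'I_N}) spherical_measure d (piece (mem I) eta))).
  pose t (j : 'I_N) (I : {set 'I_N}) :=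
    if #|I| == j then spherical_measure d (piece (mem I) eta) else 0.
  have t0 j I : 0 <= t j I by rewrite /t; case: ifP => // _; exact: spherical_measure_ge0.
  apply: (@le_trans _ _ (\sum_(j < N) \sum_(I : {set 'I_N}) t j I)).
    apply: lee_sum => j _.
    rewrite -[X in 'C(X, _)]card_ord -card_draws.
    rewrite /t -big_mkcond/= -sum1_card natr_sum -sumEFin ge0_sume_distrl//.
    rewrite [leLHS](eq_bigl (fun I : {set 'I_N} => #|I| == j)) => [|I]; last by rewrite inE.
    by apply: lee_sum => I /eqP <-; rewrite mul1e; exact: spherical_measure_piece_le.
  rewrite exchange_big/=; apply: lee_sum => I _.
  have [IN|NI] := ltnP #|I| N.
    rewrite (bigD1 (Ordinal IN))//= big1 ?adde0; first by rewrite /t eqxx.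
    by move=> j jI; rewrite /t; case: eqP => // Ij; case/eqP: jI; exact: val_inj.
  rewrite big1 ?spherical_measure_ge0// => j _; rewrite /t gtn_eqF//.
  exact: leq_trans (ltn_ord j) NI.
apply: (@spherical_measure_separated R N n d {set 'I_N}
  (fun I => piece (mem I) eta) _ delta) => //.
  by move=> I; exact: piece_sub_preimage.
by move=> I J x y; exact: piece_separated.
Qed.

End pieces.

(** * Integrating the added points *)

Section kernel_bound.
Local Open Scope ereal_scope.
Context {R : realType} {n : nat}.

Lemma measurable_supp (g : config R n) : measurable (supp g : set (borelRn R n)).
Proof.
have [D [x ->]] := config_repr_supp g.
rewrite -bigcup_imset1; apply: countable_bigcup_measurable => i _.
by apply: closed_borelRn; apply: accessible_closed_set1; exact: hausdorff_accessible.
Qed.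

Lemma lebn_supp (g : config R n) : (0 < n)%N -> lebn (supp g : set (borelRn R n)) = 0.
Proof.
move=> n0; have [D [x ->]] := config_repr_supp g.
apply/eqP; rewrite eq_le measure_ge0 andbT /lebn lebesgueRnE.
have := @cover_inf_le _ _ _ box_le box box_vol nat D (fun i => (x i, x i)) (x @` D).
move=> /(_ _ _)/le_trans; apply.
- by move=> i _ k /=.
- by move=> _ [i Di <-]; exists i => // k /=; rewrite lexx.
- by rewrite esum1// => i _; rewrite /box_vol/= (bigD1 (Ordinal n0))//= subrr mul0r.
Qed.

Variables (A : set (config R n)) (m : nat) (r s delta : R).
Hypotheses (le_mn : (m <= n)%N) (r0 : (0 <= r)%R) (le_rs : (r <= s)%R) (delta_gt0 : (0 < delta)%R).

Definition shell_first j N eta : set 'M[R]_(N, n) :=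
  piece A r s delta (fun i : 'I_N => (i < j)%N) eta.

(** The weight is [1 / k!] for the number [k = N - j] of inner points.  The index is
    [N] rather than [k] because the sums over [j] and [N] are exchanged in the end:
    all the terms of index [N] measure sets of [N]-tuples of points of [B_s]. *)
Definition shell_term j N eta : \bar R :=
  if (j < N)%N then
    ((N - j)`!%:R^-1)%:E * spherical_measure (n * N - m) (@shell_first j N eta)
  else 0.

Lemma shell_term_ge0 j N eta : 0 <= shell_term j N eta.
Proof.
rewrite /shell_term; case: ifP => // _.
by rewrite mule_ge0 ?spherical_measure_ge0// lee_fin invr_ge0.
Qed.

Lemma codim_measure_le_shell eta :
  codim_measure m r (config_section A eta r) <=
  expeR (- spherical_measure n (closed_eball0 r : set 'rV[R]_n)) *
  \sum_(N <oo) shell_term 0 N eta.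
Proof.
rewrite /codim_measure; apply: lee_wpmul2l; first exact: expeR_ge0.
rewrite eseries_cond eseries_mkcondr; apply: lee_nneseries => [N _ _|N _].
  case: ifP => // _; rewrite mule_ge0 ?spherical_measure_ge0// lee_fin invr_ge0//.
rewrite /shell_term subn0; case: ifP => // _.
apply: lee_wpmul2l; first by rewrite lee_fin invr_ge0.
apply: le_spherical_measure => x [[xr _] [g [[_ [z Az zE]] _] gE]]; split.
  by move=> i; rewrite ltn0.
by exists z => // B; rewrite zE gE.
Qed.

Lemma slice_shell_first j N eta y : outer_shell r s delta y -> ~ supp eta y ->
  @shell_first j N (addpt y eta) `<=` slice (@shell_first j.+1 N.+1 eta) y.
Proof.
move=> Vy ny x [xI [z Az zE]]; split.
  move=> i; case: (@split_ordP 1 N i) => k ->.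
    have -> : (lshift N k < j.+1)%N by rewrite ord1.
    rewrite (@rowKu _ 1 N n) (_ : row k y = y)//.
    by apply/rowP => l; rewrite mxE ord1.
  have -> : (rshift 1 k < j.+1)%N = (k < j)%N by rewrite /= add1n ltnS.
  by rewrite (@rowKd _ 1 N n); exact: xI.
exists z => // B; rewrite zE addptE//.
rewrite [in RHS]/labelling (@big_split_ord _ _ _ 1 N)/= big_ord1 (@rowKu _ 1 N n).
rewrite (_ : row ord0 y = y); last by apply/rowP => l; rewrite mxE.
under eq_bigr do rewrite (@rowKd _ 1 N n).
by rewrite -/(labelling x B) addeA addeC addeA.
Qed.

Local Notation L := (annulus_measure r s : {finite_measure set (borelRn R n) -> \bar R}).

Lemma annulus_measure_ae eta : (0 < n)%N ->
  {ae L, forall y : borelRn R n, annulus r s y /\ ~ supp eta y}.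
Proof.
move=> n0; exists (~` annulus r s `|` supp eta); split.
- apply: measurableU; last exact: measurable_supp.
  by apply: measurableC; exact: measurable_annulus.
- apply/eqP; rewrite eq_le measure_ge0 andbT annulus_measureE -(lebn_supp eta n0).
  by apply: le_lebn => y [[|//]].
- move=> y h; have [yA|] := pselect (annulus r s y); last by left.
  by right; apply: contrapT => yS; exact: h.
Qed.

(** Lebesgue measure is the sum of its restrictions to the annulus and to the
    complement of the annulus. *)
Lemma integral_annulus_measure_le (f : borelRn R n -> \bar R) :
  measurable_fun setT f -> (forall y, 0 <= f y) -> \int[L]_y f y <= \int[lebn]_y f y.
Proof.
move=> mf f0.
pose L' := mrestr (@lebn R n) (measurableC (measurable_annulus r s)).
have lebnE C : measurable C -> C `<=` setT -> lebn C = (measure_add L L' : {measure set (borelRn R n) -> \bar R}) C.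
  move=> mC _; transitivity (L C + L' C); last exact: esym (measure_addE _ _ _).
  have mA := @measurable_annulus R n r s.
  rewrite annulus_measureE /L' /mrestr/= -measureU ?setIUr.
  - by rewrite -setIUr setUv setIT.
  - exact: measurableI.
  - by apply: measurableI => //; exact: measurableC.
  - by rewrite setIACA setICr setI0.
rewrite [leRHS](eq_measure_integral _ lebnE) ge0_integral_measure_add// leeDl//.
exact: integral_ge0.
Qed.

Lemma annulus0 : n = 0%N -> annulus r s = set0 :> set 'rV[R]_n.
Proof.
move=> n0; apply/seteqP; split => // y [_ /=]; apply.
rewrite /closed_eball0 /= (_ : y = 0%R) ?enorm0//.
by apply/rowP => i; have := ltn_ord i; rewrite {2}n0.
Qed.

(** For a point [y] of the shell that is not an atom of [eta], the tuples counted
    for [addpt y eta] are in the slice above [y] of the tuples counted for [eta], with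
    one more outer point; the slice inequality integrates over [y].  Atoms of [eta]
    form a null set, and [u] vanishes when [y] is too close to [B_r]. *)
Lemma add_mean_shell_le (c : R) (u : borel_config R n -> \bar R) j :
  (0 <= c)%R -> measurable_fun setT u -> (forall eta, 0 <= u eta) ->
  (forall eta, ~ void (open_eball 0 (r + delta)) eta -> u eta = 0) ->
  (forall eta, u eta <= c%:E * \sum_(N <oo) shell_term j N eta) ->
  forall eta, add_mean L u eta <= c%:E * \sum_(N <oo) shell_term j.+1 N eta.
Proof.
move=> c0 mu u0 uvoid ule eta.
have uaddpt : measurable_fun setT (fun y : borelRn R n => u (addpt y eta)).
  have pm : measurable_fun setT (fun y : borelRn R n => (y, eta : borel_config R n)).
    exact: pair2_measurable.
  exact: (measurableT_comp mu (measurableT_comp measurable_addpt pm)).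
have rhs0 : 0 <= c%:E * \sum_(N <oo) shell_term j.+1 N eta.
  by rewrite mule_ge0 ?lee_fin// nneseries_ge0// => *; exact: shell_term_ge0.
(* in dimension zero the annulus is empty *)
have [n0|n0] := posnP n.
  rewrite /add_mean null_set_integral//.
  by rewrite [LHS]annulus_measureE annulus0// setI0 measure0.
have G_ N : exists G : borelRn R n -> \bar R, [/\ measurable_fun setT G, forall y, 0 <= G y,
    forall y, outer_shell r s delta y -> ~ supp eta y -> shell_term j N (addpt y eta) <= G y &
    \int[lebn]_y G y <= shell_term j.+1 N.+1 eta].
  rewrite /shell_term ltnS subSS; case: ifPn => jN; last first.
    by exists (cst 0); split => //; rewrite integral0.
  have [G [mG G0 GS GI]] := slice_inequality (n * N - m) (@shell_first j.+1 N.+1 eta) n0.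
  have w0 : (0 <= (N - j)`!%:R^-1 :> R)%R by rewrite invr_ge0.
  exists (fun y => ((N - j)`!%:R^-1)%:E * G y); split.
  - exact: measurable_funeM.
  - by move=> y; rewrite mule_ge0.
  - move=> y Vy ny; apply: lee_wpmul2l => //.
    apply: le_trans (GS y); apply: le_spherical_measure; exact: slice_shell_first.
  - rewrite ge0_integralZl//; apply: lee_wpmul2l => //.
    apply: le_trans GI _; rewrite mulnS addnC addnBA//.
    by apply: leq_trans le_mn _; rewrite leq_pmulr// (leq_trans _ jN).
have [G Gprop] := choice G_.
have mG N := let: And4 h _ _ _ := Gprop N in h.
have G0 N := let: And4 _ h _ _ := Gprop N in h.
have GS N := let: And4 _ _ h _ := Gprop N in h.
have GI N := let: And4 _ _ _ h := Gprop N in h.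
pose v y := c%:E * \sum_(N <oo) G N y.
have mS : measurable_fun setT (fun y => \sum_(N <oo) G N y).
  by apply: ge0_emeasurable_sum => // N y _ _; exact: G0.
have S0 y : 0 <= \sum_(N <oo) G N y by apply: nneseries_ge0.
have mv : measurable_fun setT v by exact: measurable_funeM.
have v0 y : 0 <= v y by rewrite mule_ge0.
apply: (@le_trans _ _ (\int[L]_y v y)).
  apply: ae_ge0_le_integral => //.
  apply: filterS (annulus_measure_ae eta n0) => y [[ys yr] ny] _.
  have [Vy|Oy] := leP (r + delta)%R (enorm y).
    apply: le_trans (ule _) _; apply: lee_wpmul2l => //.
    apply: lee_nneseries => N *; first exact: shell_term_ge0.
    by apply: GS => //; apply/andP.
  rewrite uvoid// /void /= addpt_eq0 => -[+ _]; apply.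
  by rewrite /open_eball /= subr0.
apply: le_trans (integral_annulus_measure_le mv v0) _.
rewrite ge0_integralZl// integral_nneseries//.
apply: lee_wpmul2l => //.
apply: (@le_trans _ _ (\sum_(N <oo) shell_term j.+1 N.+1 eta)).
  by apply: lee_nneseries => N *; [exact: integral_ge0|exact: GI].
rewrite [leRHS]nneseries_recl//; last by move=> *; exact: shell_term_ge0.
rewrite -(@nneseries_addn _ (shell_term j.+1 ^~ eta) 1%N); last by move=> *; exact: shell_term_ge0.
under [in leRHS]eq_eseriesr do rewrite addn1.
by rewrite leeDr// shell_term_ge0.
Qed.

Lemma iter_add_mean_vanish (u : borel_config R n -> \bar R) O j :
  (forall eta, ~ void O eta -> u eta = 0) ->
  forall eta, ~ void O eta -> iter j (add_mean L) u eta = 0.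
Proof.
move=> u0; elim: j => [//|j IH] eta etaO.
apply: integral0_eq => y _; apply: IH; rewrite /void /= addpt_eq0.
by move=> [_ /etaO].
Qed.

Lemma iter_add_mean_shell_le (c : R) (u : borel_config R n -> \bar R) j :
  (0 <= c)%R -> measurable_fun setT u -> (forall eta, 0 <= u eta) ->
  (forall eta, ~ void (open_eball 0 (r + delta)) eta -> u eta = 0) ->
  (forall eta, u eta <= c%:E * \sum_(N <oo) shell_term 0 N eta) ->
  forall eta, iter j (add_mean L) u eta <= c%:E * \sum_(N <oo) shell_term j N eta.
Proof.
move=> c0 mu u0 uvoid ule; elim: j => [//|j IH].
have [mK K0] := iter_add_mean L j mu u0.
by apply: add_mean_shell_le => //; exact: iter_add_mean_vanish.
Qed.

(** The weight [1 / (j! (N - j)!)] is [binomial(N, j) / N!], so after exchanging the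
    two series the term of index [N] is bounded by [sum_spherical_measure_pieces]. *)
Lemma series_shell_le eta :
  \sum_(j <oo) (j`!%:R^-1)%:E * \sum_(N <oo) shell_term j N eta <=
  \sum_(1 <= N <oo) codim_measurek m N s
    (config_section A eta s `&` Upsilonk N (closed_eball0 s)).
Proof.
under eq_eseriesr => j _.
  rewrite -nneseriesZl; last by move=> *; exact: shell_term_ge0.
  over.
have t0 j N : 0 <= (j`!%:R^-1)%:E * shell_term j N eta.
  by rewrite mule_ge0 ?shell_term_ge0// lee_fin invr_ge0.
rewrite nneseries_interchange// [leRHS]eseries_cond [leRHS]eseries_mkcondr.
apply: lee_nneseries => [N _ _|N _]; first by apply: nneseries_ge0.
rewrite (nneseries_split 0 N)// add0n [X in _ + X]eseries0 ?adde0; last first.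
  by move=> j Nj _; rewrite /shell_term ltnNge Nj mule0.
case: N => [|N]; first by rewrite big_geq.
rewrite big_mkord /=.
apply: (@le_trans _ _ ((N.+1`!%:R^-1)%:E * \sum_(j < N.+1) ('C(N.+1, j)%:R%:E *
    spherical_measure (n * N.+1 - m) (@shell_first j N.+1 eta)))); last first.
  apply: lee_wpmul2l; first by rewrite lee_fin invr_ge0.
  exact: sum_spherical_measure_pieces.
rewrite ge0_sume_distrr; last first.
  by move=> j _; rewrite mule_ge0 ?spherical_measure_ge0.
apply: lee_sum => j _; rewrite /shell_term ltn_ord !muleA -!EFinM.
apply: lee_wpmul2r; first exact: spherical_measure_ge0.
have jN : (j <= N.+1)%N by exact/ltnW.
rewrite lee_fin -(bin_fact jN) !natrM.
have f0 k : (k`!%:R != 0 :> R)%R by rewrite pnatr_eq0 -lt0n fact_gt0.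
have C0 : ('C(N.+1, j)%:R != 0 :> R)%R by rewrite pnatr_eq0 -lt0n bin_gt0.
by rewrite -invfM !invfM mulrAC mulVf// mul1r.
Qed.

End kernel_bound.

(** * Monotonicity *)

Section monotonicity.
Import HBNNSimple.
Local Open Scope ereal_scope.
Context {R : realType} {n : nat}.

Lemma norm_le_enorm (x : 'rV[R]_n) : (`|x| <= enorm x)%R.
Proof.
have [->|x0] := eqVneq x 0%R; first by rewrite normr0 enorm_ge0.
have [[i j] /= xij] : exists i, mx_norm x = `|x i.1 i.2|%R.
  by apply: mx_norm_neq0; rewrite -[mx_norm x]/(`|x|%R) normr_eq0.
rewrite -[X in (X <= _)%R]/(mx_norm x) xij -ler_sqr ?nnegrE ?enorm_ge0// enorm_rV_sqr ord1.
by rewrite real_normK ?num_real// (bigD1 j)//= lerDl sumr_ge0// => k _; exact: sqr_ge0.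
Qed.

Lemma seq_gap (L : seq 'rV[R]_n) (r : R) : (forall y, y \in L -> (r < enorm y)%R) ->
  exists k : nat, forall y, y \in L -> (r + k.+1%:R^-1 <= enorm y)%R.
Proof.
elim: L => [|y L IH] gap; first by exists 0%N.
have [z zL|k kL] := IH; first by apply: gap; rewrite inE zL orbT.
have := gap y (mem_head y L); rewrite -subr_gt0 => /ltr_add_invr.
rewrite /= => -[l]; rewrite add0r => ly; exists (maxn k l) => z.
have le_inv p q : (p <= q)%N -> (q.+1%:R^-1 <= p.+1%:R^-1 :> R)%R.
  by move=> pq; rewrite lef_pV2 ?posrE// ler_nat.
rewrite inE => /orP[/eqP ->|/kL].
  by rewrite -lerBrDl; apply: le_trans (ltW ly); apply: le_inv; rewrite leq_maxr.
by apply: le_trans; rewrite lerD2l; apply: le_inv; rewrite leq_maxl.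
Qed.

(** Only finitely many atoms are within distance [r + 1] of the origin, so those
    outside [B_r] stay away from it. *)
Lemma void_closed_ball (r : R) :
  void (closed_eball0 r) = \bigcup_k void (open_eball 0 (r + k.+1%:R^-1)) :> set (config R n).
Proof.
apply/seteqP; split => [g /voidP gr|g [k _ /voidP gk]]; last first.
  apply/voidP => y /gk yk yr; apply: yk; rewrite /open_eball /= subr0.
  by apply: le_lt_trans yr _; rewrite ltrDl invr_gt0.
have [k kgap] : exists k : nat, forall y, y \in atoms g (r + 1) -> (r + k.+1%:R^-1 <= enorm y)%R.
  by apply: seq_gap => y /mem_atoms[/gr yr _]; rewrite ltNge; exact/negP.
exists k => //; apply/voidP => y gy; rewrite /open_eball /= subr0 => yk.
suff : y \in atoms g (r + 1) by move=> /kgap; rewrite leNgt yk.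
apply/mem_atoms; split => //; apply: le_lt_trans (norm_le_enorm y) _.
by apply: lt_le_trans yk _; rewrite lerD2l invf_le1// ler1n.
Qed.

Lemma measurable_void_closed_ball (r : R) :
  measurable (void (closed_eball0 r) : set (borel_config R n)).
Proof.
rewrite void_closed_ball; apply: bigcupT_measurable => k.
by apply: measurable_void; exact: open_open_eball.
Qed.

Lemma void_open_ball_homo (r : R) (k l : nat) : (k <= l)%N ->
  (void (open_eball 0 (r + k.+1%:R^-1)) : set (config R n)) `<=`
  void (open_eball 0 (r + l.+1%:R^-1)).
Proof.
move=> kl g /voidP gk; apply/voidP => y /gk; rewrite /open_eball /= => h yl; apply: h.
by apply: lt_le_trans yl _; rewrite lerD2l lef_pV2 ?posrE// ler_nat.
Qed.

(** The integral of a non-measurable nonnegative function is its lower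
    integral, so it still dominates the integral of a measurable minorant. *)
Lemma integral_le_lower d (T : measurableType d) (P : probability T R) (D : set T)
    (u f : T -> \bar R) : measurable D -> P D = 1 -> measurable_fun setT u ->
  (forall x, 0 <= u x) -> (forall x, u x <= f x) ->
  \int[P]_x u x <= \int[P]_(x in D) f x.
Proof.
move=> mD PD mu u0 uf.
have mCD := measurableC mD.
rewrite -(setvU D) ge0_integral_setU//; [|by rewrite setvU|]; last first.
  by apply/disj_setPS => x [].
rewrite [X in X + _]null_set_integral//; [|exact: measurable_funS mu|]; last first.
  by have := probability_setC P mD; rewrite PD subee.
rewrite add0e !ge0_integralE//; last by move=> x _; exact: le_trans (uf x).
apply: ereal_sup_le => _ [h hu <-]; exists h => // x; apply: le_trans (hu x) _.
by rewrite /patch; case: ifP.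
Qed.

Lemma integral_le_of_simple d (T : measurableType d) (P : {measure set T -> \bar R}) (D : set T)
    (f : T -> \bar R) (M : \bar R) : (forall x, 0 <= f x) ->
  (forall h : {nnsfun T >-> R}, (forall x, (h x)%:E <= (f \_ D) x) ->
     \int[P]_x (h x)%:E <= M) ->
  \int[P]_(x in D) f x <= M.
Proof.
move=> f0 hM; rewrite ge0_integralE//; apply: ge_ereal_sup => _ [h hf <-].
by rewrite -integralT_nnsfun; exact: hM.
Qed.


Lemma UpsilonC (r : R) : Upsilon (~` closed_eball0 r) = void (closed_eball0 r) :> set (config R n).
Proof. by rewrite /Upsilon setCK. Qed.

Local Notation sigma r := (spherical_measure n (closed_eball0 r : set 'rV[R]_n)).

Lemma spherical_measure_ball_fin (r : R) : sigma r \is a fin_num.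
Proof.
rewrite ge0_fin_numE ?spherical_measure_ge0//.
exact: le_lt_trans (spherical_measure_le_lebesgueRn _) (lebn_closed_ball r).
Qed.

Lemma expeR_ball (r : R) : expeR (- sigma r) = (expR (- fine (sigma r)))%:E.
Proof. by rewrite -{1}(fineK (spherical_measure_ball_fin r)). Qed.

(** [B_s] is the union of [B_r] and the annulus, and [S^n] is subadditive and at
    most Lebesgue measure. *)
Lemma expR_ball_le (r s : R) : (r <= s)%R ->
  (expR (- fine (annulus_measure r s (setT : set (borelRn R n)))) * expR (- fine (sigma r)) <=
   expR (- fine (sigma s)))%R.
Proof.
move=> rs; rewrite -expRD ler_expR -opprD lerN2 -lee_fin EFinD.
rewrite !fineK ?spherical_measure_ball_fin ?fin_num_measure//.
apply: (@le_trans _ _ (spherical_measure n (annulus r s `|` closed_eball0 r : set 'rV[R]_n))).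
  apply: le_spherical_measure => x xs.
  by have [xr|xr] := pselect (closed_eball0 r x); [right|left].
apply: le_trans (spherical_measureU _ _ _) _; rewrite leeD2r//.
by rewrite annulus_measureE setTI; exact: spherical_measure_le_lebesgueRn.
Qed.

Lemma codim_measure_ge0 m (r : R) (B : set (config R n)) : 0 <= codim_measure m r B.
Proof.
rewrite /codim_measure mule_ge0 ?expeR_ge0// nneseries_ge0// => k _ _.
by rewrite mule_ge0 ?spherical_measure_ge0// lee_fin invr_ge0.
Qed.

Section two_radii.
Variables (A : set (config R n)) (m : nat) (r s : R) (P Q : probability (borel_config R n) R).
Hypotheses (le_mn : (m <= n)%N) (r0 : (0 <= r)%R) (le_rs : (r <= s)%R).
Hypotheses (Ppoisson : is_poisson_measure (~` closed_eball0 r) P).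
Hypotheses (Qpoisson : is_poisson_measure (~` closed_eball0 s) Q).

Lemma integral_poisson_shift (u : borel_config R n -> \bar R) :
  measurable_fun setT u -> (forall g, 0 <= u g) ->
  \int[P]_g u g = \int[Q]_eta \sum_(j <oo)
    (expR (- fine (annulus_measure r s (setT : set (borelRn R n)))) / j`!%:R)%:E *
    iter j (add_mean (annulus_measure r s)) u eta.
Proof.
move=> mu u0.
rewrite (@eq_measure_integral _ _ _ _ (add_poisson (annulus_measure r s) Q)); last first.
  by move=> C mC _; exact: poisson_superposition.
rewrite integral_add_poisson// integral_nneseries//.
- apply: eq_eseriesr => j _; rewrite ge0_integralZl//.
  + by have [] := iter_add_mean (annulus_measure r s) j mu u0.
  + by move=> eta _; have [_] := iter_add_mean (annulus_measure r s) j mu u0; apply.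
- move=> j; apply: measurable_funeM.
  by have [] := iter_add_mean (annulus_measure r s) j mu u0.
- move=> j eta _; rewrite mule_ge0//.
  by have [_] := iter_add_mean (annulus_measure r s) j mu u0; apply.
Qed.

(** The inequality for a measurable minorant that only sees configurations at
    distance [delta] from [B_r]: integrate the added points, then collect the terms
    with the same total number of points. *)
Lemma integral_separated_le (delta : R) (u : borel_config R n -> \bar R) : (0 < delta)%R ->
  measurable_fun setT u -> (forall g, 0 <= u g) ->
  (forall eta, ~ void (open_eball 0 (r + delta)) eta -> u eta = 0) ->
  (forall eta, u eta <= codim_measure m r (config_section A eta r)) ->
  \int[P]_g u g <= \int[Q]_(eta in Upsilon (~` closed_eball0 s))
    codim_measure m s (config_section A eta s).
Proof.
move=> delta0 mu u0 uvoid ule; rewrite integral_poisson_shift//.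
set L := annulus_measure r s; set c := expR (- fine _).
have w0 j : (0 <= c / j`!%:R)%R by rewrite divr_ge0 ?expR_ge0.
have mK j : measurable_fun setT (iter j (add_mean L) u : borel_config R n -> \bar R).
  by have [] := iter_add_mean L j mu u0.
have K0 j eta : 0 <= iter j (add_mean L) u eta.
  by have [_] := iter_add_mean L j mu u0; apply.
apply: integral_le_lower.
- by rewrite UpsilonC; exact: measurable_void_closed_ball.
- by case: Qpoisson.
- apply: ge0_emeasurable_sum => j *; last exact: measurable_funeM.
  by rewrite mule_ge0 ?lee_fin.
- by move=> eta; apply: nneseries_ge0 => j _ _; rewrite mule_ge0 ?lee_fin.
move=> eta; set cr := expR (- fine (sigma r)).
have Kle j : iter j (add_mean L) u eta <= cr%:E * \sum_(N <oo) shell_term A m r s delta j N eta.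
  apply: iter_add_mean_shell_le => //; first exact: expR_ge0.
  by move=> g; apply: le_trans (ule g) _; rewrite -expeR_ball; exact: codim_measure_le_shell.
have t0 j : 0 <= \sum_(N <oo) shell_term A m r s delta j N eta.
  by apply: nneseries_ge0 => *; exact: shell_term_ge0.
apply: (@le_trans _ _ ((c * cr)%:E * \sum_(j <oo) (j`!%:R^-1)%:E *
    \sum_(N <oo) shell_term A m r s delta j N eta)).
  rewrite -nneseriesZl; last by move=> j _; rewrite mule_ge0// lee_fin invr_ge0.
  apply: lee_nneseries => j _; first by rewrite mule_ge0 ?lee_fin.
  apply: (@le_trans _ _ ((c / j`!%:R)%:E * (cr%:E *
    \sum_(N <oo) shell_term A m r s delta j N eta))); first by apply: lee_wpmul2l; rewrite ?lee_fin.
  by rewrite !muleA -!EFinM mulrAC.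
rewrite /codim_measure expeR_ball; apply: lee_pmul.
- by rewrite lee_fin mulr_ge0 ?expR_ge0.
- by apply: nneseries_ge0 => j _ _; rewrite mule_ge0// lee_fin invr_ge0.
- by rewrite lee_fin; exact: expR_ball_le.
- exact: series_shell_le.
Qed.

(** Cutting off a simple minorant [h] to configurations that avoid the open balls of
    radius [r + 1 / (k + 1)] gives an increasing sequence with limit [h]. *)
Lemma localised_integral_le :
  \int[P]_(eta in Upsilon (~` closed_eball0 r)) codim_measure m r (config_section A eta r) <=
  \int[Q]_(eta in Upsilon (~` closed_eball0 s)) codim_measure m s (config_section A eta s).
Proof.
set M := (X in _ <= X).
apply: integral_le_of_simple => [eta|h hle]; first exact: codim_measure_ge0.
pose V k : set (borel_config R n) := void (open_eball 0 (r + k.+1%:R^-1)).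
have mV k : measurable (V k) by apply: measurable_void; exact: open_open_eball.
pose hk k eta : \bar R := (h eta * \1_(V k) eta)%:E.
have mhk k : measurable_fun setT (hk k).
  by apply/measurable_EFinP; apply: measurable_funM => //; exact: measurable_indic.
have hk0 k eta : 0 <= hk k eta by rewrite lee_fin mulr_ge0.
have hkh k eta : hk k eta <= (h eta)%:E.
  by rewrite lee_fin ler_piMr// indicE lern1 leq_b1.
have hkE k eta : V k eta -> hk k eta = (h eta)%:E.
  by move=> Vk; rewrite /hk indicE mem_set// mulr1.
have hk_le k : \int[P]_eta hk k eta <= M.
  apply: (@integral_separated_le k.+1%:R^-1) => //.
    by move=> eta nV; rewrite /hk indicE memNset// mulr0.
  move=> eta; apply: le_trans (hkh k eta) _; apply: le_trans (hle eta) _.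
  by rewrite /patch; case: ifP => // _; exact: codim_measure_ge0.
have hk_lim eta : limn (hk ^~ eta) = (h eta)%:E.
  have [D|nD] := pselect (Upsilon (~` closed_eball0 r) eta).
    move: D; rewrite UpsilonC void_closed_ball => -[k _ Vk].
    apply: lim_near_cst => //; exists k => // l /= kl.
    by apply: hkE; exact: void_open_ball_homo Vk.
  have h0 : (h eta)%:E = 0.
    apply/eqP; rewrite eq_le; apply/andP; split; last by rewrite lee_fin.
    by have := hle eta; rewrite /patch memNset.
  rewrite h0; apply: lim_near_cst => //; apply: nearW => k.
  by apply/eqP; rewrite eq_le hk0 andbT -h0.
rewrite (_ : (fun x => _) = (fun x => limn (hk ^~ x))); last by apply/funext.
rewrite monotone_convergence//.
  apply: lime_le; last exact: nearW.
  apply: ereal_nondecreasing_is_cvgn => k l kl; apply: ge0_le_integral => //.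
  move=> eta _; have [Vk|Vk] := pselect (V k eta).
    by rewrite hkE// hkE//; exact: void_open_ball_homo Vk.
  by rewrite {1}/hk indicE memNset// mulr0.
move=> eta _ k l kl; have [Vk|Vk] := pselect (V k eta).
  by rewrite hkE// hkE//; exact: void_open_ball_homo Vk.
by rewrite {1}/hk indicE memNset// mulr0.
Qed.

End two_radii.
End monotonicity.

Theorem theorem3p7 (R : realType) (n m : nat) (le_mn : (m <= n)%N)
    (pi : R -> probability (borel_config R n) R)
    (pi_poisson : forall r : R, 0 < r ->
       is_poisson_measure (~` closed_eball0 r) (pi r))
    (A : set (config R n)) (suslinA : suslin A) (r s : R) :
  0 < r -> r <= s ->
  (localised_codim_measure pi m r A <= localised_codim_measure pi m s A)%E.
Proof.
move=> r0 rs; apply: localised_integral_le => //; first exact: ltW.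
  exact: pi_poisson.
by apply: pi_poisson; exact: lt_le_trans rs.
Qed.
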